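(* Let $\tau>0$ and consider two subsystems $$0=\check F(t,z_1,\dot z_1,u_1),\quad y_1=\check G(t,z_1),\qquad\text{and}\qquad 0=\hat F(t,z_2,\dot z_2,u_2),\quad y_2=\hat G(t,z_2).$$ Assume that the subsystems satisfy Hypothesis H (see context) with strangeness index $\check\mu$ and $\hat\mu$, respectively. Then the shifted hybrid numerical-experimental system $$0=\begin{bmatrix}\check F\big(t,z_1(t),\dot z_1(t),\hat G(t-\tau,z_2(t-\tau))\big)\\ \hat F\big(t,z_2(t),\dot z_2(t),\check G(t,z_1(t))\big)\end{bmatrix}$$ has a well-defined differentiation index, which is at most $\check\mu+\hat\mu+1$.
   Context: Subsystems: $z_i(t)\in\mathbb{R}^{n_i}$, $u_i(t)\in\mathbb{R}^{m_i}$, $y_i(t)\in\mathbb{R}^{p_i}$ with $m_1=p_2$, $m_2=p_1$; $\check F$ and $\hat F$ take values in $\mathbb{R}^{n_1}$ and $\mathbb{R}^{n_2}$; all functions are sufficiently smooth on their (open in state, derivative and input) domains, and the domains are such that the compositions in the coupled system are defined. The state of the hybrid system is $z=[z_1;z_2]\in\mathbb{R}^n$, $n=n_1+n_2$. Hypothesis H for a DAE $F(t,z,\dot z,u)=0$ with $z\in\mathbb{R}^n$, $u\in\mathbb{R}^m$, $F$ with values in $\mathbb{R}^n$: for $\ell\ge 0$ the derivative array is $$\mathcal{D}_\ell(t,z,\eta,u,\dot u,\ldots,u^{(\ell)})=\begin{bmatrix}F(t,z,\dot z,u)\\ \frac{\mathrm d}{\mathrm dt}F(t,z,\dot z,u)\\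 \vdots\\ (\frac{\mathrm d}{\mathrm dt})^\ell F(t,z,\dot z,u)\end{bmatrix}\in\mathbb{R}^{(\ell+1)n},\qquad \eta=[\dot z;\ldots;z^{(\ell+1)}],$$ where the derivatives are formal total derivatives and $t,z,\eta,u,\ldots,u^{(\ell)}$ are regarded as independent variables. The DAE satisfies Hypothesis H with characteristic values $\mu,a,d$ if $d=n-a$ and there exist (smooth) matrix functions $Z_{\mathrm A}(\cdot)\in\mathbb{R}^{(\mu+1)n\times a}$, $T_{\mathrm A}(\cdot)\in\mathbb{R}^{n\times d}$, $Z_{\mathrm D}(\cdot)\in\mathbb{R}^{n\times d}$ of pointwise maximal rank such that for every sufficiently smooth $u$ the set $\mathcal{M}_\mu=\{(t,z,\eta,u,\ldots,u^{(\mu)})\mid \mathcal{D}_\mu(t,z,\eta,u,\ldots,u^{(\mu)})=0\}$ is nonempty and every point of $\mathcal{M}_\mu$ has a neighborhood $\mathcal{U}$ such that on $\mathcal{M}_\mu\cap\mathcal{U}$: (i) $\operatorname{rank}(\frac{\partial}{\partial\eta}\mathcal{D}_\mu)=(\mu+1)n-a$ and $Z_{\mathrm A}^T\frac{\partial}{\partial\eta}\mathcal{D}_\mu=0$; (ii) $\operatorname{rank}(Z_{\mathrm A}^T\frac{\partial}{\partial z}\mathcal{D}_\mu)=a$ and $Z_{\mathrm A}^T(\frac{\partial}{\partial z}\mathcal{D}_\mu)T_{\mathrm A}=0$; (iii) $\operatorname{rank}(\frac{\partial F}{\partial\dot z}T_{\mathrm A})=d$ and $\operatorname{rank}(Z_{\mathrm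 D}^T\frac{\partial F}{\partial\dot z}T_{\mathrm A})=d$. The smallest possible $\mu$ is called the strangeness index. The associated DAE of a delay equation $0=F(t,z(t),\dot z(t),z(t-\tau))$ is the DAE $0=F(t,z,\dot z,u)$ obtained by substituting a control function $u(t)\in\mathbb{R}^n$ for $z(t-\tau)$ (on $[0,\tau)$, $u(t)=\phi(t-\tau)$ is given by a sufficiently smooth history function $\phi$). Differentiation index: the differentiation index of a DAE $0=F(t,z,\dot z,u)$ is the smallest number $\nu\ge 0$ of differentiations such that the equations of the derivative array $\mathcal{D}_\nu=0$ determine (locally) $\dot z$ as a function of $t$, $z$, $u$ and derivatives of $u$, i.e. yield an underlying ordinary differential equation $\dot z=\mathfrak{f}(t,z,u,\dot u,\ldots,u^{(\nu)})$; it is well defined if such a $\nu$ exists. For a DAE satisfying Hypothesis H with strangeness index $\mu$ it equals $\mu+1$ if $\frac{\partial F}{\partial\dot z}$ is singular and $0$ otherwise. The differentiation index of the hybrid delay system is that of its associated DAE. Standing assumption: the subsystem DAEs are regular, i.e. for every sufficiently smooth input the DAE is solvable (has a continuously differentiable solution on the compact time interval under consideration) and the solution is unique for every consistent initial condition (an initial condition is consistent if the initial value problem has at least one solution). *)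

(* Defs.v *)
From HB Require Import structures.
From mathcomp Require Import all_boot all_order all_algebra.
From mathcomp Require Import all_classical all_reals all_analysis.

Set Implicit Arguments.
Unset Strict Implicit.
Unset Printing Implicit Defensive.
Import Order.TTheory GRing.Theory Num.Theory.
Import numFieldNormedType.Exports.

Local Open Scope classical_set_scope.
Local Open Scope ring_scope.

(* States, inputs and values are row vectors.  "Sufficiently smooth" is read
   as C^oo. *)

Section Smoothness.
Context {R : realType} {V W : normedModType R}.

(* For finite-dimensional V, continuity of x |-> 'D_v f x for every v amounts
   to continuity of the differential, so this is the usual class C^k(O). *)
Fixpoint Ck (k : nat) (O : set V) (f : V -> W) : Prop :=
  match k with
  | 0 => forall x, O x -> {for x, continuous f}
  | k'.+1 => (forall x, O x -> differentiable f x) /\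
             forall v : V, Ck k' O (fun x => 'D_v f x)
  end.

(* On a set that need not be open (a closed time interval times an open set)
   C^k means C^k on an open neighbourhood; functions are total, so f itself
   plays the role of the extension. *)
Definition Ck_on (k : nat) (A : set V) (f : V -> W) : Prop :=
  exists2 O : set V, open O /\ A `<=` O & Ck k O f.

Definition smooth_on (A : set V) (f : V -> W) : Prop :=
  exists2 O : set V, open O /\ A `<=` O & forall k, Ck k O f.

End Smoothness.

(* 0 = F(t, z, z', u), with z, z', u ranging over the given sets and t over a
   time interval [0, T] fixed separately. *)
Record dae (R : realType) (n m : nat) := Dae {
  dom_z : set 'rV[R]_n ;
  dom_dz : set 'rV[R]_n ;
  dom_u : set 'rV[R]_m ;
  dae_F : R * 'rV[R]_n * 'rV[R]_n * 'rV[R]_m -> 'rV[R]_n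
}.

Section DAE.
Context {R : realType} {n m : nat}.
Variables (T : R) (A : dae R n m).

Definition dae_dom : set (R * 'rV[R]_n * 'rV[R]_n * 'rV[R]_m) :=
  [set x | [/\ x.1.1.1 \in `[0, T], dom_z A x.1.1.2,
               dom_dz A x.1.2 & dom_u A x.2]].

Definition smooth_dae : Prop :=
  [/\ open (dom_z A), open (dom_dz A), open (dom_u A)
    & smooth_on dae_dom (dae_F A)].

Definition smooth_input (u : R -> 'rV[R]_m) : Prop :=
  smooth_on [set` `[0, T]] u /\ {in `[0, T], forall t, dom_u A (u t)}.

(* A C^1 function on [0, T] extends to a C^1 function on R, and its derivative
   on [0, T] does not depend on the extension. *)
Definition solution (u : R -> 'rV[R]_m) (z : R -> 'rV[R]_n) : Prop :=
  Ck_on 1 [set` `[0, T]] z /\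
  {in `[0, T], forall t, dae_dom (t, z t, derive1 z t, u t) /\
                         dae_F A (t, z t, derive1 z t, u t) = 0}.

Definition regular : Prop :=
  forall u, smooth_input u ->
    (exists z, solution u z) /\
    forall z0 : 'rV[R]_n,                                (* z(0) = z0 *)
      (exists2 z, solution u z & z 0 = z0) ->            (* z0 consistent *)
      forall z z', solution u z -> z 0 = z0 ->
                   solution u z' -> z' 0 = z0 -> {in `[0, T], z =1 z'}.

Section DerivativeArray.
Variable l : nat.

(* Points (t, z, eta, U): row k of eta is z^(k+1) and row k of U is u^(k),
   for k = 0, ..., l. *)
Definition jet : Type :=
  (R * 'rV[R]_n * 'M[R]_(l.+1, n) * 'M[R]_(l.+1, m))%type.

Definition jt (x : jet) : R := x.1.1.1.
Definition jz (x : jet) : 'rV[R]_n := x.1.1.2.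
Definition jeta (x : jet) : 'M[R]_(l.+1, n) := x.1.2.
Definition jU (x : jet) : 'M[R]_(l.+1, m) := x.2.
Definition jdz (x : jet) : 'rV[R]_n := row ord0 (jeta x).
Definition ju (x : jet) : 'rV[R]_m := row ord0 (jU x).

Definition shift_up q (M : 'M[R]_(l.+1, q)) : 'M[R]_(l.+1, q) :=
  \matrix_(k < l.+1, j < q) (if (k < l)%N then M (inord k.+1) j else 0).

(* The formal total derivative d/dt, i.e. the derivative along the vector field
   d_t + z^(k+1) d_{z^(k)} + u^(k+1) d_{u^(k)}.  The truncation in shift_up is
   harmless: for k < l, (d/dt)^k F involves only z, ..., z^(k+1) and
   u, ..., u^(k), so the entries where shift_up puts 0 are never used in
   (d/dt)^k F, k <= l. *)
Definition total_field (x : jet) : jet :=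
  (1, jdz x, shift_up (jeta x), shift_up (jU x)).

Definition total_derive (g : jet -> 'rV[R]_n) : jet -> 'rV[R]_n :=
  fun x => 'D_(total_field x) g x.

Definition jetF (x : jet) : 'rV[R]_n := dae_F A (jt x, jz x, jdz x, ju x).

(* The l+1 blocks (d/dt)^k F, stacked into one vector. *)
Definition deriv_array (x : jet) : 'rV[R]_(l.+1 * n) :=
  mxvec (\matrix_(k < l.+1) iter k total_derive jetF x).

Definition array_set : set jet :=
  [set x | dae_dom (jt x, jz x, jdz x, ju x) /\ deriv_array x = 0].

(* 'J is the matrix of the differential acting on row vectors from the right;
   its transpose is the usual Jacobian (row = equation, column = variable). *)
Definition array_deta (x : jet) : 'M[R]_(l.+1 * n, l.+1 * n) :=
  ('J (fun e => deriv_array (jt x, jz x, vec_mx e, jU x)) (mxvec (jeta x)))^T.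

Definition array_dz (x : jet) : 'M[R]_(l.+1 * n, n) :=
  ('J (fun z => deriv_array (jt x, z, jeta x, jU x)) (jz x))^T.

Definition F_ddz (x : jet) : 'M[R]_(n, n) :=
  ('J (fun p => dae_F A (jt x, jz x, p, ju x)) (jdz x))^T.

Definition input_jet (u : R -> 'rV[R]_m) (t : R) : 'M[R]_(l.+1, m) :=
  \matrix_(k < l.+1) derive1n k u t.

(* The equations D_l = 0 locally yield an ODE z' = f(t, z, u, ..., u^(l)). *)
Definition array_determines_dz : Prop :=
  forall x0, array_set x0 ->
    exists U f,
      [/\ nbhs x0 U,
          exists2 V, nbhs (jt x0, jz x0, jU x0) V & smooth_on V f
        & forall x, array_set x -> U x -> jdz x = f (jt x, jz x, jU x)].

End DerivativeArray.

Definition hypothesis_H (mu a d : nat) : Prop :=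
  d = (n - a)%N /\ (a <= n)%N /\
  exists (ZA : jet mu -> 'M[R]_(mu.+1 * n, a))
         (TA : jet mu -> 'M[R]_(n, d)) (ZD : jet mu -> 'M[R]_(n, d)),
    let M := array_set (l := mu) in
    [/\ [/\ smooth_on M ZA, smooth_on M TA & smooth_on M ZD],
        forall x, M x -> [/\ \rank (ZA x) = a, \rank (TA x) = d
                           & \rank (ZD x) = d],
        forall u, smooth_input u ->
          exists t z eta, M (t, z, eta, input_jet mu u t)
      & forall x0, M x0 -> exists2 U, nbhs x0 U & forall x, M x -> U x ->
          [/\ \rank (array_deta x) = (mu.+1 * n - a)%N /\
                (ZA x)^T *m array_deta x = 0,
              \rank ((ZA x)^T *m array_dz x) = a /\
                (ZA x)^T *m array_dz x *m TA x = 0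
            & \rank (F_ddz x *m TA x) = d /\
                \rank ((ZD x)^T *m F_ddz x *m TA x) = d]].

Definition strangeness_index (mu : nat) : Prop :=
  (exists a d, hypothesis_H mu a d) /\
  forall k, (k < mu)%N -> ~ exists a d, hypothesis_H k a d.

Definition differentiation_index (nu : nat) : Prop :=
  array_determines_dz nu /\
  forall k, (k < nu)%N -> ~ array_determines_dz k.

End DAE.

(* The DAE associated with the shifted hybrid system: u = [u_1; u_2] replaces
   the delayed state z(t - tau), so u ranges over the state domain, and only
   u_2 occurs. *)
Definition hybrid_dae (R : realType) (n1 n2 m1 m2 : nat) (tau : R)
    (A1 : dae R n1 m1) (A2 : dae R n2 m2)
    (G1 : R * 'rV[R]_n1 -> 'rV[R]_m2) (G2 : R * 'rV[R]_n2 -> 'rV[R]_m1) :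
    dae R (n1 + n2) (n1 + n2) :=
  let zdom := [set z | dom_z A1 (lsubmx z) /\ dom_z A2 (rsubmx z)] in
  {| dom_z := zdom ;
     dom_dz := [set p | dom_dz A1 (lsubmx p) /\ dom_dz A2 (rsubmx p)] ;
     dom_u := zdom ;
     dae_F := fun x => let: (t, z, p, u) := x in
       row_mx
         (dae_F A1 (t, lsubmx z, lsubmx p, G2 (t - tau, rsubmx u)))
         (dae_F A2 (t, rsubmx z, rsubmx p, G1 (t, lsubmx z))) |}.

(* Main.v *)
Require Import Defs.
From mathcomp Require Import all_boot all_order all_algebra.
From mathcomp Require Import all_classical all_reals all_analysis.
From HB Require Import structures.
From mathcomp Require Import ring lra zify.
Set Implicit Arguments.
Unset Strict Implicit.
Unset Printing Implicit Defensive.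
Import Order.TTheory GRing.Theory Num.Theory.
Import numFieldNormedType.Exports.
Local Open Scope classical_set_scope.
Local Open Scope ring_scope.

(** Why the differentiation index is at most mu1 + mu2 + 1.

    A jet solves the derivative array of order l exactly when, along a smooth
    curve with this jet, the residual of the equation vanishes to order l + 1
    ([iter_total_lift], [residual_agree]).  The whole argument is therefore
    about curves whose Taylor coefficients agree up to some order ([agree]),
    a relation that smooth maps preserve ([agree_comp]).

    One system with characteristic value mu.  Hypothesis H says that the array
    of order mu has full row rank in (z, eta), so the inverse function theorem
    ([inverse_function]) parametrises its zero set.  The rank conditions also
    say that a tangent vector of the zero set moves z only along the image of
    T_A; hence z does not depend on the free part of eta
    ([constraint_independent]), and every solution satisfies a relation
    z = g(t, u, ..., u^(mu), z B), where z B are the differential components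
    ([constraint_function]).  One differentiation of this relation, together
    with F = 0, is a system whose Jacobian in z' is injective
    ([reduced_map_injective]), which gives z' = h(t, z, u, ..., u^(mu+1)).
    If the residual of a curve vanishes to order mu + k + 1, then the curve
    satisfies this equation to order k ([explicit_ode]).

    The hybrid system.  Put N = mu1 + mu2 + 1.  The input of the first
    subsystem depends on t and on the delayed state only, and
    N + 1 = mu1 + (mu2 + 1) + 1, so its explicit equation holds to order
    mu2 + 1.  Differentiating it repeatedly yields z1', ..., z1^(mu2+2)
    successively ([state1_determined]), more than enough for
    u2 = G1(t, z1) and its derivatives up to order mu2 + 1.  These are all that
    the explicit equation of the second subsystem contains, and that equation
    holds at the point because N + 1 >= mu2 + 2.  So the array of order N
    determines z' ([hybrid_determines]), and the least order with this property
    is at most N. *)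

(** * Differentiability and the classes C^k *)

HB.instance Definition _ (R : realType) (m n : nat) := Complete.on 'M[R]_(m, n).

Section Differentiability.
Context {R : realType}.
Implicit Types V W : normedModType R.

(** An epsilon form of differentiability; it avoids Landau notation where the
    remainder has to be estimated by hand, as in [solution_derive]. *)
Lemma differentiable_epsP V W (f : V -> W) x (L : {linear V -> W}) : continuous L ->
  (forall e : R, 0 < e -> \forall h \near 0, `|f (h + x) - f x - L h| <= e * `|h|) ->
  differentiable f x /\ forall v, 'D_v f x = L v.
Proof.
move=> cL H.
have E : f \o shift x = cst (f x) + L +o_ 0 id.
  apply/eqaddoP => e e0; near=> h.
  have : `|f (h + x) - f x - L h| <= e * `|h| by near: h; exact: H.
  by rewrite /= opprD addrA.
have dE := diff_unique cL E.
have df : differentiable f x by apply/diff_locallyP; rewrite dE.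
by split=> // v; rewrite deriveE// dE.
Unshelve. all: by end_near. Qed.

Lemma differentiable_eps V W (f : V -> W) x : differentiable f x ->
  forall e : R, 0 < e -> \forall h \near 0, `|f (h + x) - f x - 'D_h f x| <= e * `|h|.
Proof.
move=> df e e0; have /diff_locally /eqaddoP /(_ _ e0) := df.
apply: filterS => h; rewrite deriveE //.
by rewrite /= -![(_ + _) h]/(_ + _) /= opprD addrA.
Qed.

Lemma differentiable_near_eq V W (f g : V -> W) x :
  (\forall y \near x, f y = g y) -> differentiable f x -> differentiable g x.
Proof.
move=> fg df; have cd : continuous ('d f x) by exact: diff_continuous.
apply: (proj1 (differentiable_epsP cd _)) => e e0.
have := differentiable_eps df e0.
have : \forall h \near 0, f (h + x) = g (h + x).
  by move: fg; rewrite (near_shift 0) /=; apply: filterS => y; rewrite subr0.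
apply: filterS2 => h -> /=.
by rewrite (nbhs_singleton fg) deriveE.
Qed.

Lemma scale_bilinear W : bilinear_for
    (GRing.Scale.Law.clone _ _ *:%R _) (GRing.Scale.Law.clone _ _ *:%R _)
    (@GRing.scale R W).
Proof.
by split=> [w|a] c x y /=; rewrite ?scalerDl ?scalerDr !scalerA // mulrC.
Qed.
HB.instance Definition _ W := bilinear_isBilinear.Build R R W W _ _ (@GRing.scale R W)
    (@scale_bilinear W).

(** Leibniz rule, from the differential of the bilinear map (a, w) |-> a *: w. *)
Lemma is_diff_scale V W (f : V -> R) (g : V -> W) x :
  differentiable f x -> differentiable g x ->
  differentiable (fun y => f y *: g y) x /\
  forall v, 'D_v (fun y => f y *: g y) x = 'D_v f x *: g x + f x *: 'D_v g x.
Proof.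
move=> df dg.
pose B : {bilinear R -> W -> W} := @GRing.scale R W.
have cB : continuous (fun p : R * W => B p.1 p.2).
  by move=> p; apply: cvgZ; [exact: cvg_fst|exact: cvg_snd].
have dB := differentiable_bilin (f x, g x) cB.
have dp : differentiable (fun y => (f y, g y)) x by exact: differentiable_pair.
have E : (fun y => f y *: g y) = (fun p => B p.1 p.2) \o (fun y => (f y, g y)) by [].
have dC : differentiable (fun y => f y *: g y) x by rewrite E; exact: differentiable_comp.
split=> // v; rewrite deriveE // E diff_comp // /= diff_bilin // diff_pair //=.
by rewrite /B !deriveE // addrC.
Qed.

End Differentiability.

Section Ck_basic.
Context {R : realType}.
Implicit Types V W : normedModType R.

Lemma CkW V W k (O O' : set V) (f : V -> W) : O' `<=` O -> Ck k O f -> Ck k O' f.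
Proof.
move=> sO; elim: k f => [|k IH] f /=; first by move=> h x /sO; exact: h.
by move=> [h1 h2]; split=> [x /sO|v]; [exact: h1|exact: IH].
Qed.

Lemma near_open V (O : set V) x (P : set V) : open O -> O x -> O `<=` P ->
  \forall y \near x, P y.
Proof. by move=> oO Ox s; apply: filterS s _; exact: open_nbhs_nbhs. Qed.

(** Openness of O is essential: the derivatives only see a neighbourhood. *)
Lemma Ck_ext V W k (O : set V) (f g : V -> W) : open O ->
  (forall x, O x -> f x = g x) -> Ck k O f -> Ck k O g.
Proof.
move=> oO; elim: k f g => [|k IH] f g fg /=.
  move=> h x Ox; have := h x Ox.
  rewrite /continuous_at /prop_for (fg _ Ox); apply: cvg_trans.
  by apply: near_eq_cvg; apply: near_open oO Ox _ => y /fg.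
move=> [h1 h2]; split=> [x Ox|v].
  apply: differentiable_near_eq (h1 x Ox).
  by apply: near_open oO Ox _ => y /fg.
apply: IH (h2 v) => x Ox; apply: near_eq_derive.
by apply: near_open oO Ox _ => y /fg.
Qed.

Lemma CkS V W k (O : set V) (f : V -> W) : Ck k.+1 O f -> Ck k O f.
Proof.
elim: k f => [|k IH] f.
  by move=> [h _] x /h /differentiable_continuous.
by move=> [h1 h2]; split => // v; apply: IH.
Qed.

Lemma Ck_cst V W k (O : set V) (c : W) : Ck k O (cst c).
Proof.
elim: k c => [|k IH] c /=; first by move=> x _; exact: cst_continuous.
split=> [x _|v]; first exact: differentiable_cst.
by rewrite (_ : (fun x => _) = cst 0); [exact: IH|apply/funext=> x; rewrite derive_cst].
Qed.

Lemma Ck_add V W k (O : set V) (f g : V -> W) : open O ->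
  Ck k O f -> Ck k O g -> Ck k O (fun x => f x + g x).
Proof.
move=> oO; elim: k f g => [|k IH] f g.
  by move=> hf hg x Ox; apply: continuousD; [exact: hf|exact: hg].
move=> [f1 f2] [g1 g2]; split=> [x Ox|v].
  by apply: differentiableD; [exact: f1|exact: g1].
apply: Ck_ext (IH _ _ (f2 v) (g2 v)) => // x Ox.
by rewrite deriveD//; apply: diff_derivable; [exact: f1|exact: g1].
Qed.

Lemma Ck_scale V W k (O : set V) (f : V -> R) (g : V -> W) : open O ->
  Ck k O f -> Ck k O g -> Ck k O (fun x => f x *: g x).
Proof.
move=> oO; elim: k f g => [|k IH] f g.
  by move=> hf hg x Ox; apply: cvgZ; [exact: hf|exact: hg].
move=> hf hg; have [f1 f2] := hf; have [g1 g2] := hg; split=> [x Ox|v].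
  by apply (is_diff_scale (f1 _ Ox) (g1 _ Ox)).1.
apply: Ck_ext (Ck_add oO (IH _ _ (f2 v) (CkS hg)) (IH _ _ (CkS hf) (g2 v))) => // x Ox.
by rewrite (is_diff_scale (f1 _ Ox) (g1 _ Ox)).2.
Qed.

Lemma Ck_sum V W k (O : set V) (I : Type) (r : seq I) (f : I -> V -> W) : open O ->
  (forall i, Ck k O (f i)) -> Ck k O (fun x => \sum_(i <- r) f i x).
Proof.
move=> oO hf; elim: r => [|i r IH].
  by rewrite (_ : (fun x => _) = cst 0); [exact: Ck_cst|apply/funext=> x; rewrite big_nil].
apply: Ck_ext (Ck_add oO (hf i) IH) => // x _.
by rewrite big_cons.
Qed.

End Ck_basic.

(** * Finite-dimensional normed modules *)
Section Findim.
Context {R : realType}.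

(** A finite coordinate system with continuous coordinates.  It turns a
    derivative in a moving direction into a finite combination of derivatives in
    fixed directions, which is what [Ck] speaks of. *)
Class findim (V : normedModType R) : Prop := findimP :
  exists (I : finType) (e : I -> V) (c : I -> {linear V -> R}),
    (forall i, continuous (c i)) /\ forall v, v = \sum_i c i v *: e i.

#[global] Instance findim_R : findim R.
Proof.
exists unit, (fun=> 1), (fun=> idfun); split=> [_ x //|v].
by rewrite (big_pred1 tt) /=; [rewrite -[_ *: _]/(_ * _) mulr1|case].
Qed.

#[global] Instance findim_mx m n : findim 'M[R]_(m, n).
Proof.
have c (ij : 'I_m * 'I_n) : {f : {linear 'M[R]_(m, n) -> R} | f =1 fun M => M ij.1 ij.2}.
  have lf : linear (fun M : 'M[R]_(m, n) => M ij.1 ij.2 : R).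
    by move=> a x y; rewrite !mxE.
  pose L := GRing.isLinear.Build _ _ _ _ _ lf.
  pose F : {linear 'M[R]_(m, n) -> R} := HB.pack (fun M : 'M[R]_(m, n) => M ij.1 ij.2 : R) L.
  by exists F.
exists ('I_m * 'I_n)%type, (fun ij => delta_mx ij.1 ij.2), (fun ij => sval (c ij)); split.
  move=> ij; have -> : (sval (c ij) : 'M[R]_(m, n) -> R) = (fun M => M ij.1 ij.2).
    by apply/funext => M; rewrite (svalP (c ij)).
  exact: coord_continuous.
move=> M; rewrite [LHS]matrix_sum_delta pair_big /=.
by apply: eq_bigr => ij _; rewrite (svalP (c ij)).
Qed.

#[global] Instance findim_prod (V W : normedModType R) :
  findim V -> findim W -> findim (V * W)%type.
Proof.
move=> [I [e [c [cc ce]]]] [J [f [d [dc de]]]].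
have lc i : linear (fun p : V * W => c i p.1) by move=> a x y; rewrite /= linearP.
have ld j : linear (fun p : V * W => d j p.2) by move=> a x y; rewrite /= linearP.
pose Lc i := GRing.isLinear.Build _ _ _ _ _ (lc i).
pose Ld j := GRing.isLinear.Build _ _ _ _ _ (ld j).
pose C i : {linear _ -> _} := HB.pack (fun p : V * W => c i p.1) (Lc i).
pose D j : {linear _ -> _} := HB.pack (fun p : V * W => d j p.2) (Ld j).
exists (I + J)%type, (fun k => match k with inl i => (e i, 0) | inr j => (0, f j) end),
  (fun k => match k with inl i => C i | inr j => D j end); split.
  case=> [i|j] p.
    by apply: (@continuous_comp _ _ _ fst (c i)); [exact: cvg_fst|exact: cc].
  by apply: (@continuous_comp _ _ _ snd (d j)); [exact: cvg_snd|exact: dc].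
move=> [v w]; rewrite big_sumType /=.
under eq_bigr do rewrite -[_ *: (_, _)]/(_ *: _, _ *: _) scaler0.
under [X in _ = _ + X]eq_bigr do rewrite -[_ *: (_, _)]/(_ *: _, _ *: _) scaler0.
have E1 (r : seq I) (F : I -> V) : \sum_(i <- r) (F i, 0 : W) = (\sum_(i <- r) F i, 0).
  by elim/big_rec2 : _ => // i x y _ ->; rewrite -[LHS]/(_ + _, _ + _) addr0.
have E2 (r : seq J) (F : J -> W) : \sum_(i <- r) (0 : V, F i) = (0, \sum_(i <- r) F i).
  by elim/big_rec2 : _ => // i x y _ ->; rewrite -[LHS]/(_ + _, _ + _) addr0.
by rewrite E1 E2 -[RHS]/(_ + _, _ + _) addr0 add0r -ce -de.
Qed.

Context {V W : normedModType R}.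

Lemma findim_continuous (f : V -> W) : findim V -> linear f -> continuous f.
Proof.
move=> [I [e [c [cc ce]]]] lf.
pose L := GRing.isLinear.Build _ _ _ _ _ lf.
pose F : {linear _ -> _} := HB.pack f L.
have -> : f = fun v => \sum_i c i v *: f (e i).
  apply/funext => v; rewrite -[f v]/(F v) [in LHS](ce v) linear_sum.
  by apply: eq_bigr => i _; rewrite linearZ.
move=> v; apply: (@Ck_sum R V W 0 setT) => // [|i w _]; first exact: openT.
by apply: cvgZ; [exact: cc|exact: cvg_cst].
Qed.

Lemma is_diff_linear (f : V -> W) x : findim V -> linear f ->
  differentiable f x /\ forall v, 'D_v f x = f v.
Proof.
move=> fV lf; have cf := findim_continuous fV lf.
pose L := GRing.isLinear.Build _ _ _ _ _ lf.
pose F : {linear _ -> _} := HB.pack f L.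
have dF : differentiable (F : V -> W) x by exact: linear_differentiable.
by split => // v; rewrite -[f]/(F : _ -> _) deriveE // diff_lin.
Qed.

Lemma Ck_linear k (O : set V) (f : V -> W) : findim V -> linear f -> Ck k O f.
Proof.
move=> fV lf; case: k => [|k] /=; first by move=> x _; exact: findim_continuous.
split=> [x _|v]; first by apply (is_diff_linear x fV lf).1.
rewrite (_ : (fun x => _) = cst (f v)); first exact: Ck_cst.
by apply/funext => x; rewrite (is_diff_linear x fV lf).2.
Qed.

End Findim.

Section Ck_comp.
Context {R : realType}.
Implicit Types U V W : normedModType R.

Lemma Ck_pair U V W k (O : set U) (f : U -> V) (g : U -> W) : open O ->
  Ck k O f -> Ck k O g -> Ck k O (fun x => (f x, g x)).
Proof.
move=> oO; elim: k f g => [|k IH] f g.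
  by move=> hf hg x Ox; apply: cvg_pair; [exact: hf|exact: hg].
move=> [f1 f2] [g1 g2]; split=> [x Ox|v].
  by apply: differentiable_pair; [exact: f1|exact: g1].
apply: Ck_ext (IH _ _ (f2 v) (g2 v)) => // x Ox.
have df := f1 _ Ox; have dg := g1 _ Ox.
by rewrite !deriveE ?diff_pair //; exact: differentiable_pair.
Qed.

Lemma derive_comp U V W (f : U -> V) (g : V -> W) x v :
  differentiable f x -> differentiable g (f x) ->
  'D_v (fun y => g (f y)) x = 'D_('D_v f x) g (f x).
Proof.
move=> df dg; have dc := differentiable_comp df dg.
by rewrite -[fun y => _]/(g \o f) !deriveE // diff_comp.
Qed.

Lemma derive_sumE U V (I : finType) (c : I -> R) (e : I -> U) (f : U -> V) x :
  differentiable f x ->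
  'D_(\sum_i c i *: e i) f x = \sum_i c i *: 'D_(e i) f x.
Proof.
move=> df; rewrite deriveE // linear_sum; apply: eq_bigr => i _.
by rewrite linearZ deriveE.
Qed.

Lemma Ck_comp_linear U V W k (O : set U) (f : U -> V) (g : V -> W) : open O ->
  findim V -> linear g -> Ck k O f -> Ck k O (fun x => g (f x)).
Proof.
move=> oO fV lg; elim: k f => [|k IH] f.
  by move=> hf x Ox; apply: continuous_comp; [exact: hf|exact: findim_continuous].
move=> [f1 f2]; split=> [x Ox|v].
  by apply: differentiable_comp; [exact: f1|apply (is_diff_linear _ fV lg).1].
apply: Ck_ext (IH _ (f2 v)) => // x Ox.
have [dg gE] := is_diff_linear (f x) fV lg.
by rewrite (derive_comp (f := f) (g := g)) ?gE //; exact: f1.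
Qed.

(** The chain rule writes the derivative of g o f as a sum of products of
    coordinates of the derivative of f with partial derivatives of g along f,
    which are of class C^k by induction. *)
Lemma Ck_comp U V W k (O : set U) (O' : set V) (f : U -> V) (g : V -> W) :
  findim V -> open O -> open O' -> (forall x, O x -> O' (f x)) ->
  Ck k O f -> Ck k O' g -> Ck k O (fun x => g (f x)).
Proof.
move=> fV oO oO' OO'; elim: k f g OO' => [|k IH] f g OO'.
  by move=> hf hg x Ox; apply: continuous_comp; [exact: hf|exact/hg/OO'].
move=> hf hg; have [f1 f2] := hf; have [g1 g2] := hg; split=> [x Ox|v].
  by apply: differentiable_comp; [exact: f1|exact/g1/OO'].
have [I [e [c [cc ce]]]] := fV.
have H i : Ck k O (fun x => c i ('D_v f x) *: 'D_(e i) g (f x)).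
  have h1 : Ck k O (fun x => 'D_(e i) g (f x)).
    by apply: (IH f (fun y => 'D_(e i) g y)) OO' (CkS hf) _; exact: g2.
  apply: (Ck_scale oO _ h1).
  by apply: (Ck_comp_linear (f := fun x => 'D_v f x) oO fV _ (f2 v)) => a x y; rewrite linearP.
apply: Ck_ext (Ck_sum (index_enum I) oO H) => // x Ox.
rewrite (derive_comp (f := f) (g := g)); [|exact: f1|exact/g1/OO'].
by rewrite [in RHS](ce ('D_v f x)) derive_sumE //; exact/g1/OO'.
Qed.

Lemma Ck_inv k : Ck k [set x : R | x != 0] (fun x => x^-1).
Proof.
have oO : open [set x : R | x != 0] by exact: open_neq.
elim: k => [|k IH]; first by move=> x x0; exact: inv_continuous.
split=> [x x0|v]; first exact: differentiable_Rinv.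
have H : Ck k [set x : R | x != 0] (fun x => x^-1 *: (x^-1 *: (- v))).
  by apply: Ck_scale => //; apply: Ck_scale => //; exact: Ck_cst.
apply: Ck_ext H => // x x0.
rewrite (@deriveV _ _ id x v x0 (@derivable_id _ _ x v)) derive_id.
by rewrite scalerA scalerN scaleNr -invfM -expr2.
Qed.

End Ck_comp.

(** * Germs of smooth maps *)
Section smooth_at.
Context {R : realType}.
Implicit Types U V W : normedModType R.

(** The neighbourhood does not depend on the order k, so that [smooth_at] is
    the germ form of [smooth_on]. *)
Definition smooth_at V W (f : V -> W) (x : V) :=
  exists2 O : set V, open_nbhs x O & forall k, Ck k O f.

Lemma smooth_at_on V W (A : set V) (f : V -> W) x : smooth_on A f -> A x -> smooth_at f x.
Proof. by move=> [ O [ oO AO] h] Ax; exists O => //; split=> //; exact: AO. Qed.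

Lemma smooth_at_smooth_on V W (f : V -> W) x : smooth_at f x ->
  exists2 A, nbhs x A & smooth_on A f.
Proof.
move=> [ O Ox h]; exists O; first exact: open_nbhs_nbhs.
by exists O => //; split; [case: Ox|].
Qed.

Lemma smooth_at_near V W (f : V -> W) x : smooth_at f x -> \forall y \near x, smooth_at f y.
Proof.
move=> [ O [ oO Ox] h]; by apply: (near_open oO Ox) => y Oy; exists O.
Qed.

Lemma smooth_at_ext V W (f g : V -> W) x :
  (\forall y \near x, f y = g y) -> smooth_at f x -> smooth_at g x.
Proof.
move=> fg; have : nbhs x [set y | f y = g y] by exact: fg.
rewrite nbhsE => -[ O' [ oO' O'x] h] [ O [ oO Ox] hf].
exists (O `&` O'); first by split; [exact: openI|].
move=> k; apply: (@Ck_ext _ _ _ _ _ f) => [|y [_ /h //]|]; first exact: openI.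
by apply: CkW (hf k) => y [].
Qed.

Lemma smooth_at_eq V W (f g : V -> W) x : f =1 g -> smooth_at f x -> smooth_at g x.
Proof. by move=> /funext->. Qed.

Lemma smooth_at_cst V W (c : W) (x : V) : smooth_at (fun=> c) x.
Proof. by exists setT; [split=> //; exact: openT|move=> k; exact: Ck_cst]. Qed.

Lemma smooth_at_linear V W (f : V -> W) x {fV : findim V} : linear f -> smooth_at f x.
Proof.
by move=> lf; exists setT; [split=> //; exact: openT|move=> k; exact: Ck_linear].
Qed.

Lemma smooth_at_differentiable V W (f : V -> W) x : smooth_at f x -> differentiable f x.
Proof. by move=> [ O [ oO Ox] /(_ 1)[+ _]]; apply. Qed.

Lemma smooth_at_continuous V W (f : V -> W) x : smooth_at f x -> {for x, continuous f}.
Proof. by move=> /smooth_at_differentiable/differentiable_continuous. Qed.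

Lemma smooth_at_derive V W (f : V -> W) v x : smooth_at f x -> smooth_at (fun y => 'D_v f y) x.
Proof. by move=> [ O Ox h]; exists O => // k; have [_] := h k.+1; apply. Qed.

Lemma smooth_at2 U V W (X : normedModType R) (f : U -> V) (g : U -> W) (h : U -> X) x :
  (forall k (O : set U), open O -> Ck k O f -> Ck k O g -> Ck k O h) ->
  smooth_at f x -> smooth_at g x -> smooth_at h x.
Proof.
move=> H [ O [ oO Ox] hf] [ O' [ oO' O'x] hg].
have oI : open (O `&` O') by exact: openI.
exists (O `&` O') => // k.
by apply: H => //; [apply: CkW (hf k)|apply: CkW (hg k)] => y [].
Qed.

Lemma smooth_at_add V W (f g : V -> W) x :
  smooth_at f x -> smooth_at g x -> smooth_at (fun y => f y + g y) x.
Proof. by apply: smooth_at2 => k O; exact: Ck_add. Qed.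

Lemma smooth_at_scale V W (f : V -> R) (g : V -> W) x :
  smooth_at f x -> smooth_at g x -> smooth_at (fun y => f y *: g y) x.
Proof. by apply: smooth_at2 => k O; exact: Ck_scale. Qed.

Lemma smooth_at_pair U V W (f : U -> V) (g : U -> W) x :
  smooth_at f x -> smooth_at g x -> smooth_at (fun y => (f y, g y)) x.
Proof. by apply: smooth_at2 => k O; exact: Ck_pair. Qed.

Lemma smooth_at_opp V W (f : V -> W) x : smooth_at f x -> smooth_at (fun y => - f y) x.
Proof.
move=> hf; have := smooth_at_scale (smooth_at_cst (-1 : R) x) hf.
by apply: smooth_at_ext; apply: nearW => y; rewrite scaleN1r.
Qed.

Lemma smooth_at_sub V W (f g : V -> W) x :
  smooth_at f x -> smooth_at g x -> smooth_at (fun y => f y - g y) x.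
Proof. by move=> hf hg; apply: smooth_at_add => //; exact: smooth_at_opp. Qed.

Lemma smooth_at_sum V W (I : Type) (r : seq I) (f : I -> V -> W) x :
  (forall i, smooth_at (f i) x) -> smooth_at (fun y => \sum_(i <- r) f i y) x.
Proof.
move=> hf; elim: r => [|i r IH].
  by apply: smooth_at_ext (smooth_at_cst 0 x); apply: nearW => y; rewrite big_nil.
by apply: smooth_at_ext (smooth_at_add (hf i) IH); apply: nearW => y; rewrite big_cons.
Qed.

Lemma smooth_at_prod V (I : Type) (r : seq I) (f : I -> V -> R) x :
  (forall i, smooth_at (f i) x) -> smooth_at (fun y => \prod_(i <- r) f i y) x.
Proof.
move=> hf; elim: r => [|i r IH].
  by apply: smooth_at_ext (smooth_at_cst (1 : R) x); apply: nearW => y; rewrite big_nil.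
by apply: smooth_at_ext (smooth_at_scale (hf i) IH); apply: nearW => y; rewrite big_cons.
Qed.

Lemma smooth_at_comp U V W (g : V -> W) (f : U -> V) x {fV : findim V} :
  smooth_at g (f x) -> smooth_at f x -> smooth_at (fun y => g (f y)) x.
Proof.
move=> [ O' [ oO' O'x] hg] [ O [ oO Ox] hf].
have : nbhs x (O `&` f @^-1` O').
  apply: filterI; first exact: open_nbhs_nbhs.
  by have /(_ _ Ox) := hf 0; apply; exact: open_nbhs_nbhs.
rewrite nbhsE => -[ O1 O1x sub]; exists O1 => // k.
apply: (Ck_comp (O' := O')) => //; [exact: O1x.1|by move=> y /sub[]|].
by apply: CkW (hf k) => y /sub[].
Qed.

Lemma smooth_at_inv V (f : V -> R) x : f x != 0 -> smooth_at f x ->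
  smooth_at (fun y => (f y)^-1) x.
Proof.
move=> fx hf; apply: (smooth_at_comp (g := fun y : R => y^-1) (f := f)) => //.
exists [set x : R | x != 0]; last by move=> k; exact: Ck_inv.
by split=> //; exact: open_neq.
Qed.

Lemma smooth_at_mxP V m n (f : V -> 'M[R]_(m, n)) x :
  smooth_at f x <-> forall i j, smooth_at (fun y => f y i j : R) x.
Proof.
split=> [hf i j|hf].
  apply: (smooth_at_comp (g := fun M : 'M[R]_(m, n) => M i j : R) (f := f)) => //.
  by apply: smooth_at_linear => a y z; rewrite !mxE.
have H := smooth_at_sum (index_enum 'I_m) (fun i => smooth_at_sum (index_enum 'I_n)
  (fun j => smooth_at_scale (hf i j) (smooth_at_cst (delta_mx i j : 'M[R]_(m, n)) x))).
by apply: smooth_at_ext H; apply: nearW => y; rewrite -matrix_sum_delta.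
Qed.

Lemma smooth_at_mulmx V m n p (A : V -> 'M[R]_(m, n)) (B : V -> 'M[R]_(n, p)) x :
  smooth_at A x -> smooth_at B x -> smooth_at (fun y => A y *m B y) x.
Proof.
move=> /smooth_at_mxP hA /smooth_at_mxP hB; apply/smooth_at_mxP => i j.
have H := smooth_at_sum (index_enum 'I_n) (fun k => smooth_at_scale (hA i k) (hB k j)).
by apply: smooth_at_ext H; apply: nearW => y; rewrite mxE.
Qed.

Lemma smooth_at_det V n (A : V -> 'M[R]_n) x :
  smooth_at A x -> smooth_at (fun y => \det (A y)) x.
Proof.
move=> /smooth_at_mxP hA.
apply: smooth_at_sum => s; apply: (smooth_at_scale (smooth_at_cst _ x)).
by apply: smooth_at_prod => i; exact: hA.
Qed.

Lemma near_unitmx V n (A : V -> 'M[R]_n) x : A x \in unitmx ->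
  smooth_at A x -> \forall y \near x, A y \in unitmx.
Proof.
move=> Ax hA; have hd := smooth_at_det hA.
have dx : \det (A x) != 0 by move: Ax; rewrite unitmxE unitfE.
have : \forall y \near x, \det (A y) != 0.
  have : nbhs (\det (A x)) [set d : R | d != 0].
    by apply: open_nbhs_nbhs; split; [exact: open_neq|exact: dx].
  by move/(smooth_at_continuous hd).
apply: filterS => y /=.
by rewrite unitmxE unitfE.
Qed.

(** Cramer's rule: determinants are polynomials in the entries. *)
Lemma smooth_at_invmx V n (A : V -> 'M[R]_n) x : A x \in unitmx ->
  smooth_at A x -> smooth_at (fun y => invmx (A y)) x.
Proof.
move=> Ax hA; have hd := smooth_at_det hA.
have dx : \det (A x) != 0 by move: Ax; rewrite unitmxE unitfE.
have H : smooth_at (fun y => (\det (A y))^-1 *: \adj (A y)) x.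
  apply: smooth_at_scale; first exact: smooth_at_inv.
  apply/smooth_at_mxP => i j.
  have : smooth_at (fun y => cofactor (A y) j i) x.
    apply: (smooth_at_scale (smooth_at_cst _ x)); apply: smooth_at_det.
    apply/smooth_at_mxP => i' j'.
    move/smooth_at_mxP : hA => /(_ (lift j i') (lift i j')).
    by apply: smooth_at_ext; apply: nearW => y; rewrite !mxE.
  by apply: smooth_at_ext; apply: nearW => y; rewrite mxE.
apply: smooth_at_ext H.
move: (near_unitmx Ax hA); apply: filterS => y Ay.
by rewrite /invmx Ay.
Qed.

End smooth_at.

(** * Mean value inequality *)
Section MeanValue.
Context {R : realType} {V : normedModType R}.

Lemma smooth_at_Ck (W : normedModType R) (O : set V) (f : V -> W) k :
  (forall x, O x -> smooth_at f x) -> Ck k O f.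
Proof.
elim: k f => [|k IH] f hf; first by move=> x /hf/smooth_at_continuous.
split=> [x /hf/smooth_at_differentiable //|v].
by apply: IH => x /hf; exact: smooth_at_derive.
Qed.

Lemma derive_line (W : normedModType R) (f : V -> W) x v (s : R) :
  differentiable f (x + s *: v) ->
  differentiable (fun s : R => f (x + s *: v)) s /\
  'D_1 (fun s : R => f (x + s *: v)) s = 'D_v f (x + s *: v).
Proof.
move=> df.
have ds : smooth_at (fun s : R => x + s *: v) s.
  apply: smooth_at_add; first exact: smooth_at_cst.
  by apply: smooth_at_linear => a y z; rewrite scalerDl scalerA.
have dd := smooth_at_differentiable ds.
split; first exact: (@differentiable_comp _ _ _ _ (fun s : R => x + s *: v) f).
have lv : linear (fun s : R => s *: v) by move=> a y z; rewrite scalerDl scalerA.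
have [dv vE] := is_diff_linear s (findim_R (R := R)) lv.
rewrite (derive_comp (f := fun s : R => x + s *: v)) //; congr (derive f _ _).
rewrite deriveD; [|exact: derivable_cst|exact: diff_derivable].
by rewrite derive_cst add0r vE scale1r.
Qed.

(** The scalar mean value theorem is applied to each coordinate; the norm of a
    row vector is the maximum of its coordinates. *)
Lemma mean_value_ineq q (f : V -> 'rV[R]_q) x v (M : R) :
  (forall s : R, 0 <= s <= 1 -> differentiable f (x + s *: v) /\
     `|'D_v f (x + s *: v)| <= M) ->
  `|f (x + v) - f x| <= M.
Proof.
move=> H.
have M0 : 0 <= M by have [|_] := H 0; [rewrite lexx ler01|exact: le_trans].
rewrite [leLHS]/Num.Def.normr/= mx_normrE (bigmax_le _ M0)//= => -[i j] _ /=.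
rewrite !ord1 {i}.
pose g s := f (x + s *: v) 0 j.
have dg (s : R) : 0 <= s <= 1 -> is_derive s 1 g ('D_v f (x + s *: v) 0 j).
  move=> s01; have [df _] := H s s01; have [dl dE] := derive_line df.
  have dv : derivable (fun s : R => f (x + s *: v)) s 1 by exact: diff_derivable.
  apply: DeriveDef; first by move/derivable_mxP : dv => /(_ 0 j).
  by rewrite -dE derive_mx // mxE.
have [s s01||c] := @MVT_segment R g (fun s => 'D_v f (x + s *: v) 0 j) 0 1 ler01.
- by apply: dg; move: s01; rewrite in_itv /= => /andP[/ltW-> /ltW->].
- apply: derivable_within_continuous => s; rewrite in_itv /= => s01.
  by have [] := dg s s01.
rewrite in_itv /= => c01; rewrite /g scale1r scale0r addr0 subr0 mulr1 !mxE => ->.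
have [_] := H c c01; apply: le_trans.
rewrite [leRHS]/Num.Def.normr/= mx_normrE.
by apply: le_trans; last exact: (le_bigmax _ _ (0, j)).
Qed.

End MeanValue.

(** * Fixed points of contractions depending on a parameter *)
Section PartialJacobian.
Context {R : realType} {P : normedModType R} {p q : nat}.
Variable Phi : P * 'rV[R]_p -> 'rV[R]_q.

Lemma derive_snd_sum (x : P * 'rV[R]_p) (v : 'rV[R]_p) : differentiable Phi x ->
  'D_(0, v) Phi x = \sum_j v 0 j *: 'D_(0, delta_mx 0 j) Phi x.
Proof.
move=> dPhi; have <- := @derive_sumE _ _ _ _ (fun j => v 0 j) (fun j : 'I_p => (0 : P, delta_mx
    0 j : 'rV[R]_p)) _ _ dPhi.
congr (derive Phi x _).
have l2 : linear (fun v : 'rV[R]_p => (0 : P, v)).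
  by move=> a y z; rewrite -[RHS]/(_ + _, _ + _) /= scaler0 addr0.
pose L2 := GRing.isLinear.Build _ _ _ _ _ l2.
pose F : {linear 'rV[R]_p -> (P * 'rV[R]_p)%type} := HB.pack (fun v : 'rV[R]_p => (0 : P, v))
    L2.
rewrite -[LHS]/(F v) {1}(row_sum_delta v) linear_sum.
by apply: eq_bigr => j _; rewrite linearZ.
Qed.

Definition jac_snd (x : P * 'rV[R]_p) : 'M[R]_(p, q) := \matrix_(i, j) ('D_(0, delta_mx 0 i)
    Phi x) 0 j.

Lemma jac_sndE x v : differentiable Phi x -> v *m jac_snd x = 'D_(0, v) Phi x.
Proof.
move=> dPhi; rewrite derive_snd_sum //; apply/rowP => j; rewrite mxE summxE.
by apply: eq_bigr => i _; rewrite !mxE.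
Qed.

End PartialJacobian.

Section Contraction.
Context {R : realType} {P : normedModType R} {fP : findim P} {q : nat}.
Notation W := 'rV[R]_q.
Variables (K : P * W -> W).

Definition half_contracting (x : P * W) :=
  smooth_at K x /\ forall v, `|'D_(0, v) K x| <= 2^-1 * `|v|.

Lemma norm_coord (v : W) j : `|v 0 j| <= `|v|.
Proof.
rewrite [leRHS]/Num.Def.normr/= mx_normrE.
by apply: le_trans; last exact: (le_bigmax _ _ (0, j)).
Qed.

(** The partial derivatives in the finitely many basis directions are
    continuous and vanish at x0. *)
Lemma half_contracting_near x0 : smooth_at K x0 -> (forall v, 'D_(0, v) K x0 = 0) ->
  \forall x \near x0, half_contracting x.
Proof.
move=> sK dK0; pose c : R := (2 * q.+1%:R)^-1.
have c0 : 0 < c by rewrite invr_gt0 mulr_gt0.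
have H : \forall x \near x0, forall j : 'I_q, `|'D_(0, delta_mx 0 j) K x| <= c.
  apply: (@filter_forall _ _ (fun (j : 'I_q) x => `|derive K x (0, delta_mx 0 j)| <= c) (nbhs
      x0) _) => j.
  have cD := smooth_at_continuous (smooth_at_derive (0, delta_mx 0 j) sK).
  have : (fun y => derive K y (0, delta_mx 0 j)) y @[y --> x0] --> (0 : W).
    by rewrite -(dK0 (delta_mx 0 j)); exact: cD.
  by move=> /cvgr0_norm_le; apply.
have sN := smooth_at_near sK.
apply: filterS2 H sN => x H sx; split=> // v.
rewrite derive_snd_sum; last exact: smooth_at_differentiable.
apply: le_trans (ler_norm_sum _ _ _) _.
apply: (@le_trans _ _ (\sum_(j < q) `|v| * c)).
  by apply: ler_sum => j _; rewrite normrZ; apply: ler_pM => //; exact: norm_coord.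
rewrite sumr_const card_ord -mulrnAr mulrC ler_wpM2r // -mulr_natl /c invfM mulrCA.
by rewrite ler_piMr // ler_pdivrMr // mul1r ler_nat.
Qed.

Section Solution.
Variables (p0 : P) (w0 : W) (r : R).
Hypothesis r0 : 0 < r.
Hypothesis hc : forall p w, `|p - p0| < r -> `|w - w0| <= r -> half_contracting (p, w).
Variable D : set P.
Hypothesis oD : open D.
Hypothesis Dr : forall p, D p -> `|p - p0| < r /\ `|K (p, w0) - w0| <= r / 2.

Let B := [set w : W | `|w - w0| <= r].

(** Mean value inequality on the segment from w' to w, which stays in the
    ball by convexity. *)
Lemma K_lip p w w' : D p -> B w -> B w' -> `|K (p, w) - K (p, w')| <= 2^-1 * `|w - w'|.
Proof.
move=> /Dr[pr _] Bw Bw'.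
have E : (p, w) = (p, w') + (0, w - w').
  by rewrite -[RHS]/(_ + _, _ + _) /= addr0 addrCA subrr addr0.
rewrite E; apply: mean_value_ineq => s /andP[s0 s1].
have -> : (p, w') + s *: (0, w - w') = (p, w' + s *: (w - w')).
  by rewrite -[LHS]/(_ + _, _ + _) /= scaler0 addr0.
have [sK le] : half_contracting (p, w' + s *: (w - w')).
  apply: hc => //.
  have -> : w' + s *: (w - w') - w0 = s *: (w - w0) + (1 - s) *: (w' - w0).
    by apply/rowP => j; rewrite !mxE; ring.
  apply: le_trans (ler_normD _ _) _; rewrite !normrZ ger0_norm // ger0_norm ?subr_ge0 //.
  apply: (@le_trans _ _ (s * r + (1 - s) * r)); last by rewrite -mulrDl addrC subrK mul1r.
  by apply: lerD; apply: ler_wpM2l; rewrite ?subr_ge0.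
by split; [exact: smooth_at_differentiable|exact: le].
Qed.

(** Banach's theorem: the ball is mapped to itself because its centre moves by
    at most r / 2 and distances are halved. *)
Lemma fixed_point_exists p : D p -> exists2 w, B w & w = K (p, w).
Proof.
move=> Dp; have [pr pw] := Dr Dp.
have KB : {homo (fun w => K (p, w)) : w / B w >-> B w}.
  move=> w Bw; rewrite /B /= -(subrK (K (p, w0)) (K (p, w))) -addrA.
  apply: le_trans (ler_normD _ _) _; rewrite [leRHS]splitr lerD //.
  apply: le_trans (K_lip Dp Bw _) _; first by rewrite /B /= subrr normr0 ltW.
  by rewrite mulrC ler_wpM2r ?invr_ge0.
pose M := isFun.Build W W B B (fun w => K (p, w)) KB.
pose F : {fun B >-> B} := HB.pack (fun w => K (p, w)) M.
have cF : is_contraction F.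
  exists (2^-1)%:nng; split => /=; first by rewrite invf_lt1 // ltr1n.
  by move=> [w w'] /= [Bw Bw']; exact: K_lip.
have clB : closed B.
  have -> : B = closed_ball_ Num.Def.normr w0 r.
    by apply/seteqP; split=> w; rewrite /B /closed_ball_ /= distrC.
  exact: closed_closed_ball_.
have [|w Bw wE] := banach_fixed_point cF clB; last by exists w.
by exists w0; rewrite /B /= subrr normr0 ltW.
Qed.

Lemma fixed_point_unique p w w' : D p -> B w -> B w' ->
  w = K (p, w) -> w' = K (p, w') -> w = w'.
Proof.
move=> Dp Bw Bw' E E'; apply/eqP; rewrite -subr_eq0 -normr_le0.
have := K_lip Dp Bw Bw'; rewrite -E -E'.
by rewrite -subr_le0 -{1}[`|_|]mul1r -mulrBl (_ : 1 - 2^-1 = 2^-1); [rewrite pmulr_rle0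
    ?invr_gt0|lra].
Qed.

Lemma half_contracting_unit x : half_contracting x -> 1%:M - jac_snd K x \in unitmx.
Proof.
move=> [/smooth_at_differentiable dK le]; rewrite -row_free_unit.
apply: inj_row_free => v; rewrite mulmxBr mulmx1 jac_sndE // => /eqP.
rewrite subr_eq0 => /eqP vE; apply/eqP; rewrite -normr_le0.
have := le v; rewrite -vE; lra.
Qed.

Variable h : P -> W.
Hypothesis hB : forall p, D p -> B (h p).
Hypothesis hK : forall p, D p -> h p = K (p, h p).

Lemma solution_half_contracting p : D p -> half_contracting (p, h p).
Proof. by move=> Dp; apply: hc; [exact: (Dr Dp).1|exact: hB]. Qed.

Lemma solution_continuous p : D p -> {for p, continuous h}.
Proof.
move=> Dp; apply/cvgrPdist_le => e e0.
have [/smooth_at_continuous cK _] := solution_half_contracting Dp.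
have : (fun p' => K (p', h p)) p' @[p' --> p] --> K (p, h p).
  apply: (continuous_comp (f := fun p' => (p', h p))); last exact: cK.
  exact: (cvg_pair cvg_id (cvg_cst _)).
move=> /cvgrPdist_le /(_ (e / 2)); rewrite divr_gt0 // => /(_ isT) H.
apply: filterS2 (near_open oD Dp (fun _ => id)) H => p' Dp' le.
have := K_lip Dp' (hB Dp) (hB Dp').
have := ler_normD (h p - K (p', h p)) (K (p', h p) - h p').
rewrite addrA subrK -(hK Dp') => l1 l2.
rewrite -(hK Dp) in le; lra.
Qed.

(** Linearising h p = K (p, h p) gives dh = dK_p + dh dK_w, hence
    dh = dK_p (1 - dK_w)^-1. *)
Lemma solution_derive p : D p -> differentiable h p /\
  forall u, 'D_u h p = 'D_(u, 0) K (p, h p) *m invmx (1%:M - jac_snd K (p, h p)).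
Proof.
move=> Dp; have Hc := solution_half_contracting Dp.
have U := half_contracting_unit Hc; have [/smooth_at_differentiable dK _] := Hc.
set x := (p, h p) in dK U Hc *; set I := invmx _.
have lL : linear (fun u : P => 'D_(u, 0 : W) K x *m I).
  move=> a u v; rewrite !deriveE // scalemxAl -mulmxDl -linearP; congr ('d K x _ *m _).
  by rewrite -[RHS]/(_ + _, _ + _) /= scaler0 addr0.
pose ML := GRing.isLinear.Build _ _ _ _ _ lL.
pose L : {linear P -> W} := HB.pack (fun u : P => 'D_(u, 0 : W) K x *m I) ML.
have cL : continuous L by exact: findim_continuous.
have [M M0 LM] := linear_lipschitz cL.
have cI : continuous (mulmxr I : W -> W) by apply: findim_continuous => a y z; rewrite linearP.
have [C C0 IC] := linear_lipschitz cI.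
apply: (differentiable_epsP cL) => e e0.
(* The first bound gives |d| <= (2 M + 1) |u|, the second the estimate with e. *)
pose e' := Num.min (2^-1 / C) (e / (2 * M + 2) / C).
have e'0 : 0 < e' by rewrite lt_min !divr_gt0 //; lra.
have e'1 : C * e' <= 2^-1 by rewrite mulrC -ler_pdivlMr // ge_min lexx.
have e'2 : C * e' * (2 * M + 2) <= e.
  rewrite -ler_pdivlMr; last by lra.
  by rewrite mulrC -ler_pdivlMr // ge_min lexx orbT.
have dlim : (fun u => (u, h (u + p) - h p)) u @[u --> 0] --> (0 : P * W).
  suff H : h (u + p) - h p @[u --> 0] --> (0 : W) by exact: (cvg_pair cvg_id H).
  rewrite -(subrr (h p)); apply: cvgB; last exact: cvg_cst.
  have cs : (fun u => u + p) u @[u --> 0] --> p.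
    by rewrite -[X in _ --> X]add0r; apply: cvgD; [exact: cvg_id|exact: cvg_cst].
  by apply: cvg_comp cs _; exact: solution_continuous.
have H1 := dlim _ (differentiable_eps dK e'0).
have Dnear : \forall u \near 0, D (u + p).
  have cs : (fun u => u + p) u @[u --> 0] --> p.
    by rewrite -[X in _ --> X]add0r; apply: cvgD; [exact: cvg_id|exact: cvg_cst].
  by apply: cs; apply: open_nbhs_nbhs.
apply: filterS2 Dnear H1 => u Du /=; set d := h (u + p) - h p.
have -> : K ((u, d) + x) = h (u + p).
  by rewrite -[_ + x]/(_ + _, _ + _) /= /d subrK -hK.
rewrite /x -hK // -/x -/d.
have -> : 'D_(u, d) K x = 'D_(u, 0) K x + d *m jac_snd K x.
  rewrite jac_sndE // !deriveE // -linearD; congr ('d K x _).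
  by rewrite -[RHS]/(_ + _, _ + _) /= addr0 add0r.
move=> le.
have E : d - L u = (d - ('D_(u, 0) K x + d *m jac_snd K x)) *m I.
  rewrite /L /= opprD addrA addrAC mulmxBl -[X in X - _ *m jac_snd K x](mulmx1 d).
  by rewrite -mulmxBr -mulmxA mulmxV // mulmx1.
have l1 : `|d - L u| <= C * e' * (`|u| + `|d|).
  rewrite E; apply: le_trans (IC _) _; rewrite -mulrA ler_wpM2l ?(ltW C0) //.
  apply: le_trans le _; rewrite ler_wpM2l ?(ltW e'0) //.
  by rewrite prod_normE /= ge_max lerDl lerDr !normr_ge0.
have l2 : C * e' * (`|u| + `|d|) <= 2^-1 * (`|u| + `|d|).
  by rewrite ler_wpM2r // addr_ge0.
have l3 := ler_normD (d - L u) (L u); rewrite subrK in l3; have l4 := LM u.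
have l5 : `|d| <= (2 * M + 1) * `|u| by lra.
apply: (le_trans l1).
apply: (@le_trans _ _ (C * e' * ((2 * M + 2) * `|u|))).
  by rewrite ler_wpM2l ?mulr_ge0 ?(ltW C0) ?(ltW e'0) //; lra.
by rewrite mulrA ler_wpM2r.
Qed.

(** The formula of [solution_derive] expresses the derivative of h by h itself
    and smooth data, so each order of smoothness yields the next one. *)
Lemma solution_Ck k : Ck k D h.
Proof.
elim: k => [|k IH]; first exact: solution_continuous.
split=> [p Dp|u]; first by apply (solution_derive Dp).1.
pose O := [set x | smooth_at K x /\ 1%:M - jac_snd K x \in unitmx].
have sN x : smooth_at K x -> smooth_at (fun x => 1%:M - jac_snd K x) x.
  move=> sK; apply: smooth_at_sub; first exact: smooth_at_cst.
  apply/smooth_at_mxP => i j.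
  have /smooth_at_mxP /(_ 0 j) := smooth_at_derive (0, delta_mx 0 i) sK.
  by apply: smooth_at_eq => y; rewrite mxE.
have oO : open O.
  rewrite openE => x [sK Ux].
  have n1 : nbhs x [set y | smooth_at K y] by exact: (smooth_at_near sK).
  have n2 : nbhs x [set y | 1%:M - jac_snd K y \in unitmx] by exact: (near_unitmx (A := fun y
      => 1%:M - jac_snd K y) Ux (sN _ sK)).
  exact: (filterI n1 n2).
have H : Ck k O (fun x => 'D_(u, 0) K x *m invmx (1%:M - jac_snd K x)).
  apply: smooth_at_Ck => x [sK Ux].
  apply: smooth_at_mulmx; first exact: smooth_at_derive.
  by apply: smooth_at_invmx => //; exact: sN.
have Hp : Ck k D (fun p => (p, h p)).
  by apply: Ck_pair => //; apply: Ck_linear.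
apply: (Ck_ext oD _ (Ck_comp _ oD oO _ Hp H)) => p Dp.
  by rewrite (solution_derive Dp).2.
have Hc := solution_half_contracting Dp.
by split; [case: Hc|exact: half_contracting_unit].
Qed.

End Solution.
End Contraction.

(** * Inverse function theorem with a parameter *)
Section InverseFunction.
Context {R : realType}.

Theorem contraction_solution (P : normedModType R) (q : nat)
    (K : P * 'rV[R]_q -> 'rV[R]_q) (p0 : P) (w0 : 'rV[R]_q) : findim P ->
  smooth_at K (p0, w0) -> K (p0, w0) = w0 ->
  (forall v, 'D_(0, v) K (p0, w0) = 0) ->
  exists h : P -> 'rV[R]_q,
    [/\ smooth_at h p0, h p0 = w0, \forall p \near p0, h p = K (p, h p)
      & \forall x \near (p0, w0), x.2 = K x -> x.2 = h x.1].
Proof.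
move=> fP sK Kfix dK0.
have : nbhs (p0, w0) [set x | half_contracting K x] by exact: half_contracting_near.
move=> /nbhs_ballP[e /= e0 be].
pose r := e / 2; have r0 : 0 < r by rewrite divr_gt0.
have hc p w : `|p - p0| < r -> `|w - w0| <= r -> half_contracting K (p, w).
  move=> pr wr; apply: be; split; rewrite -ball_normE /= distrC.
    by apply: lt_le_trans pr _; rewrite ler_pdivrMr // ler_pMr // ler1n.
  by apply: le_lt_trans wr _; rewrite ltr_pdivrMr // ltr_pMr // ltr1n.
have n1 : nbhs p0 [set p | `|p - p0| < r].
  by apply/nbhs_ballP; exists r => // p; rewrite -ball_normE /= distrC.
have n2 : nbhs p0 [set p | `|K (p, w0) - w0| <= r / 2].
  have : K (p, w0) @[p --> p0] --> w0.
    rewrite -[X in _ --> X]Kfix.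
    apply: (continuous_comp (f := fun p => (p, w0))); last exact: smooth_at_continuous.
    exact: (cvg_pair cvg_id (cvg_cst _)).
  move=> /cvgrPdist_le /(_ (r / 2)); rewrite divr_gt0 // => /(_ isT).
  by apply: filterS => p; rewrite distrC.
have : nbhs p0 ([set p | `|p - p0| < r] `&` [set p | `|K (p, w0) - w0| <= r / 2]).
  exact: filterI.
rewrite nbhsE => -[D [oD Dp0] Dr].
have ex p : exists w, D p -> `|w - w0| <= r /\ w = K (p, w).
  have [Dp|nDp] := pselect (D p); last by exists w0.
  by have [w Bw wE] := fixed_point_exists r0 hc Dr Dp; exists w.
pose h p := sval (cid (ex p)).
have hB p : D p -> `|h p - w0| <= r by move=> Dp; exact: (svalP (cid (ex p)) Dp).1.
have hK p : D p -> h p = K (p, h p) by move=> Dp; exact: (svalP (cid (ex p)) Dp).2.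
have hU := fixed_point_unique hc Dr.
have hu p w : D p -> `|w - w0| <= r -> w = K (p, w) -> w = h p.
  by move=> Dp Bw wE; exact: (hU p _ _ Dp Bw (hB p Dp) wE (hK p Dp)).
exists h; split.
- by exists D => // k; exact: (solution_Ck hc oD Dr hB hK).
- by apply/esym; apply: hu => //; rewrite subrr normr0 ltW.
- by apply: (near_open oD Dp0) => p; exact: hK.
have : nbhs (p0, w0) [set x | D x.1 /\ `|x.2 - w0| <= r].
  exists (D, [set w | `|w - w0| <= r]) => //=; split; first exact: open_nbhs_nbhs.
  by apply/nbhs_ballP; exists r => // w; rewrite -ball_normE /= distrC; exact: ltW.
by apply: filterS => -[p w] /= [Dp wr]; exact: hu.
Qed.

(** Inverse function theorem for (p, w) |-> (p, Phi (p, w)) when the partial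
    derivative in w is only injective: f is then a left inverse, and it is a
    two-sided inverse when the dimensions agree.  If B is a left inverse of the
    Jacobian, Phi (p, w) = y gives w = w - (Phi (p, w) - y) B, whose right-hand
    side has derivative 0 in w. *)
Theorem inverse_function (P : normedModType R) (p q : nat)
    (Phi : P * 'rV[R]_p -> 'rV[R]_q) (p0 : P) (w0 : 'rV[R]_p) : findim P ->
  smooth_at Phi (p0, w0) -> (forall v, 'D_(0, v) Phi (p0, w0) = 0 -> v = 0) ->
  exists f : P * 'rV[R]_q -> 'rV[R]_p,
    [/\ smooth_at f (p0, Phi (p0, w0)), f (p0, Phi (p0, w0)) = w0,
        \forall x \near (p0, w0), f (x.1, Phi x) = x.2
      & p = q -> \forall y \near (p0, Phi (p0, w0)), Phi (y.1, f y) = y.2].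
Proof.
move=> fP sPhi inj; set x0 := (p0, w0) in sPhi inj *; set y0 := Phi x0.
have dPhi := smooth_at_differentiable sPhi.
pose J := jac_snd Phi x0.
have JE v : v *m J = 'D_(0, v) Phi x0 by exact: jac_sndE.
have freeJ : row_free J by apply: inj_row_free => v; rewrite JE; exact: inj.
pose B := pinvmx J.
pose K (x : (P * 'rV[R]_q) * 'rV[R]_p) := x.2 - (Phi (x.1.1, x.2) - x.1.2) *m B.
pose z0 : (P * 'rV[R]_q) * 'rV[R]_p := ((p0, y0), w0).
have slin (X Y : normedModType R) (fX : findim X) (g : X -> Y) z : linear g -> smooth_at g z.
  by move=> lg; exact: smooth_at_linear.
have s2 : smooth_at (fun x : (P * 'rV[R]_q) * 'rV[R]_p => x.2) z0.
  by apply: slin => a y z.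
have s12 : smooth_at (fun x : (P * 'rV[R]_q) * 'rV[R]_p => x.1.2) z0.
  by apply: slin => a y z.
have s11 : smooth_at (fun x : (P * 'rV[R]_q) * 'rV[R]_p => (x.1.1, x.2)) z0.
  by apply: slin => a y z.
have sP : smooth_at (fun x : (P * 'rV[R]_q) * 'rV[R]_p => Phi (x.1.1, x.2)) z0.
  exact: (smooth_at_comp (f := fun x : (P * 'rV[R]_q) * 'rV[R]_p => (x.1.1, x.2))).
have sR := smooth_at_sub sP s12.
have sRB := smooth_at_mulmx sR (smooth_at_cst B z0).
have sK : smooth_at K z0 by exact: smooth_at_sub.
have Kfix : K z0 = w0 by rewrite /K /= -/x0 subrr mul0mx subr0.
have der (X Y : normedModType R) (g : X -> Y) z v : smooth_at g z -> derivable g z v.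
  by move=> /smooth_at_differentiable; exact: diff_derivable.
have dK0 v : 'D_(0, v) K z0 = 0.
  rewrite deriveB; [|exact: der|exact: der].
  have lB : linear (fun y : 'rV[R]_q => y *m B) by move=> a y z; rewrite mulmxDl scalemxAl.
  have [dB BE] := is_diff_linear ((Phi (z0.1.1, z0.2) - z0.1.2) : 'rV[R]_q) _ lB.
  rewrite (derive_comp (g := fun y : 'rV[R]_q => y *m B)) //; last exact:
      smooth_at_differentiable.
  rewrite BE deriveB; [|exact: der|exact: der].
  rewrite (derive_comp (f := fun x : (P * 'rV[R]_q) * 'rV[R]_p => (x.1.1, x.2)) (g := Phi)) //;
      last exact: smooth_at_differentiable.
  have E (X : normedModType R) (g : (P * 'rV[R]_q) * 'rV[R]_p -> X) : linear g -> 'D_(0, v) g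
      z0 = g (0, v).
    by move=> lg; apply (is_diff_linear z0 _ lg).2.
  rewrite !E //= subr0 -JE -mulmxA mulmxVp // mulmx1 subrr //.
have [h [sh h0 hK hu]] := contraction_solution _ sK Kfix dK0.
exists h; split => //.
- have c : (fun x => ((x.1, Phi x), x.2)) x @[x --> x0] --> z0.
    have cP : Phi x @[x --> x0] --> y0 by exact: (smooth_at_continuous sPhi).
    exact: (cvg_pair (cvg_pair cvg_fst cP) cvg_snd).
  have : \forall x \near x0, x.2 = K (x.1, Phi x, x.2) -> x.2 = h (x.1, Phi x) by exact: (c _
      hu).
  by apply: filterS => x /= <- //; rewrite /K /= -surjective_pairing subrr mul0mx subr0.
move=> pq; apply: filterS hK => -[y1 y2] /eqP.
rewrite /K /= -subr_eq0 opprB addrCA subrr addr0 => /eqP E.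
have fullJ : row_full J by rewrite /row_full (eqP (freeJ : \rank J == p)) pq.
apply/eqP; rewrite -subr_eq0 -[_ - _]mulmx1 -(mulVpmx fullJ) mulmxA E mul0mx //.
Qed.

End InverseFunction.

(** * Agreement of the Taylor coefficients of curves *)
Section Agree.
Context {R : realType}.
Implicit Types V W : normedModType R.
Implicit Types s : R.

Definition agree W (k : nat) (f g : R -> W) (s : R) :=
  forall j, (j < k)%N -> (derive1n j f) s = (derive1n j g) s.

Lemma smooth_at_derive1 W (f : R -> W) s : smooth_at f s -> smooth_at (derive1 f) s.
Proof.
move=> sf; apply: (smooth_at_eq _ (smooth_at_derive (1 : R) sf)) => x.
by rewrite derive1E.
Qed.

Lemma smooth_at_derive1n W (f : R -> W) j s : smooth_at f s -> smooth_at (derive1n j f) s.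
Proof.
by move=> sf; elim: j => [//|j IH]; rewrite derive1nS; exact: smooth_at_derive1.
Qed.

Lemma near_derive1 W (f g : R -> W) s : (\forall x \near s, f x = g x) ->
  \forall x \near s, (derive1 f) x = (derive1 g) x.
Proof.
move=> fg; have := near_join fg; apply: filterS => x fgx.
by rewrite !derive1E; exact: near_eq_derive.
Qed.

Lemma near_derive1n W (f g : R -> W) j s : (\forall x \near s, f x = g x) ->
  \forall x \near s, (derive1n j f) x = (derive1n j g) x.
Proof. by move=> fg; elim: j => [//|j IH]; rewrite !derive1nS; exact: near_derive1. Qed.

Lemma near_agree W k (f g : R -> W) s : (\forall x \near s, f x = g x) -> agree k f g s.
Proof. by move=> fg j _; have := nbhs_singleton (near_derive1n j fg). Qed.

Lemma agree0 W (f g : R -> W) s : agree 0 f g s.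
Proof. by move=> j; rewrite ltn0. Qed.

Lemma agree_refl W k (f : R -> W) s : agree k f f s.
Proof. by []. Qed.

Lemma agree_sym W k (f g : R -> W) s : agree k f g s -> agree k g f s.
Proof. by move=> h j jk; rewrite h. Qed.

Lemma agree_trans W k (g f h : R -> W) s : agree k f g s -> agree k g h s -> agree k f h s.
Proof. by move=> fg gh j jk; rewrite fg // gh. Qed.

Lemma agreeW W k l (f g : R -> W) s : (l <= k)%N -> agree k f g s -> agree l f g s.
Proof. by move=> lk h j jl; apply: h; exact: leq_trans lk. Qed.

Lemma agreeS W k (f g : R -> W) s :
  agree k.+1 f g s <-> f s = g s /\ agree k (derive1 f) (derive1 g) s.
Proof.
split=> [h|[h0 h] [|j] jk //].
  by split=> [|j jk]; [exact: (h 0)|have := h j.+1 jk; rewrite !derive1Sn].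
by rewrite !derive1Sn; exact: h.
Qed.

Lemma agree_derive1n W k l (f g : R -> W) s :
  agree (l + k) f g s -> agree k (derive1n l f) (derive1n l g) s.
Proof.
move=> h j jk; rewrite /derive1n -!iterD addnC; apply: h.
by rewrite ltn_add2l.
Qed.

Lemma derive1_comp_curve V W (f : V -> W) (c : R -> V) s :
  smooth_at c s -> smooth_at f (c s) ->
  (derive1 (fun x => f (c x))) s = 'D_((derive1 c) s) f (c s).
Proof.
move=> /smooth_at_differentiable dc /smooth_at_differentiable df.
by rewrite !derive1E (derive_comp (f := c)).
Qed.

Lemma smooth_at_near_comp V W (f : V -> W) (c : R -> V) s :
  smooth_at c s -> smooth_at f (c s) -> \forall x \near s, smooth_at c x /\ smooth_at f (c x).
Proof.
move=> sc sf; have n1 := smooth_at_near sc.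
have n2 : \forall x \near s, smooth_at f (c x).
  exact: (smooth_at_continuous sc (smooth_at_near sf)).
by apply: filterS2 n1 n2.
Qed.

Lemma agree_add W k (f1 f2 g1 g2 : R -> W) s :
  smooth_at f1 s -> smooth_at f2 s -> smooth_at g1 s -> smooth_at g2 s ->
  agree k f1 g1 s -> agree k f2 g2 s ->
  agree k (fun x => f1 x + f2 x) (fun x => g1 x + g2 x) s.
Proof.
have D (f g : R -> W) x : smooth_at f x -> smooth_at g x ->
    (derive1 (fun x => f x + g x)) x = (derive1 f) x + (derive1 g) x.
  move=> /smooth_at_differentiable df /smooth_at_differentiable dg.
  by rewrite !derive1E deriveD //; exact: diff_derivable.
have D' (f g : R -> W) : smooth_at f s -> smooth_at g s ->
    \forall x \near s, (derive1 (fun x => f x + g x)) x = (derive1 f) x + (derive1 g) x.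
  by move=> /smooth_at_near + /smooth_at_near; apply: filterS2 => x; exact: D.
elim: k f1 f2 g1 g2 => [//|k IH] f1 f2 g1 g2 sf1 sf2 sg1 sg2 /agreeS[e1 a1] /agreeS[e2 a2].
apply/agreeS; split; first by rewrite e1 e2.
apply: agree_trans (near_agree (D' _ _ sf1 sf2)) _.
apply: agree_trans _ (agree_sym (near_agree (D' _ _ sg1 sg2))).
by apply: IH => //; exact: smooth_at_derive1.
Qed.

Lemma agree_scale W k (f1 g1 : R -> R) (f2 g2 : R -> W) s :
  smooth_at f1 s -> smooth_at f2 s -> smooth_at g1 s -> smooth_at g2 s ->
  agree k f1 g1 s -> agree k f2 g2 s ->
  agree k (fun x => f1 x *: f2 x) (fun x => g1 x *: g2 x) s.
Proof.
have D (f : R -> R) (g : R -> W) x : smooth_at f x -> smooth_at g x ->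
    (derive1 (fun x => f x *: g x)) x = (derive1 f) x *: g x + f x *: (derive1 g) x.
  move=> /smooth_at_differentiable df /smooth_at_differentiable dg.
  by rewrite !derive1E (is_diff_scale df dg).2.
have D' (f : R -> R) (g : R -> W) : smooth_at f s -> smooth_at g s ->
    \forall x \near s, (derive1 (fun x => f x *: g x)) x = (derive1 f) x *: g x + f x *:
        (derive1 g) x.
  by move=> /smooth_at_near + /smooth_at_near; apply: filterS2 => x; exact: D.
elim: k f1 f2 g1 g2 => [//|k IH] f1 f2 g1 g2 sf1 sf2 sg1 sg2 h1 h2.
have /agreeS[e1 a1] := h1; have /agreeS[e2 a2] := h2.
have {}h1 := agreeW (leqnSn k) h1; have {}h2 := agreeW (leqnSn k) h2.
apply/agreeS; split; first by rewrite e1 e2.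
apply: agree_trans (near_agree (D' _ _ sf1 sf2)) _.
apply: agree_trans _ (agree_sym (near_agree (D' _ _ sg1 sg2))).
have [sf1' sf2'] := (smooth_at_derive1 sf1, smooth_at_derive1 sf2).
have [sg1' sg2'] := (smooth_at_derive1 sg1, smooth_at_derive1 sg2).
by apply: agree_add; (try exact: smooth_at_scale); exact: IH.
Qed.

Lemma agree_sum W k (I : Type) (r : seq I) (f g : I -> R -> W) s :
  (forall i, smooth_at (f i) s) -> (forall i, smooth_at (g i) s) ->
  (forall i, agree k (f i) (g i) s) ->
  agree k (fun x => \sum_(i <- r) f i x) (fun x => \sum_(i <- r) g i x) s.
Proof.
move=> sf sg fg; elim: r => [|i r IH].
  by move=> j _; congr (derive1n j _ s); apply/funext => x; rewrite !big_nil.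
have E (h : I -> R -> W) : (fun x => \sum_(j <- i :: r) h j x) = (fun x => h i x + \sum_(j <-
    r) h j x).
  by apply/funext => x; rewrite big_cons.
by rewrite !E; apply: agree_add => //; exact: smooth_at_sum.
Qed.

Lemma agree_linear V W k (L : V -> W) (f g : R -> V) s : findim V -> linear L ->
  smooth_at f s -> smooth_at g s ->
  agree k f g s -> agree k (fun x => L (f x)) (fun x => L (g x)) s.
Proof.
move=> fV lL.
have D' (c : R -> V) : smooth_at c s ->
    \forall x \near s, derive1 (fun x => L (c x)) x = L (derive1 c x).
  move=> /smooth_at_near; apply: filterS => x sx.
  rewrite (derive1_comp_curve (f := L)) //; last exact: smooth_at_linear.
  by rewrite (is_diff_linear _ fV lL).2.
elim: k f g => [//|k IH] f g sf sg /agreeS[e a].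
apply/agreeS; split; first by rewrite e.
apply: agree_trans (near_agree (D' _ sf)) _.
apply: agree_trans _ (agree_sym (near_agree (D' _ sg))).
by apply: IH => //; exact: smooth_at_derive1.
Qed.

(** By the chain rule the derivative of f o c is a combination of products of
    coordinates of c' with partial derivatives of f along c; both factors agree
    to one order less. *)
Lemma agree_comp V W k (f : V -> W) (c1 c2 : R -> V) s : findim V ->
  smooth_at c1 s -> smooth_at c2 s -> smooth_at f (c1 s) -> c1 s = c2 s ->
  agree k c1 c2 s -> agree k (fun x => f (c1 x)) (fun x => f (c2 x)) s.
Proof.
move=> fV sc1 sc2 + c12; have [I [e [kap [ck ek]]]] := fV.
have lk i : linear (kap i) by move=> a x y; rewrite linearP.
have D' (g : V -> W) (c : R -> V) : smooth_at c s -> smooth_at g (c s) ->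
    \forall x \near s, (derive1 (fun x => g (c x))) x =
       \sum_i kap i ((derive1 c) x) *: 'D_(e i) g (c x).
  move=> sc sg; have := smooth_at_near_comp sc sg; apply: filterS => x [scx sgx].
  rewrite derive1_comp_curve // [in LHS](ek ((derive1 c) x)) derive_sumE //.
  exact: smooth_at_differentiable.
elim: k f => [//|k IH] f sf ag; have /agreeS[_ a] := ag.
have {}ag := agreeW (leqnSn k) ag.
have sf2 : smooth_at f (c2 s) by rewrite -c12.
apply/agreeS; split; first by rewrite c12.
apply: agree_trans (near_agree (D' _ _ sc1 sf)) _.
apply: agree_trans _ (agree_sym (near_agree (D' _ _ sc2 sf2))).
have [sd1 sd2] := (smooth_at_derive1 sc1, smooth_at_derive1 sc2).
have S1 i : smooth_at (fun x => kap i ((derive1 c1) x)) s.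
  by apply: (smooth_at_comp (g := kap i)) => //; apply: smooth_at_linear; exact: lk.
have S2 i : smooth_at (fun x => kap i ((derive1 c2) x)) s.
  by apply: (smooth_at_comp (g := kap i)) => //; apply: smooth_at_linear; exact: lk.
have T1 i : smooth_at (fun x => 'D_(e i) f (c1 x)) s.
  by apply: (smooth_at_comp (g := fun y => 'D_(e i) f y)) => //; exact: smooth_at_derive.
have T2 i : smooth_at (fun x => 'D_(e i) f (c2 x)) s.
  by apply: (smooth_at_comp (g := fun y => 'D_(e i) f y)) => //; exact: smooth_at_derive.
apply: agree_sum => i; [exact: smooth_at_scale|exact: smooth_at_scale|].
apply: agree_scale => //; first by apply: agree_linear => //; exact: lk.
by apply: (IH (fun y => 'D_(e i) f y)) => //; exact: smooth_at_derive.
Qed.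

Lemma derive1n_cst0 W j : derive1n j (cst 0 : R -> W) = cst 0.
Proof.
elim: j => [//|j IH]; rewrite derive1nS IH.
by apply/funext => x; rewrite derive1_cst.
Qed.

(** On the open set A all derivatives vanish, and they are continuous at s.
    This handles the end points of the time interval, where a curve is only
    constrained on one side. *)
Lemma vanish_derive1n W (A : set R) (h : R -> W) s j : open A -> closure A s ->
  smooth_at h s -> (\forall x \near s, A x -> h x = 0) -> (derive1n j h) s = 0.
Proof.
move=> oA cA sh hA.
suff : \forall x \near s, A x -> (derive1n j h) x = 0.
  move=> H; have /smooth_at_continuous cj := smooth_at_derive1n j sh.
  apply/eqP; rewrite -normr_le0 leNgt; apply/negP => n0.
  move/cvgrPdist_lt : cj => /(_ _ n0) n1.
  have [x [Ax [Hx]]] := cA _ (filterI H n1).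
  by rewrite /= Hx // subr0 ltxx.
elim: j => [//|j IH]; have := near_join IH; apply: filterS => x nx Ax.
rewrite derive1nS derive1E (near_eq_derive (g := cst 0)) ?derive_cst //.
by apply: filterS2 nx (near_open oA Ax (fun _ => id)) => y h1 /h1.
Qed.

Lemma vanish_agree W (A : set R) (f g : R -> W) s k : open A -> closure A s ->
  smooth_at f s -> smooth_at g s -> (\forall x \near s, A x -> f x = g x) -> agree k f g s.
Proof.
move=> oA cA sf sg fg.
have sd : smooth_at (fun x => f x - g x) s by exact: smooth_at_sub.
have H : agree k (fun x => f x - g x) (cst 0) s.
  move=> j _; rewrite (vanish_derive1n _ oA cA sd); last first.
    by apply: filterS fg => x h /h ->; rewrite subrr.
  by rewrite derive1n_cst0.
have := agree_add sd sg (smooth_at_cst 0 s) sg H (@agree_refl W k g s).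
have -> : (fun x => f x - g x + g x) = f by apply/funext => x; rewrite subrK.
by have -> : (fun x => cst 0 x + g x) = g by apply/funext => x; rewrite add0r.
Qed.

End Agree.

(** * Curves depending on a parameter *)
Section ParameterCurves.
Context {R : realType}.
Implicit Types V W Q : normedModType R.

Lemma derive1_pair V W (f : R -> V) (g : R -> W) (s : R) : smooth_at f s -> smooth_at g s ->
  derive1 (fun x => (f x, g x)) s = (derive1 f s, derive1 g s).
Proof.
move=> /smooth_at_differentiable df /smooth_at_differentiable dg.
by rewrite !derive1E !deriveE ?diff_pair //; exact: differentiable_pair.
Qed.

Lemma smooth_at_id V (x : V) {fV : findim V} : smooth_at (fun y : V => y) x.
Proof. exact: smooth_at_linear. Qed.

(** The derivatives of a slice s |-> H (q, s) are iterated partial derivatives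
    of H; in particular they are smooth in (q, s). *)
Lemma derive1n_slice Q W (H : Q * R -> W) q (s : R) j : smooth_at H (q, s) ->
  derive1n j (fun s => H (q, s)) s = iter j (fun (F : Q * R -> W) x => 'D_(0, 1) F x) H (q, s)
      /\
  smooth_at (iter j (fun (F : Q * R -> W) x => 'D_(0, 1) F x) H) (q, s).
Proof.
elim: j s => [//|j IH] s sH; have [E sj] := IH s sH.
rewrite derive1nS iterS; split; last exact: smooth_at_derive.
have sc : smooth_at (fun s : R => (q, s)) s.
  apply: smooth_at_pair; first exact: smooth_at_cst.
  exact: smooth_at_linear.
have cE : derive1 (fun s : R => (q, s)) s = (0, 1).
  by rewrite derive1_pair ?derive1_id ?derive1_cst //; [exact: smooth_at_cst|exact:
      smooth_at_id].
set G := iter j _ H in E sj *.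
rewrite -cE -(derive1_comp_curve sc sj) !derive1E; apply: near_eq_derive.
have n1 : \forall x \near s, smooth_at H (q, x).
  exact: (smooth_at_continuous sc (smooth_at_near sH)).
by apply: filterS n1 => x /IH[].
Qed.

Lemma smooth_at_slice Q W (H : Q * R -> W) q0 (s : R) j {fQ : findim Q} :
  smooth_at H (q0, s) -> smooth_at (fun q => derive1n j (fun s => H (q, s)) s) q0.
Proof.
move=> sH; have [_ sj] := derive1n_slice j sH.
have sc : smooth_at (fun q : Q => (q, s)) q0.
  by apply: smooth_at_pair; [exact: smooth_at_id|exact: smooth_at_cst].
apply: (smooth_at_ext _ (smooth_at_comp sj sc)).
have n1 : \forall q \near q0, smooth_at H (q, s).
  exact: (smooth_at_continuous sc (smooth_at_near sH)).
by apply: filterS n1 => q /(derive1n_slice j)[].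
Qed.

(** The polynomial curve with Taylor coefficients a 0, ..., a r.-1 at 0. *)
Definition tpoly V (r : nat) (a : nat -> V) (s : R) : V :=
  \sum_(i < r) (s ^+ i / i`!%:R) *: a i.

Lemma smooth_at_exp V (f : V -> R) n x : smooth_at f x -> smooth_at (fun y => f y ^+ n) x.
Proof.
move=> sf; elim: n => [|n IH]; first exact: smooth_at_cst.
by apply: (smooth_at_eq _ (smooth_at_scale (W := R) sf IH)) => y; rewrite exprS.
Qed.

Lemma smooth_at_tpoly Q V r (a : nat -> Q -> V) (c : Q -> R) q0 :
  (forall i, smooth_at (a i) q0) -> smooth_at c q0 ->
  smooth_at (fun q => tpoly r (fun i => a i q) (c q)) q0.
Proof.
move=> sa sc; apply: smooth_at_sum => i; apply: smooth_at_scale (sa i).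
apply: (smooth_at_scale (W := R)); last exact: smooth_at_cst.
exact: smooth_at_exp.
Qed.

Lemma derive1_tpoly V r (a : nat -> V) : derive1 (tpoly r.+1 a) = tpoly r (fun i => a i.+1).
Proof.
apply/funext => s; rewrite derive1E.
have dm i : smooth_at (fun s : R => (s ^+ i / i`!%:R) *: a i) s.
  apply: smooth_at_scale; last exact: smooth_at_cst.
  apply: (smooth_at_scale (W := R)); last exact: smooth_at_cst.
  by apply: smooth_at_exp; exact: smooth_at_id.
have -> : tpoly r.+1 a = \sum_(i < r.+1) (fun s : R => (s ^+ i / i`!%:R) *: a i).
  by apply/funext => x; rewrite fct_sumE.
rewrite derive_sum; last first.
  by move=> i; apply: diff_derivable; exact: smooth_at_differentiable.
have E i : 'D_1 (fun s : R => (s ^+ i / i`!%:R) *: a i) s = (i%:R * s ^+ i.-1 / i`!%:R) *: a i.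
  have -> : (fun s : R => (s ^+ i / i`!%:R) *: a i) = (fun s => s ^+ i *: (i`!%:R^-1 *: a i)).
    by apply/funext => x; rewrite scalerA.
  have dx : smooth_at (fun s : R => s ^+ i) s by apply: smooth_at_exp; exact: smooth_at_id.
  rewrite (is_diff_scale (smooth_at_differentiable dx) (differentiable_cst _ _)).2.
  by rewrite derive_cst scaler0 addr0 exp_derive scalerA; congr (_ *: _);
    rewrite -![_ *: _]/(_ * _) mulr1.
rewrite big_ord_recl E mul0r mul0r scale0r add0r /tpoly.
apply: eq_bigr => i _; rewrite E; congr (_ *: _).
rewrite /= /bump /= add1n factS natrM invfM mulrA; congr (_ * _).
by rewrite mulrAC mulfV ?pnatr_eq0 // mul1r.
Qed.

Lemma derive1n_tpoly V r (a : nat -> V) j : (j < r)%N -> derive1n j (tpoly r a) 0 = a j.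
Proof.
elim: j r a => [|j IH] [|r] a // jr; last by rewrite derive1Sn derive1_tpoly IH.
by rewrite /= /tpoly big_ord_recl /= expr0 fact0 divr1 scale1r big1 ?addr0 // => i _;
  rewrite expr0n mul0r scale0r.
Qed.

End ParameterCurves.

(** * The derivative array along a curve *)
Section Prolongation.
Context {R : realType} {n m : nat}.
Variables (A : dae R n m) (l : nat).
Notation jet := (@jet R n m l).
Notation TD := (@total_derive R n m l).

Lemma smooth_at_dir (U V W : normedModType R) (g : V -> W) (h X : U -> V) x :
  findim V -> smooth_at g (h x) -> smooth_at h x -> smooth_at X x ->
  smooth_at (fun y => 'D_(X y) g (h y)) x.
Proof.
move=> fV sg sh sX; have [I [e [kap [ck ek]]]] := fV.
have H : smooth_at (fun y => \sum_i kap i (X y) *: 'D_(e i) g (h y)) x.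
  apply: smooth_at_sum => i; apply: smooth_at_scale; last first.
    by apply: (smooth_at_comp (g := fun y => 'D_(e i) g y)) => //; exact: smooth_at_derive.
  apply: (smooth_at_comp (g := kap i)) sX; apply: smooth_at_linear.
  by move=> a y z; rewrite linearP.
have n1 : \forall y \near x, smooth_at g (h y).
  exact: (smooth_at_continuous sh (smooth_at_near sg)).
apply: smooth_at_ext H; move: n1; apply: filterS => y sy.
by rewrite [in RHS](ek (X y)) derive_sumE //; exact: smooth_at_differentiable.
Qed.

Lemma shift_up_linear q : linear (@shift_up R l q).
Proof.
by move=> a x y; apply/matrixP => i j; rewrite !mxE; case: ifP; rewrite ?mulr0 ?addr0.
Qed.

Lemma smooth_at_total_field x : smooth_at (@total_field R n m l) x.
Proof.
apply: smooth_at_pair; first apply: smooth_at_pair; first apply: smooth_at_pair.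
- exact: smooth_at_cst.
- by apply: smooth_at_linear => a y z; rewrite /jdz /jeta linearP.
- by apply: smooth_at_linear => a y z; rewrite /jeta shift_up_linear.
- by apply: smooth_at_linear => a y z; rewrite /jU shift_up_linear.
Qed.

Definition jet0 (x : jet) := (jt x, jz x, jdz x, ju x).

Lemma jet0_linear : linear jet0.
Proof.
by move=> a x y; rewrite /jet0 /jt /jz /jdz /ju /jeta /jU /= !linearP.
Qed.

Lemma smooth_at_jetF x : smooth_at (dae_F A) (jet0 x) -> smooth_at (jetF A (l := l)) x.
Proof.
move=> sF; apply: (smooth_at_comp (f := jet0) (g := dae_F A)) => //.
by apply: smooth_at_linear; exact: jet0_linear.
Qed.

Lemma smooth_at_iter_total k x : smooth_at (dae_F A) (jet0 x) ->
  smooth_at (iter k TD (jetF A (l := l))) x.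
Proof.
move=> sF; elim: k => [|k IH]; first exact: smooth_at_jetF.
apply: (smooth_at_dir (h := fun y => y)) => //; first exact: smooth_at_id.
exact: smooth_at_total_field.
Qed.

Lemma smooth_at_deriv_array x : smooth_at (dae_F A) (jet0 x) ->
  smooth_at (deriv_array A (l := l)) x.
Proof.
move=> sF; apply: (smooth_at_comp (g := mxvec)).
  by apply: smooth_at_linear => a y z; rewrite linearP.
apply/smooth_at_mxP => i j.
have /smooth_at_mxP /(_ 0 j) := smooth_at_iter_total i sF.
by apply: smooth_at_eq => y; rewrite mxE.
Qed.

(** [local_upto k g]: g only reads rows 0, ..., k of eta and of U.  The k-th
    total derivative of F is of this kind, so that the zero row which [shift_up]
    puts at the end is never read. *)
Definition same_rows q (k : nat) (M N : 'M[R]_(l.+1, q)) :=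
  forall i : 'I_l.+1, (i <= k)%N -> row i M = row i N.

Definition jet_eq k (x y : jet) := [/\ jt x = jt y, jz x = jz y,
  same_rows k (jeta x) (jeta y) & same_rows k (jU x) (jU y)].

Definition local_upto k (g : jet -> 'rV[R]_n) := forall x y, jet_eq k x y -> g x = g y.

Lemma same_rows_lin q k (a : R) (M N M' N' : 'M[R]_(l.+1, q)) :
  same_rows k M N -> same_rows k M' N' -> same_rows k (a *: M + M') (a *: N + N').
Proof. by move=> h h' i ik; rewrite !linearP /= h // h'. Qed.

Lemma jet_eq_lin k (a : R) (x y x' y' : jet) :
  jet_eq k x y -> jet_eq k x' y' -> jet_eq k (a *: x + x') (a *: y + y').
Proof.
move: x y x' y' => [[[t z] e] u] [[[t1 z1] e1] u1] [[[t' z'] e'] u'] [[[t2 z2] e2] u2].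
rewrite /jet_eq /jt /jz /jeta /jU /= => -[-> -> h1 h2] [-> -> h1' h2'].
by split => //; exact: same_rows_lin.
Qed.

(** The difference quotients are equal as functions, so that no
    differentiability is involved. *)
Lemma local_derive k g x y v w : local_upto k g -> jet_eq k x y -> jet_eq k v w ->
  'D_v g x = 'D_w g y.
Proof.
move=> lg xy vw; rewrite /derive.
have -> // : (fun h => h^-1 *: ((g \o shift x) (h *: v) - g x)) =
          (fun h => h^-1 *: ((g \o shift y) (h *: w) - g y)).
by apply/funext => h /=; rewrite (lg _ _ xy) (lg _ _ (jet_eq_lin h vw xy)).
Qed.

Lemma same_rows_shift q k (M N : 'M[R]_(l.+1, q)) : (k < l)%N ->
  same_rows k.+1 M N -> same_rows k (shift_up M) (shift_up N).
Proof.
move=> kl h i ik; apply/rowP => j; rewrite !mxE (leq_ltn_trans ik kl).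
have il : (i.+1 < l.+1)%N by rewrite ltnS (leq_ltn_trans ik kl).
have := h (inord i.+1); rewrite inordK // => /(_ ik) /rowP /(_ j).
by rewrite !mxE.
Qed.

Lemma same_rowsW q k (M N : 'M[R]_(l.+1, q)) : same_rows k.+1 M N -> same_rows k M N.
Proof. by move=> h i ik; apply: h; exact: leqW. Qed.

Lemma local_total k g : (k < l)%N -> local_upto k g -> local_upto k.+1 (TD g).
Proof.
move=> kl lg x y [h1 h2 h3 h4]; apply: (local_derive lg).
  by split=> //; exact: same_rowsW.
split => //; [|exact: same_rows_shift|exact: same_rows_shift].
by rewrite /jz /= /jdz; apply: h3.
Qed.

Lemma local_iter_total k : (k <= l)%N -> local_upto k (iter k TD (jetF A (l := l))).
Proof.
elim: k => [_ x y [h1 h2 h3 h4]|k IH kl]; last by apply: local_total => //; apply: IH; exact: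
    ltnW.
by rewrite /= /jetF h1 h2 /jdz /ju h3 // h4.
Qed.

(** The jet at time t0 + s of a state curve and an input curve. *)
Definition jet_lift (t0 : R) (zeta : R -> 'rV[R]_n) (ups : R -> 'rV[R]_m) (s : R) : jet :=
  (t0 + s, zeta s, \matrix_(k < l.+1) derive1n k.+1 zeta s,
   \matrix_(k < l.+1) derive1n k ups s).

Lemma smooth_at_rows (V : normedModType R) p q (c : 'I_p -> V -> 'rV[R]_q) x :
  (forall i, smooth_at (c i) x) -> smooth_at (fun y => \matrix_i c i y) x.
Proof.
move=> sc; apply/smooth_at_mxP => i j; have /smooth_at_mxP /(_ 0 j) := sc i.
by apply: smooth_at_eq => y; rewrite mxE.
Qed.

Lemma derive1_rows p q (c : 'I_p -> R -> 'rV[R]_q) (s : R) :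
  (forall i, smooth_at (c i) s) ->
  derive1 (fun y => \matrix_i c i y) s = \matrix_i derive1 (c i) s.
Proof.
move=> sc; have sd := smooth_at_differentiable (smooth_at_rows sc).
rewrite derive1E derive_mx; last exact: diff_derivable.
apply/matrixP => i j; rewrite !mxE derive1E derive_mx ?mxE; last first.
  by apply: diff_derivable; exact: smooth_at_differentiable.
suff -> : (fun t => (\matrix_i0 c i0 t) i j) = (fun t => c i t 0 j) by [].
by apply/funext => y; rewrite mxE.
Qed.

Section Lift.
Variables (t0 : R) (zeta : R -> 'rV[R]_n) (ups : R -> 'rV[R]_m).

Lemma smooth_at_jet_lift s : smooth_at zeta s -> smooth_at ups s ->
  smooth_at (jet_lift t0 zeta ups) s.
Proof.
move=> sz su; apply: smooth_at_pair; first apply: smooth_at_pair; first apply: smooth_at_pair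
    => //.
- by apply: smooth_at_add; [exact: smooth_at_cst|exact: smooth_at_id].
- by apply: smooth_at_rows => i; exact: (smooth_at_derive1n i.+1 sz).
- by apply: smooth_at_rows => i; exact: (smooth_at_derive1n i su).
Qed.

Lemma derive1_jet_lift s : smooth_at zeta s -> smooth_at ups s ->
  derive1 (jet_lift t0 zeta ups) s =
  (1, derive1 zeta s, \matrix_(k < l.+1) derive1n k.+2 zeta s,
   \matrix_(k < l.+1) derive1n k.+1 ups s).
Proof.
move=> sz su.
have st : smooth_at (fun s : R => t0 + s) s.
  by apply: smooth_at_add; [exact: smooth_at_cst|exact: smooth_at_id].
have szs (i : 'I_l.+1) : smooth_at (derive1n i.+1 zeta) s by exact: (smooth_at_derive1n i.+1
    sz).
have sus (i : 'I_l.+1) : smooth_at (derive1n i ups) s by exact: (smooth_at_derive1n i su).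
have srz := smooth_at_rows szs; have sru := smooth_at_rows sus.
rewrite derive1_pair; [|exact: smooth_at_pair (smooth_at_pair st sz) srz|exact: sru].
rewrite derive1_pair; [|exact: smooth_at_pair st sz|exact: srz].
rewrite derive1_pair // !derive1_rows //; congr (_, _, _, _).
rewrite derive1E deriveD; [|exact: derivable_cst|exact: derivable_id].
by rewrite derive_cst add0r derive_id.
Qed.

Definition residual s := dae_F A (t0 + s, zeta s, derive1 zeta s, ups s).

Lemma jet0_lift s : jet0 (jet_lift t0 zeta ups s) = (t0 + s, zeta s, derive1 zeta s, ups s).
Proof.
by rewrite /jet0 /jt /jz /jdz /ju /jeta /jU /=; congr (_, _, _, _); apply/rowP => j; rewrite
    !mxE.
Qed.

(** The velocity of the lifted curve differs from the total field only in the
    last rows, which the k-th total derivative with k < l does not read.  So each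
    total derivative is the time derivative of the previous one. *)
Lemma iter_total_lift k s : (k <= l)%N -> smooth_at zeta s -> smooth_at ups s ->
  smooth_at (dae_F A) (t0 + s, zeta s, derive1 zeta s, ups s) ->
  iter k TD (jetF A (l := l)) (jet_lift t0 zeta ups s) = derive1n k residual s.
Proof.
elim: k s => [|k IH] s kl sz su sF.
  by rewrite /= /jetF -[(_, _, _, _)]/(jet0 _) jet0_lift.
have sl := smooth_at_jet_lift sz su.
have sk : smooth_at (iter k TD (jetF A (l := l))) (jet_lift t0 zeta ups s).
  by apply: smooth_at_iter_total; rewrite jet0_lift.
rewrite derive1nS iterS.
transitivity (derive1 (fun s => iter k TD (jetF A (l := l)) (jet_lift t0 zeta ups s)) s).
  have E := derive1_comp_curve sl sk; rewrite (derive1_jet_lift sz su) in E.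
  apply: etrans _ (esym E).
  apply: (local_derive (local_iter_total (ltnW kl))); first by split.
  rewrite /total_field; split => //=.
  - by rewrite /jz /= /jdz; apply/rowP => j; rewrite !mxE.
  - move=> i ik; apply/rowP => j; have il := leq_ltn_trans ik kl.
    by rewrite /jeta /= !mxE il inordK.
  - move=> i ik; apply/rowP => j; have il := leq_ltn_trans ik kl.
    by rewrite /jU /= !mxE il inordK.
rewrite !derive1E; apply: near_eq_derive.
have sc : smooth_at (fun s => (t0 + s, zeta s, derive1 zeta s, ups s)) s.
  apply: smooth_at_pair => //; apply: smooth_at_pair; last exact: smooth_at_derive1.
  apply: smooth_at_pair => //.
  by apply: smooth_at_add; [exact: smooth_at_cst|exact: smooth_at_id].
have n1 : \forall x \near s, smooth_at (dae_F A) (t0 + x, zeta x, derive1 zeta x, ups x).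
  exact: (smooth_at_continuous sc (smooth_at_near sF)).
have n2 := smooth_at_near sz; have n3 := smooth_at_near su.
by apply: filterS3 n1 n2 n3 => x h1 h2 h3; apply: IH => //; exact: ltnW.
Qed.

Lemma deriv_array_lift s : smooth_at zeta s -> smooth_at ups s ->
  smooth_at (dae_F A) (t0 + s, zeta s, derive1 zeta s, ups s) ->
  deriv_array A (jet_lift t0 zeta ups s) = mxvec (\matrix_(k < l.+1) derive1n k residual s).
Proof.
move=> sz su sF; rewrite /deriv_array; congr mxvec; apply/matrixP => i j; rewrite !mxE.
by rewrite iter_total_lift // -ltnS.
Qed.

Lemma smooth_at_residual s : smooth_at zeta s -> smooth_at ups s ->
  smooth_at (dae_F A) (t0 + s, zeta s, derive1 zeta s, ups s) -> smooth_at residual s.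
Proof.
move=> sz su sF; apply: (smooth_at_comp sF).
apply: smooth_at_pair => //; apply: smooth_at_pair; last exact: smooth_at_derive1.
apply: smooth_at_pair => //.
by apply: smooth_at_add; [exact: smooth_at_cst|exact: smooth_at_id].
Qed.

End Lift.

End Prolongation.

(** * Linear algebra of Hypothesis H *)
Section JetJacobians.
Context {R : realType}.

Lemma derive_linear (U V W : normedModType R) (L : V -> W) (g : U -> V) x v :
  findim V -> linear L -> differentiable g x ->
  'D_v (fun y => L (g y)) x = L ('D_v g x).
Proof.
move=> fV lL dg; have [dL LE] := is_diff_linear (g x) fV lL.
by rewrite (derive_comp (f := g) (g := L)) // LE.
Qed.

Lemma derive_affine (U V W : normedModType R) (L : U -> V) (c : V) (g : V -> W) x v :
  findim U -> linear L -> differentiable g (c + L x) ->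
  'D_v (fun y => g (c + L y)) x = 'D_(L v) g (c + L x).
Proof.
move=> fU lL dg; have [dL LE] := is_diff_linear x fU lL.
have da : differentiable (fun y => c + L y) x.
  by apply: differentiableD => //; exact: differentiable_cst.
rewrite (derive_comp (f := fun y => c + L y) (g := g)) //; congr (derive g _ _).
rewrite deriveD; [|exact: derivable_cst|exact: diff_derivable].
by rewrite derive_cst add0r LE.
Qed.

Lemma derive_vD (V W : normedModType R) (g : V -> W) x u v : differentiable g x ->
  'D_(u + v) g x = 'D_u g x + 'D_v g x.
Proof. by move=> dg; rewrite !deriveE // linearD. Qed.

(** The rows of B lie in the kernel of S and have the right rank to span it. *)
Lemma kermx_complement (n a d : nat) (S : 'M[R]_(n, a)) (B : 'M[R]_(d, n)) (z : 'rV[R]_n) :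
  \rank S = a -> \rank B = d -> d = (n - a)%N -> B *m S = 0 -> z *m S = 0 ->
  exists c, z = c *m B.
Proof.
move=> rS rB dE BS zS.
have sB : (B <= kermx S)%MS by apply/sub_kermxP.
have : (B == kermx S)%MS by rewrite -(mxrank_leqif_eq sB) mxrank_ker rS rB dE.
move=> /andP[_ sK].
have : (z <= B)%MS by apply: submx_trans sK; apply/sub_kermxP.
by move=> /submxP.
Qed.

Context {n m l : nat}.
Variables (A : dae R n m).
Notation jet := (@jet R n m l).
Notation r := (l.+1 * n)%N.
Notation D := (deriv_array A (l := l)).

Lemma jetE (x : jet) : x = (jt x, jz x, jeta x, jU x).
Proof. by case: x => [[[t z] e] u]. Qed.

Lemma array_detaE (x : jet) (e : 'rV[R]_r) : smooth_at (dae_F A) (jet0 x) ->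
  e *m (array_deta A x)^T = 'D_(0, 0, vec_mx e, 0) D x.
Proof.
move=> sF; have dD := smooth_at_differentiable (smooth_at_deriv_array sF).
rewrite /array_deta trmxK.
pose L (e : 'rV[R]_r) : jet := (0, 0, vec_mx e, 0).
have lL : linear L.
  by move=> a u v; rewrite /L linearP -[RHS]/(_, _, _, _) /= ?mulr0 ?scaler0 ?addr0.
pose c : jet := (jt x, jz x, 0, jU x).
have cE e' : (jt x, jz x, vec_mx e', jU x) = c + L e'.
  by rewrite -[RHS]/(_, _, _, _) /= !addr0 add0r.
have xE : x = c + L (mxvec (jeta x)) by rewrite -cE mxvecK -jetE.
have E : (fun e => D (jt x, jz x, vec_mx e, jU x)) = (fun e => D (c + L e)).
  by apply/funext => e'; rewrite cE.
have sc : smooth_at (fun e => D (c + L e)) (mxvec (jeta x)).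
  apply: (smooth_at_comp (g := D) (f := fun e => c + L e)).
    by rewrite -xE; exact: smooth_at_deriv_array.
  by apply: smooth_at_add; [exact: smooth_at_cst|exact: smooth_at_linear].
rewrite E -deriveEjacobian; last exact: smooth_at_differentiable.
by rewrite derive_affine -?xE.
Qed.

Lemma array_dzE (x : jet) (z : 'rV[R]_n) : smooth_at (dae_F A) (jet0 x) ->
  z *m (array_dz A x)^T = 'D_(0, z, 0, 0) D x.
Proof.
move=> sF; have dD := smooth_at_differentiable (smooth_at_deriv_array sF).
rewrite /array_dz trmxK.
pose L (z : 'rV[R]_n) : jet := (0, z, 0, 0).
have lL : linear L.
  by move=> a u v; rewrite /L -[RHS]/(_, _, _, _) /= ?mulr0 ?scaler0 ?addr0.
pose c : jet := (jt x, 0, jeta x, jU x).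
have cE e' : (jt x, e', jeta x, jU x) = c + L e'.
  by rewrite -[RHS]/(_, _, _, _) /= !addr0 add0r.
have xE : x = c + L (jz x) by rewrite -cE -jetE.
have E : (fun e => D (jt x, e, jeta x, jU x)) = (fun e => D (c + L e)).
  by apply/funext => e'; rewrite cE.
have sc : smooth_at (fun e => D (c + L e)) (jz x).
  apply: (smooth_at_comp (g := D) (f := fun e => c + L e)).
    by rewrite -xE; exact: smooth_at_deriv_array.
  by apply: smooth_at_add; [exact: smooth_at_cst|exact: smooth_at_linear].
rewrite E -deriveEjacobian; last exact: smooth_at_differentiable.
by rewrite derive_affine -?xE.
Qed.

Lemma F_ddzE (x : jet) (p : 'rV[R]_n) : smooth_at (dae_F A) (jet0 x) ->
  p *m (F_ddz A x)^T = 'D_(0, 0, p, 0) (dae_F A) (jet0 x).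
Proof.
move=> sF; have dF := smooth_at_differentiable sF.
rewrite /F_ddz trmxK.
pose L (z : 'rV[R]_n) : R * 'rV[R]_n * 'rV[R]_n * 'rV[R]_m := (0, 0, z, 0).
have lL : linear L.
  by move=> a u v; rewrite /L -[RHS]/(_, _, _, _) /= ?mulr0 ?scaler0 ?addr0.
pose c : R * 'rV[R]_n * 'rV[R]_n * 'rV[R]_m := (jt x, jz x, 0, ju x).
have cE e' : (jt x, jz x, e', ju x) = c + L e'.
  by rewrite -[RHS]/(_, _, _, _) /= !addr0 add0r.
have xE : jet0 x = c + L (jdz x) by rewrite -cE.
have E : (fun e => dae_F A (jt x, jz x, e, ju x)) = (fun e => dae_F A (c + L e)).
  by apply/funext => e'; rewrite cE.
have sc : smooth_at (fun e => dae_F A (c + L e)) (jdz x).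
  apply: (smooth_at_comp (g := dae_F A) (f := fun e => c + L e)).
    by rewrite -xE.
  by apply: smooth_at_add; [exact: smooth_at_cst|exact: smooth_at_linear].
rewrite E -deriveEjacobian; last exact: smooth_at_differentiable.
by rewrite derive_affine -?xE.
Qed.

End JetJacobians.

Section RegularPoint.
Context {R : realType} {n m l : nat}.
Variables (A : dae R n m) (a d : nat).
Notation jet := (@jet R n m l).
Notation r := (l.+1 * n)%N.
Notation D := (deriv_array A (l := l)).
Hypotheses (dE : d = (n - a)%N) (an : (a <= n)%N).

(** Conditions (i)-(iii) of Hypothesis H at one point, without Z_D. *)
Definition regular_point (x : jet) (Z : 'M[R]_(r, a)) (B : 'M[R]_(n, d)) : Prop :=
  [/\ \rank (array_deta A x) = (r - a)%N /\ Z^T *m array_deta A x = 0,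
      \rank (Z^T *m array_dz A x) = a /\ Z^T *m array_dz A x *m B = 0
    & \rank B = d /\ \rank (F_ddz A x *m B) = d].

Variables (x : jet) (Z : 'M[R]_(r, a)) (B : 'M[R]_(n, d)).
Hypotheses (sF : smooth_at (dae_F A) (jet0 x)) (reg : regular_point x Z B).

(** Multiplying the linearised array by Z_A removes the eta-part; what remains
    says that z is in the kernel of Z_A^T D_z, which is the image of T_A. *)
Lemma tangent_dz (z : 'rV[R]_n) (e : 'M[R]_(l.+1, n)) :
  'D_(0, z, e, 0) D x = 0 -> exists c, z = c *m B^T.
Proof.
case: reg => [[_ ZE] [rz zB] [rB _]].
have dD := smooth_at_differentiable (smooth_at_deriv_array sF).
have -> : ((0, z, e, 0) : jet) = (0, z, 0, 0) + (0, 0, e, 0).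
  by rewrite -[RHS]/(_, _, _, _) /= !addr0 add0r.
rewrite derive_vD // -array_dzE // -{1}(mxvecK e) -array_detaE // => H.
apply: (kermx_complement (S := (array_dz A x)^T *m Z) (a := a)) => //.
- by rewrite -[LHS]mxrank_tr trmx_mul trmxK.
- by rewrite mxrank_tr.
- by apply: trmx_inj; rewrite !trmx_mul !trmxK trmx0.
have := congr1 (mulmx^~ Z) H; rewrite /= mulmxDl mul0mx -!mulmxA.
suff -> : (array_deta A x)^T *m Z = 0 by rewrite mulmx0 addr0.
by apply: trmx_inj; rewrite trmx_mul trmxK ZE trmx0.
Qed.

Lemma rank_ker_deta : \rank (kermx (array_deta A x)^T) = a.
Proof.
case: reg => [[rE _] _ _]; rewrite mxrank_ker mxrank_tr rE subKn //.
by apply: leq_trans an _; rewrite leq_pmull.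
Qed.

Lemma dynamic_injective (c : 'rV[R]_d) :
  c *m B^T *m (F_ddz A x)^T = 0 -> c = 0.
Proof.
case: reg => [_ _ [_ rF]]; rewrite -mulmxA -trmx_mul => H.
have : row_free (F_ddz A x *m B)^T by rewrite /row_free mxrank_tr rF.
by move=> /row_free_inj inj; apply: inj; rewrite H mul0mx.
Qed.

End RegularPoint.

(** * Tools for smooth maps of row vectors *)
Section SmoothnessTools.
Context {R : realType}.

Lemma linear_row_mx p q : linear (fun x : 'rV[R]_p * 'rV[R]_q => row_mx x.1 x.2).
Proof. by move=> c u v; rewrite /= scale_row_mx add_row_mx. Qed.

Lemma smooth_at_row_mx (V : normedModType R) p q (f : V -> 'rV[R]_p) (g : V -> 'rV[R]_q) x :
  smooth_at f x -> smooth_at g x -> smooth_at (fun y => row_mx (f y) (g y)) x.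
Proof.
move=> sf sg; apply: (smooth_at_comp (f := fun y => (f y, g y))
  (g := fun x : 'rV[R]_p * 'rV[R]_q => row_mx x.1 x.2)); last exact: smooth_at_pair.
by apply: smooth_at_linear; exact: linear_row_mx.
Qed.

Lemma smooth_at_linear_comp (V V' W : normedModType R) (f : V -> V') (L : V' -> W) x :
  findim V' -> linear L -> smooth_at f x -> smooth_at (fun y => L (f y)) x.
Proof. by move=> fV lL sf; apply: (smooth_at_comp (g := L)) => //; exact: smooth_at_linear. Qed.

Lemma continuous_near (V W : normedModType R) (f : V -> W) x (P : W -> Prop) :
  smooth_at f x -> (\forall y \near f x, P y) -> \forall y \near x, P (f y).
Proof. by move=> sf h; exact: (smooth_at_continuous sf h). Qed.

(** The time interval is nondegenerate, so that each of its points is a limit of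
    interior points. *)
Lemma closure_itv (T t : R) : 0 < T -> t \in `[0, T] ->
  closure [set s : R | 0 < t + s < T] 0.
Proof.
move=> T0; rewrite in_itv /= => /andP[t0 tT] B /nbhs_ballP[e /= e0 be].
have [tl|tl] := ltP t (T / 2).
  exists (Num.min (e / 2) (T / 4)); split => /=.
    have : 0 < Num.min (e / 2) (T / 4) by rewrite lt_min !divr_gt0.
    have : Num.min (e / 2) (T / 4) <= T / 4 by rewrite ge_min lexx orbT.
    lra.
  apply: be; rewrite -ball_normE /= sub0r normrN ger0_norm; last first.
    by rewrite le_min !divr_ge0 // ltW.
  by rewrite gt_min ltr_pdivrMr // ltr_pMr // ltr1n.
exists (- Num.min (e / 2) (T / 4)); split => /=.
  have : 0 < Num.min (e / 2) (T / 4) by rewrite lt_min !divr_gt0.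
  have : Num.min (e / 2) (T / 4) <= T / 4 by rewrite ge_min lexx orbT.
  lra.
apply: be; rewrite -ball_normE /= sub0r opprK ger0_norm; last first.
  by rewrite le_min !divr_ge0 // ltW.
by rewrite gt_min ltr_pdivrMr // ltr_pMr // ltr1n.
Qed.

Lemma open_itv_shift (T t : R) : open [set s : R | 0 < t + s < T].
Proof.
have -> : [set s : R | 0 < t + s < T] = `] (- t), (T - t) [%classic.
  apply/seteqP; split=> s /=; rewrite in_itv /=; lra.
exact: interval_open.
Qed.

Lemma derive_pair (V W W' : normedModType R) (f : V -> W) (g : V -> W') x v :
  differentiable f x -> differentiable g x ->
  'D_v (fun y => (f y, g y)) x = ('D_v f x, 'D_v g x).
Proof. by move=> df dg; rewrite !deriveE ?diff_pair //; exact: differentiable_pair. Qed.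

Lemma lsubmx_linear p q : linear (lsubmx : 'rV[R]_(p + q) -> 'rV[R]_p).
Proof. by move=> c u w; rewrite linearP. Qed.

Lemma rsubmx_linear p q : linear (rsubmx : 'rV[R]_(p + q) -> 'rV[R]_q).
Proof. by move=> c u w; rewrite linearP. Qed.

End SmoothnessTools.

(** * The algebraic constraint of one system *)
Section Constraint.
Context {R : realType} {n m mu : nat}.
Variables (T : R) (A : dae R n m) (a d : nat).
Notation jet := (@jet R n m mu).
Notation r := (mu.+1 * n)%N.
Notation D := (deriv_array A (l := mu)).
Notation M := (array_set T A (l := mu)).
Notation Q := (R * 'M[R]_(mu.+1, m))%type.
Hypotheses (dE : d = (n - a)%N) (an : (a <= n)%N) (T_gt0 : 0 < T).
Hypothesis sA : smooth_dae T A.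

Lemma dom_smooth (x : jet) : dae_dom T A (jet0 x) -> smooth_at (dae_F A) (jet0 x).
Proof. by case: sA => _ _ _ sF; exact: smooth_at_on. Qed.

Definition qjet (x : jet) : Q := (jt x, jU x).
Definition wjet (x : jet) : 'rV[R]_(n + r) := row_mx (jz x) (mxvec (jeta x)).
Definition mkjet (x : Q * 'rV[R]_(n + r)) : jet :=
  (x.1.1, lsubmx x.2, vec_mx (rsubmx x.2), x.1.2).

Lemma mkjetK x : mkjet (qjet x, wjet x) = x.
Proof. by rewrite /mkjet /= /wjet row_mxKl row_mxKr mxvecK -jetE. Qed.

Lemma mkjet_linear : linear mkjet.
Proof. by move=> c u v; rewrite /mkjet /= !linearP. Qed.

Lemma wjet_linear : linear wjet.
Proof. by move=> c u v; rewrite /wjet /jeta /= linearP scale_row_mx add_row_mx. Qed.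

(** Coordinates near a point x0 of the zero set: an element q = (t, U) together
    with w = (z, eta) written as one row vector. *)
Variables (ZA : jet -> 'M[R]_(r, a)) (TA : jet -> 'M[R]_(n, d)).
Variable x0 : jet.
Hypotheses (Mx0 : M x0) (sTA : smooth_at TA x0).
Hypothesis regH : \forall x \near x0, M x -> regular_point A x (ZA x) (TA x).

Let sF0 : smooth_at (dae_F A) (jet0 x0).
Proof. by apply: dom_smooth; case: Mx0. Qed.

Let reg0 : regular_point A x0 (ZA x0) (TA x0).
Proof. exact: (nbhs_singleton regH Mx0). Qed.

Let E0 : 'M[R]_r := (array_deta A x0)^T.
Let b := \rank (kermx E0).
(* z Ld are the differential components of z, and eta Lr are coordinates of eta
   along the kernel of the eta-Jacobian at x0. *)
Let Ld : 'M[R]_(n, d) := pinvmx (TA x0)^T.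
Let Lr : 'M[R]_(r, b) := pinvmx (row_base (kermx E0)).

Let TALd : (TA x0)^T *m Ld = 1%:M.
Proof.
case: reg0 => _ _ [rB _]; apply: mulmxVp.
by rewrite /row_free mxrank_tr rB.
Qed.

Let Lr_inj (e : 'rV[R]_r) : e *m E0 = 0 -> e *m Lr = 0 -> e = 0.
Proof.
move=> /sub_kermxP; rewrite -(eq_row_base (kermx E0)) => /submxP[c ->].
by rewrite -mulmxA mulmxVp ?row_base_free // mulmx1 => ->; rewrite mul0mx.
Qed.

Let dims : (n + r = r + (d + b))%N.
Proof.
rewrite /b (rank_ker_deta an reg0) dE subnK // addnC //.
Qed.

(** The derivative array completed by the coordinates z Ld and eta Lr to a map
    with invertible derivative in w = (z, eta). *)
Definition constr_map (x : Q * 'rV[R]_(n + r)) : 'rV[R]_(r + (d + b)) :=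
  row_mx (D (mkjet x)) (row_mx (lsubmx x.2 *m Ld) (rsubmx x.2 *m Lr)).
Notation Phi := constr_map.

Let l2 : linear (fun x : Q * 'rV[R]_(n + r) => lsubmx x.2 *m Ld).
Proof. by move=> c u v; rewrite /= linearP mulmxDl scalemxAl. Qed.
Let l3 : linear (fun x : Q * 'rV[R]_(n + r) => rsubmx x.2 *m Lr).
Proof. by move=> c u v; rewrite /= linearP mulmxDl scalemxAl. Qed.

Lemma smooth_at_constr_map x : smooth_at (dae_F A) (jet0 (mkjet x)) -> smooth_at Phi x.
Proof.
move=> sF; apply: smooth_at_row_mx.
  apply: (smooth_at_comp (g := D) (f := mkjet)); first exact: smooth_at_deriv_array.
  by apply: smooth_at_linear; exact: mkjet_linear.
by apply: smooth_at_row_mx; apply: smooth_at_linear; [exact: l2|exact: l3].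
Qed.

Lemma constr_map_derive x v : smooth_at (dae_F A) (jet0 (mkjet x)) ->
  [/\ lsubmx ('D_v Phi x) = 'D_(mkjet v) D (mkjet x),
      lsubmx (rsubmx ('D_v Phi x)) = lsubmx v.2 *m Ld
    & rsubmx (rsubmx ('D_v Phi x)) = rsubmx v.2 *m Lr].
Proof.
move=> sF; have dP := smooth_at_differentiable (smooth_at_constr_map sF).
have dr : differentiable (fun y => rsubmx (Phi y)) x.
  by apply: (differentiable_comp dP); exact: differentiable_rsubmx.
have dD := smooth_at_differentiable (smooth_at_deriv_array sF).
have [dm mE] := is_diff_linear x _ mkjet_linear.
have ll p q : linear (lsubmx : 'rV[R]_(p + q) -> 'rV[R]_p).
  by move=> c u w; rewrite linearP.
have lr p q : linear (rsubmx : 'rV[R]_(p + q) -> 'rV[R]_q).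
  by move=> c u w; rewrite linearP.
split.
- rewrite -(derive_linear _ _ (ll _ _) dP).
  have -> : (fun y => lsubmx (Phi y)) = (fun y => D (mkjet y)).
    by apply/funext => y; rewrite row_mxKl.
  by apply: etrans (derive_comp v dm dD) _; rewrite (mE v).
- rewrite -(derive_linear _ _ (lr _ _) dP) -(derive_linear _ _ (ll _ _) dr).
  have -> : (fun y => lsubmx (rsubmx (Phi y))) = (fun x => lsubmx x.2 *m Ld).
    by apply/funext => y; rewrite row_mxKr row_mxKl.
  by have [_ ->] := is_diff_linear x _ l2.
- rewrite -(derive_linear _ _ (lr _ _) dP) -(derive_linear _ _ (lr _ _) dr).
  have -> : (fun y => rsubmx (rsubmx (Phi y))) = (fun x => rsubmx x.2 *m Lr).
    by apply/funext => y; rewrite row_mxKr row_mxKr.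
  by have [_ ->] := is_diff_linear x _ l3.
Qed.

Let q0 := qjet x0.
Let w0 := wjet x0.

(** A kernel vector has z in the image of T_A, and z Ld = 0 forces z = 0; then eta
    is in the kernel of the eta-Jacobian, where eta Lr determines it. *)
Lemma constr_map_injective v : 'D_(0, v) Phi (q0, w0) = 0 -> v = 0.
Proof.
have sF : smooth_at (dae_F A) (jet0 (mkjet (q0, w0))) by rewrite mkjetK.
move=> dv; have := constr_map_derive (0, v) sF.
rewrite dv !linear0 mkjetK /= => -[h1 h2 h3].
have [c cE] := tangent_dz dE sF0 reg0 (esym h1).
have c0 : c = 0 by rewrite -[c]mulmx1 -TALd mulmxA -cE -h2.
have z0 : lsubmx v = 0 by rewrite cE c0 mul0mx.
have e0 : rsubmx v = 0.
  apply: (Lr_inj _ (esym h3)).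
  apply: etrans (array_detaE (rsubmx v) sF0) _.
  apply: etrans _ (esym h1); congr (derive _ _ _).
  by rewrite /mkjet /= z0.
by rewrite -[v]hsubmxK z0 e0 row_mx0.
Qed.

Section Inverse.
Variable f : Q * 'rV[R]_(r + (d + b)) -> 'rV[R]_(n + r).
Let y0 := Phi (q0, w0).
Hypothesis sf : smooth_at f (q0, y0).
Hypothesis f0 : f (q0, y0) = w0.
Hypothesis F1 : \forall x \near (q0, w0), f (x.1, Phi x) = x.2.
Hypothesis F2 : \forall y \near (q0, y0), Phi (y.1, f y) = y.2.

(* Values of [constr_map] on the zero set of the array. *)
Let yv (z : 'rV[R]_d) (rho : 'rV[R]_b) : 'rV[R]_(r + (d + b)) :=
  row_mx 0 (row_mx z rho).
Let z0 := jz x0 *m Ld.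
Let rho0 := mxvec (jeta x0) *m Lr.

Let y0E : y0 = yv z0 rho0.
Proof.
rewrite /y0 /constr_map mkjetK; have [_ ->] := Mx0.
by rewrite /w0 /wjet row_mxKl row_mxKr.
Qed.

(** Chain rule applied to Phi (y.1, f y) = y.2. *)
Lemma derive_inverse q y Y : smooth_at f (q, y) ->
  (\forall y' \near (q, y), Phi (y'.1, f y') = y'.2) ->
  smooth_at (dae_F A) (jet0 (mkjet (q, f (q, y)))) ->
  'D_(0, 'D_(0, Y) f (q, y)) Phi (q, f (q, y)) = Y.
Proof.
move=> sfy inv sF; have dP := smooth_at_differentiable (smooth_at_constr_map sF).
have df := smooth_at_differentiable sfy.
have lfst : linear (fst : Q * 'rV[R]_(r + (d + b)) -> Q) by [].
have lsnd : linear (snd : Q * 'rV[R]_(r + (d + b)) -> _) by [].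
have [d1 E1] := is_diff_linear (q, y) _ lfst.
have [d2 E2] := is_diff_linear (q, y) _ lsnd.
have dh := differentiable_pair d1 df.
have E := derive_comp (0, Y) dh dP.
have Eh := derive_pair (0, Y) d1 df.
rewrite (E1 (0, Y)) in Eh; rewrite Eh in E.
apply: etrans (esym E) _; apply: etrans (near_eq_derive _ inv) _.
exact: (E2 (0, Y)).
Qed.

Lemma inverse_tangent q y Y (Z : 'M[R]_(r, a)) (B : 'M[R]_(n, d)) : smooth_at f (q, y) ->
  (\forall y' \near (q, y), Phi (y'.1, f y') = y'.2) ->
  smooth_at (dae_F A) (jet0 (mkjet (q, f (q, y)))) ->
  regular_point A (mkjet (q, f (q, y))) Z B -> lsubmx Y = 0 ->
  (exists c, lsubmx ('D_(0, Y) f (q, y)) = c *m B^T) /\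
  lsubmx ('D_(0, Y) f (q, y)) *m Ld = lsubmx (rsubmx Y).
Proof.
move=> sfy inv sF reg Y0; have := derive_inverse Y sfy inv sF.
set w := derive f _ _ => E.
have := constr_map_derive (0, w) sF; rewrite E Y0 => -[h1 h2 _].
split; last exact: (esym h2).
exact: (tangent_dz dE sF reg (esym h1)).
Qed.

(* An open condition that makes the points of the zero set near x0 regular, with
   Ld still a coordinate system on the image of T_A. *)
Let adm (x : jet) : Prop := [/\ dom_z A (jz x), dom_dz A (jdz x), dom_u A (ju x) &
  M x -> regular_point A x (ZA x) (TA x) /\ (TA x)^T *m Ld \in unitmx].

Let adm_near : \forall x \near x0, adm x.
Proof.
have [[/= t0 z0' p0 u0] _] := Mx0; have [oz odz ou _] := sA.
have n1 : \forall x \near x0, dom_z A (jz x).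
  apply: (continuous_near (f := fun x : jet => jz x)); last exact: open_nbhs_nbhs.
  by apply: smooth_at_linear.
have n2 : \forall x \near x0, dom_dz A (jdz x).
  apply: (continuous_near (f := fun x : jet => jdz x)); last exact: open_nbhs_nbhs.
  by apply: smooth_at_linear => c u v; rewrite /jdz /jeta /= linearP.
have n3 : \forall x \near x0, dom_u A (ju x).
  apply: (continuous_near (f := fun x : jet => ju x)); last exact: open_nbhs_nbhs.
  by apply: smooth_at_linear => c u v; rewrite /ju /jU /= linearP.
have n4 : \forall x \near x0, (TA x)^T *m Ld \in unitmx.
  apply: (near_unitmx (A := fun x => (TA x)^T *m Ld)); first by rewrite TALd unitmx1.
  apply: smooth_at_mulmx; last exact: smooth_at_cst.
  by apply: (smooth_at_linear_comp _ _ sTA) => c u v; rewrite linearP.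
apply: filterS3 (filterI n1 n2) (filterI n3 n4) regH => x [h1 h2] [h3 h4] h5.
by split => // /h5.
Qed.

(** Moving rho with q and z fixed moves the point inside the zero set, so its
    z-component moves along the image of T_A while z Ld stays fixed; hence it does
    not move at all.  The points have t in the time interval because the rank
    conditions are only available there. *)
Lemma constraint_independent :
  \forall v \near ((q0, z0), rho0), v.1.1.1 \in `[0, T] ->
    lsubmx (f (v.1.1, yv v.1.2 v.2)) = lsubmx (f (v.1.1, yv v.1.2 rho0)).
Proof.
pose V := ((Q * 'rV[R]_d) * 'rV[R]_b)%type.
pose Yv (v : V) : Q * 'rV[R]_(r + (d + b)) := (v.1.1, yv v.1.2 v.2).
have lYv : linear Yv.
  move=> c u v; rewrite /Yv /=.
  have -> : yv (c *: u.1.2 + v.1.2) (c *: u.2 + v.2) = c *: yv u.1.2 u.2 + yv v.1.2 v.2.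
    by rewrite /yv !scale_row_mx !add_row_mx scaler0 addr0.
  by [].
pose v0 : V := ((q0, z0), rho0).
have Yv0 : Yv v0 = (q0, y0) by rewrite y0E.
have sYv v : smooth_at Yv v by exact: smooth_at_linear.
pose X (v : V) : jet := mkjet (v.1.1, f (Yv v)).
have X0 : X v0 = x0 by rewrite /X Yv0 f0 mkjetK.
have sX : smooth_at X v0.
  apply: (smooth_at_linear_comp (f := fun v : V => (v.1.1, f (Yv v)))) => //; first exact:
      mkjet_linear.
  apply: smooth_at_pair; first exact: smooth_at_linear.
  by apply: (smooth_at_comp (g := f)); rewrite ?Yv0.
have n1 : \forall v \near v0, adm (X v).
  by apply: (continuous_near sX); rewrite X0; exact: adm_near.
have n2 : \forall v \near v0, smooth_at f (Yv v).
  by apply: (continuous_near (sYv v0)); rewrite Yv0; exact: smooth_at_near.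
have n3 : \forall v \near v0, \forall y' \near Yv v, Phi (y'.1, f y') = y'.2.
  apply: (continuous_near (P := fun y => \forall y' \near y, Phi (y'.1, f y') = y'.2) (sYv v0)).
  by rewrite Yv0; exact: near_join F2.
have : nbhs v0 [set v | [/\ adm (X v), smooth_at f (Yv v) & \forall y' \near Yv v, Phi (y'.1, f
    y') = y'.2]].
  by apply: filterS3 n1 n2 n3 => v h1 h2 h3; split.
move=> /nbhs_ballP[e /= e0 be].
apply/nbhs_ballP; exists e => // -[[q z] rho] [[bq bz] brho] /= tT.
apply/eqP; rewrite -subr_eq0 -normr_le0.
pose g rho := lsubmx (f (q, yv z rho)).
have -> : lsubmx (f (q, yv z rho)) - lsubmx (f (q, yv z rho0)) = g (rho0 + (rho - rho0)) - g
    rho0.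
  by rewrite [rho0 + _]addrC subrK.
apply: mean_value_ineq => s s01.
set rs := rho0 + s *: (rho - rho0).
have /be [[hz hp hu hM] sfy inv] : ball v0 e ((q, z), rs).
  split => //=; move: brho; rewrite -!ball_normE /= => brho.
  apply: le_lt_trans brho; rewrite /rs opprD addrA subrr sub0r normrN normrZ distrC.
  have /andP[s0 s1] := s01.
  by rewrite ger0_norm // ler_piMl.
set x := X (q, z, rs) in hz hp hu hM.
have dom : dae_dom T A (jet0 x) by [].
have sF := dom_smooth dom.
have Dx : D x = 0.
  have /(congr1 lsubmx) := nbhs_singleton inv.
  by rewrite /constr_map row_mxKl /= /yv row_mxKl.
have [reg uni] := hM (conj dom Dx).
have df := smooth_at_differentiable sfy.
have sg : smooth_at g rs.
  apply: (smooth_at_linear_comp (f := fun rho => f (q, yv z rho))); first exact: lsubmx_linear.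
  apply: (smooth_at_comp (g := f) (f := fun rho => (q, yv z rho))) => //.
  apply: (smooth_at_comp (g := Yv) (f := fun rho => ((q, z), rho))) => //.
  by apply: smooth_at_pair; [exact: smooth_at_cst|exact: smooth_at_id].
split; first exact: smooth_at_differentiable.
pose L (rho : 'rV[R]_b) : Q * 'rV[R]_(r + (d + b)) := (0, yv 0 rho).
have lL : linear L.
  move=> c u v; rewrite /L; have -> : yv 0 (c *: u + v) = c *: yv 0 u + yv 0 v.
    by rewrite /yv !scale_row_mx !add_row_mx !scaler0 !addr0.
  by rewrite -[RHS]/(c *: 0 + 0, _) scaler0 addr0.
have cE rho' : (q, yv z rho') = (q, yv z 0) + L rho'.
  rewrite /L -[RHS]/(_, _) /= addr0; congr (_, _).
  by rewrite /yv !add_row_mx !addr0 add0r.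
have gE : g = (fun rho' => lsubmx (f ((q, yv z 0) + L rho'))).
  by apply/funext => rho'; rewrite /g cE.
have df' : differentiable f ((q, yv z 0) + L rs) by rewrite -cE.
set dlt := rho - rho0.
have dgE : 'D_dlt g rs = lsubmx ('D_(L dlt) f (q, yv z rs)).
  have E1 := derive_affine dlt _ lL df'.
  rewrite gE (cE rs) -E1.
  apply: (derive_linear _ _ (@lsubmx_linear _ _ _)).
  apply: (differentiable_comp (f := fun rho' => (q, yv z 0) + L rho')) => //.
  apply: differentiableD; first exact: differentiable_cst.
  by apply (is_diff_linear _ _ lL).1.
have Y0 : lsubmx (yv 0 dlt) = 0 by rewrite /yv row_mxKl.
have [[c cc] zl] := inverse_tangent sfy inv sF reg Y0.
rewrite dgE /L; move: cc zl; set dz := lsubmx _ => cc zl.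
rewrite /yv row_mxKr row_mxKl in zl.
have : c *m ((TA x)^T *m Ld) = 0 by rewrite mulmxA -cc.
move=> /(congr1 (mulmx^~ (invmx ((TA x)^T *m Ld)))) /=.
rewrite mulmxK // mul0mx => c0.
by rewrite cc c0 mul0mx normr0.
Qed.

(** The relation z = g(t, U, z Ld), with the free coordinate frozen at rho0. *)
Definition constr_fun (x : Q * 'rV[R]_d) : 'rV[R]_n := lsubmx (f (x.1, yv x.2 rho0)).

Lemma smooth_at_constr_fun : smooth_at constr_fun (q0, z0).
Proof.
apply: (smooth_at_linear_comp (f := fun x : Q * 'rV[R]_d => f (x.1, yv x.2 rho0))).
  exact: lsubmx_linear.
apply: (smooth_at_comp (g := f) (f := fun x : Q * 'rV[R]_d => (x.1, yv x.2 rho0))).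
  by rewrite /= -y0E.
apply: smooth_at_pair; first exact: smooth_at_linear.
apply: smooth_at_row_mx; first exact: smooth_at_cst.
apply: smooth_at_row_mx; last exact: smooth_at_cst.
exact: smooth_at_linear.
Qed.

(** The derivative of the relation takes values in the image of T_A, on which
    dF/dz' is injective. *)
Lemma constr_fun_dynamic p : p = 'D_(0, p *m Ld) constr_fun (q0, z0) ->
  'D_(0, 0, p, 0) (dae_F A) (jet0 x0) = 0 -> p = 0.
Proof.
pose L (x : Q * 'rV[R]_d) : Q * 'rV[R]_(r + (d + b)) := (x.1, yv x.2 0).
have lL : linear L.
  move=> c u v; rewrite /L /=; have -> : yv (c *: u.2 + v.2) 0 = c *: yv u.2 0 + yv v.2 0.
    by rewrite /yv !scale_row_mx !add_row_mx !scaler0 !addr0.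
  by [].
have cE x : (x.1, yv x.2 rho0) = (0, yv 0 rho0) + L x.
  rewrite /L -[RHS]/(_, _) /= add0r; congr (_, _).
  by rewrite /yv !add_row_mx !addr0 !add0r.
have sf' : smooth_at f ((0, yv 0 rho0) + L (q0, z0)) by rewrite -cE /= -y0E.
have df' := smooth_at_differentiable sf'.
have E v : 'D_v constr_fun (q0, z0) = lsubmx ('D_(L v) f (q0, y0)).
  have -> : constr_fun = fun x => lsubmx (f ((0, yv 0 rho0) + L x)).
    by apply/funext => x; rewrite /constr_fun cE.
  rewrite y0E [in RHS](cE (q0, z0)) -(derive_affine v _ lL df').
  apply: (derive_linear _ _ (@lsubmx_linear _ _ _)).
  have sL : smooth_at (fun x => (0, yv 0 rho0) + L x) (q0, z0).
    by apply: smooth_at_add; [exact: smooth_at_cst|exact: smooth_at_linear].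
  exact: (smooth_at_differentiable (smooth_at_comp (g := f) (f := fun x => (0, yv 0 rho0) + L
      x) sf' sL)).
move=> pE Fp; rewrite E /L /= in pE.
have sF : smooth_at (dae_F A) (jet0 (mkjet (q0, f (q0, y0)))) by rewrite f0 mkjetK.
have reg : regular_point A (mkjet (q0, f (q0, y0))) (ZA x0) (TA x0).
  by rewrite f0 mkjetK.
have Y0 : lsubmx (yv (p *m Ld) 0) = 0 by rewrite /yv row_mxKl.
have [[c cc] _] := inverse_tangent sf F2 sF reg Y0.
have pc : p = c *m (TA x0)^T by exact: etrans pE cc.
have c0 : c = 0.
  apply: (dynamic_injective reg0); rewrite -pc.
  exact: etrans (F_ddzE p sF0) Fp.
by rewrite pc c0 mul0mx.
Qed.

(** Along the curve, z is a smooth function of (q, D, z Ld, eta Lr).  Replacing D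
    by 0 changes no Taylor coefficient up to order k because D vanishes to this
    order; replacing eta Lr by rho0 changes none because the two functions agree
    for all times in the time interval. *)
Lemma constr_fun_curve : \forall x \near x0,
  forall (t : R) (zeta : R -> 'rV[R]_n) (ups : R -> 'rV[R]_m) k, t \in `[0, T] -> smooth_at
      zeta 0 -> smooth_at ups 0 ->
    jet_lift mu t zeta ups 0 = x ->
    agree k (fun s => D (jet_lift mu t zeta ups s)) (cst 0) 0 ->
    agree k zeta (fun s => constr_fun (qjet (jet_lift mu t zeta ups s), zeta s *m Ld)) 0.
Proof.
pose V := ((Q * 'rV[R]_d) * 'rV[R]_b)%type.
pose Vx (x : jet) : V := ((qjet x, jz x *m Ld), mxvec (jeta x) *m Lr).
have lVx : linear Vx.
  move=> c u v.
  have e1 : mxvec (jeta (c *: u + v)) *m Lr = c *: (mxvec (jeta u) *m Lr) + mxvec (jeta v) *m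
      Lr.
    by rewrite /jeta /= linearP mulmxDl scalemxAl.
  have e2 : jz (c *: u + v) *m Ld = c *: (jz u *m Ld) + jz v *m Ld.
    by rewrite /jz /= mulmxDl scalemxAl.
  by rewrite /Vx e1 e2.
pose Wx (x : jet) : Q * 'rV[R]_(n + r) := (qjet x, wjet x).
have lWx : linear Wx by move=> c u v; rewrite /Wx wjet_linear.
pose Yv (v : V) : Q * 'rV[R]_(r + (d + b)) := (v.1.1, yv v.1.2 v.2).
have lYv : linear Yv.
  move=> c u v; rewrite /Yv /=.
  have -> : yv (c *: u.1.2 + v.1.2) (c *: u.2 + v.2) = c *: yv u.1.2 u.2 + yv v.1.2 v.2.
    by rewrite /yv !scale_row_mx !add_row_mx scaler0 addr0.
  by [].
pose Y0 (v : V) : Q * 'rV[R]_(r + (d + b)) := (v.1.1, yv v.1.2 rho0).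
have sVx x : smooth_at Vx x by exact: smooth_at_linear.
have sWx x : smooth_at Wx x by exact: smooth_at_linear.
have sYv v : smooth_at Yv v by exact: smooth_at_linear.
have sY0 v : smooth_at Y0 v.
  apply: smooth_at_pair; first exact: smooth_at_linear.
  apply: smooth_at_row_mx; first exact: smooth_at_cst.
  by apply: smooth_at_row_mx; [exact: smooth_at_linear|exact: smooth_at_cst].
have sYx x : smooth_at (fun x => Yv (Vx x)) x by exact: (smooth_at_comp (sYv _) (sVx x)).
have sY0x x : smooth_at (fun x => Y0 (Vx x)) x by exact: (smooth_at_comp (sY0 _) (sVx x)).
have K0 : \forall x \near x0, smooth_at (dae_F A) (jet0 x).
  have sJ : smooth_at (@jet0 R n m mu) x0 by apply: smooth_at_linear; exact: jet0_linear.
  exact: (smooth_at_continuous sJ (smooth_at_near sF0)).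
have K1 : \forall x \near x0, \forall x' \near x, f (qjet x', Phi (Wx x')) = wjet x'.
  by apply: near_join; exact: (continuous_near (sWx x0) F1).
have K2 : \forall x \near x0, smooth_at f (Yv (Vx x)).
  by apply: (continuous_near (P := fun y => smooth_at f y) (sYx x0)); rewrite /Yv /= -/z0
      -/rho0 -y0E; exact: smooth_at_near.
have K3 : \forall x \near x0, smooth_at f (Y0 (Vx x)).
  by apply: (continuous_near (P := fun y => smooth_at f y) (sY0x x0)); rewrite /Y0 /= -/z0
      -y0E; exact: smooth_at_near.
have K4 : \forall x \near x0, \forall v \near Vx x, v.1.1.1 \in `[0, T] ->
    lsubmx (f (Yv v)) = lsubmx (f (Y0 v)).
  apply: (continuous_near (P := fun w => \forall v \near w, v.1.1.1 \in `[0, T] ->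
    lsubmx (f (Yv v)) = lsubmx (f (Y0 v))) (sVx x0)).
  exact: (near_join constraint_independent).
apply: filterS3 (filterI K0 K1) (filterI K2 K3) K4 => x [k0 k1] [k2 k3] k4.
move=> t zeta ups [//|k] tT sz su xE ag.
pose X := jet_lift mu t zeta ups.
have sX : smooth_at X 0 by exact: smooth_at_jet_lift.
have X0 : X 0 = x by [].
have sD : smooth_at (fun s => D (X s)) 0.
  by apply: (smooth_at_comp (g := D)) => //; rewrite X0; exact: smooth_at_deriv_array.
have DX0 : D (X 0) = 0 by have := ag 0 isT.
pose L (y : 'rV[R]_r) : Q * 'rV[R]_(r + (d + b)) := (0, row_mx y 0).
have lL : linear L.
  move=> c u v; rewrite /L; have -> : row_mx (c *: u + v) 0 = c *: row_mx u 0 + row_mx v 0 :>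
      'rV[R]_(r + (d + b)).
    by rewrite !scale_row_mx !add_row_mx !scaler0 !addr0.
  by rewrite -[RHS]/(c *: 0 + 0, _) scaler0 addr0.
pose c2 s := Yv (Vx (X s)).
have sc2 : smooth_at c2 0 by exact: (smooth_at_comp (sYx _) sX).
have c1E s : (qjet (X s), Phi (Wx (X s))) = c2 s + L (D (X s)).
  rewrite /c2 /L -[RHS]/(_ + 0, _) addr0; congr (_, _).
  rewrite /constr_map /Yv /yv /= /Wx /= mkjetK /wjet row_mxKl row_mxKr.
  by rewrite add_row_mx add0r addr0.
pose c1 s := c2 s + L (D (X s)).
have sLD : smooth_at (fun s => L (D (X s))) 0 by exact: smooth_at_linear_comp.
have sc1 : smooth_at c1 0 by exact: smooth_at_add.
have L0 : L 0 = 0 by rewrite /L row_mx0.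
have ac : agree k.+1 c1 c2 0.
  have H : agree k.+1 (fun s => L (D (X s))) (fun s => L (cst 0 s)) 0.
    by apply: agree_linear => //; exact: smooth_at_cst.
  have := agree_add sc2 sLD sc2 (smooth_at_cst (L 0) 0) (@agree_refl _ _ k.+1 c2 0) H.
  by have -> : (fun x : R => c2 x + L (cst 0 x)) = c2 by apply/funext => s; rewrite L0 addr0.
have c10 : c1 0 = c2 0 by rewrite /c1 DX0 L0 addr0.
have sf2 : smooth_at f (c2 0) by rewrite /c2 X0.
have sG : smooth_at (fun y => lsubmx (f y)) (c1 0).
  by rewrite c10; apply: smooth_at_linear_comp => //; exact: lsubmx_linear.
have s1 : agree k.+1 zeta (fun s => lsubmx (f (c1 s))) 0.
  apply: near_agree; have : \forall s \near 0, f (qjet (X s), Phi (Wx (X s))) = wjet (X s).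
    by apply: (continuous_near (P := fun x' => f (qjet x', Phi (Wx x')) = wjet x') sX); rewrite
        X0.
  by apply: filterS => s; rewrite c1E /c1 => ->; rewrite /wjet row_mxKl.
apply: agree_trans s1 _.
apply: agree_trans (agree_comp _ sc1 sc2 sG c10 ac) _.
have sY : smooth_at (fun s => Y0 (Vx (X s))) 0 by exact: (smooth_at_comp (sY0x _) sX).
have sh1 : smooth_at (fun s => lsubmx (f (c2 s))) 0.
  apply: (smooth_at_linear_comp (f := fun s => f (c2 s))); first exact: lsubmx_linear.
  exact: (smooth_at_comp sf2 sc2).
have sh2 : smooth_at (fun s => lsubmx (f (Y0 (Vx (X s))))) 0.
  apply: (smooth_at_linear_comp (f := fun s => f (Y0 (Vx (X s))))); first exact: lsubmx_linear.
  by apply: (smooth_at_comp (g := f)) sY; rewrite X0.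
suff H : \forall s \near 0, [set s | 0 < t + s < T] s -> lsubmx (f (c2 s)) = lsubmx (f (Y0 (Vx
    (X s)))).
  exact: (vanish_agree (@open_itv_shift R T t) (closure_itv T_gt0 tT) sh1 sh2 H).
have : \forall s \near 0, (Vx (X s)).1.1.1 \in `[0, T] ->
    lsubmx (f (Yv (Vx (X s)))) = lsubmx (f (Y0 (Vx (X s)))).
  have sVX : smooth_at (fun s => Vx (X s)) 0 by exact: (smooth_at_comp (sVx _) sX).
  by apply: (continuous_near (P := fun v => v.1.1.1 \in `[0, T] -> lsubmx (f (Yv v)) = lsubmx
      (f (Y0 v))) sVX); rewrite X0.
apply: filterS => s h /= /andP[h0 h1]; apply: h.
by rewrite /= in_itv /= !ltW.
Qed.

End Inverse.

(** The algebraic part of the system as a relation z = g(t, u, ..., u^(mu), z B)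
    satisfied by all curves near x0; the second clause says that its derivative
    and F = 0 determine z' to first order. *)
Theorem constraint_function :
  exists (B : 'M[R]_(n, d)) (g : Q * 'rV[R]_d -> 'rV[R]_n),
  [/\ smooth_at g (qjet x0, jz x0 *m B),
      forall p, p = 'D_(0, p *m B) g (qjet x0, jz x0 *m B) ->
        'D_(0, 0, p, 0) (dae_F A) (jet0 x0) = 0 -> p = 0
    & \forall x \near x0,
        forall (t : R) (zeta : R -> 'rV[R]_n) (ups : R -> 'rV[R]_m) k, t \in `[0, T] ->
            smooth_at zeta 0 -> smooth_at ups 0 ->
          jet_lift mu t zeta ups 0 = x ->
          agree k (fun s => D (jet_lift mu t zeta ups s)) (cst 0) 0 ->
          agree k zeta (fun s => g (qjet (jet_lift mu t zeta ups s), zeta s *m B)) 0].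
Proof.
have sP : smooth_at Phi (q0, w0) by apply: smooth_at_constr_map; rewrite mkjetK.
have [f [sf f0 F1 /(_ dims) F2]] := inverse_function _ sP constr_map_injective.
exists Ld, (constr_fun f); split.
- exact: smooth_at_constr_fun.
- exact: constr_fun_dynamic.
- exact: constr_fun_curve.
Qed.

End Constraint.

(** * Order of vanishing of the derivative array *)
Section AgreeArray.
Context {R : realType}.

Lemma agree_rows p q k (c c' : 'I_p -> R -> 'rV[R]_q) (s : R) :
  (forall i, smooth_at (c i) s) -> (forall i, smooth_at (c' i) s) ->
  (forall i, agree k (c i) (c' i) s) ->
  agree k (fun s => \matrix_i c i s) (fun s => \matrix_i c' i s) s.
Proof.
move=> sc sc' cc'.
have E (b : 'I_p -> R -> 'rV[R]_q) :
    (fun s => \matrix_i b i s) = fun s => \sum_i (delta_mx i 0 : 'cV[R]_p) *m b i s.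
  apply/funext => x; apply/matrixP => i j; rewrite mxE summxE (bigD1 i) //= big1.
    by rewrite addr0 mxE big_ord1 mxE !eqxx mul1r.
  by move=> i' ni; rewrite mxE big_ord1 mxE eq_sym (negbTE ni) mul0r.
have ll i : linear (fun x : 'rV[R]_q => (delta_mx i 0 : 'cV[R]_p) *m x).
  by move=> a x y; rewrite linearP.
rewrite !E; apply: agree_sum => i.
- by apply: (smooth_at_linear_comp _ (ll i) (sc i)).
- by apply: (smooth_at_linear_comp _ (ll i) (sc' i)).
- by apply: (agree_linear _ (ll i) (sc i) (sc' i) (cc' i)).
Qed.

Lemma agree_pair (V W : normedModType R) k (f f' : R -> V) (g g' : R -> W) (s : R) :
  findim V -> findim W ->
  smooth_at f s -> smooth_at f' s -> smooth_at g s -> smooth_at g' s ->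
  agree k f f' s -> agree k g g' s ->
  agree k (fun s => (f s, g s)) (fun s => (f' s, g' s)) s.
Proof.
move=> fV fW sf sf' sg sg' af ag.
have E (a : R -> V) (b : R -> W) : (fun s => (a s, b s)) = (fun s => (a s, 0) + (0, b s)).
  by apply/funext => x; rewrite -[RHS]/(_ + 0, 0 + _) addr0 add0r.
have l1 : linear (fun x : V => (x, 0 : W)).
  by move=> c u v; rewrite -[RHS]/(_, c *: 0 + 0) scaler0 addr0.
have l2 : linear (fun x : W => (0 : V, x)).
  by move=> c u v; rewrite -[RHS]/(c *: 0 + 0, _) scaler0 addr0.
rewrite (E f g) (E f' g'); apply: agree_add.
- exact: (smooth_at_linear_comp _ l1 sf).
- exact: (smooth_at_linear_comp _ l2 sg).
- exact: (smooth_at_linear_comp _ l1 sf').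
- exact: (smooth_at_linear_comp _ l2 sg').
- exact: (agree_linear _ l1 sf sf' af).
- exact: (agree_linear _ l2 sg sg' ag).
Qed.

Lemma agree_row_mx p q k (f f' : R -> 'rV[R]_p) (g g' : R -> 'rV[R]_q) (s : R) :
  smooth_at f s -> smooth_at f' s -> smooth_at g s -> smooth_at g' s ->
  agree k f f' s -> agree k g g' s ->
  agree k (fun s => row_mx (f s) (g s)) (fun s => row_mx (f' s) (g' s)) s.
Proof.
move=> sf sf' sg sg' af ag.
have E (a : R -> 'rV[R]_p) (b : R -> 'rV[R]_q) :
    (fun s => row_mx (a s) (b s)) = (fun s => row_mx (a s) 0 + row_mx 0 (b s)).
  by apply/funext => x; rewrite add_row_mx addr0 add0r.
have l1 : linear (fun x : 'rV[R]_p => row_mx x (0 : 'rV[R]_q)).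
  by move=> c u v; rewrite scale_row_mx add_row_mx scaler0 addr0.
have l2 : linear (fun x : 'rV[R]_q => row_mx (0 : 'rV[R]_p) x).
  by move=> c u v; rewrite scale_row_mx add_row_mx scaler0 addr0.
rewrite !E; apply: agree_add.
- exact: (smooth_at_linear_comp _ l1 sf).
- exact: (smooth_at_linear_comp _ l2 sg).
- exact: (smooth_at_linear_comp _ l1 sf').
- exact: (smooth_at_linear_comp _ l2 sg').
- exact: (agree_linear _ l1 sf sf' af).
- exact: (agree_linear _ l2 sg sg' ag).
Qed.

Lemma smooth_at_shift (t s : R) : smooth_at (fun s : R => t + s) s.
Proof. by apply: smooth_at_add; [exact: smooth_at_cst|exact: smooth_at_id]. Qed.

Lemma derive1_shift (t s : R) : derive1 (fun s : R => t + s) s = 1.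
Proof.
rewrite derive1E deriveD; [|exact: derivable_cst|exact: derivable_id].
by rewrite derive_cst add0r derive_id.
Qed.

Variables (n m l : nat) (A : dae R n m) (t0 : R).
Variables (zeta : R -> 'rV[R]_n) (ups : R -> 'rV[R]_m).
Hypotheses (sz : smooth_at zeta 0) (su : smooth_at ups 0).
Hypothesis sF : smooth_at (dae_F A) (jet0 (jet_lift l t0 zeta ups 0)).

(** Block i of the array is the i-th derivative of the residual, which vanishes
    to i orders less than the residual. *)
Lemma agree_deriv_array k : agree (l + k) (residual A t0 zeta ups) (cst 0) 0 ->
  agree k (fun s => deriv_array A (jet_lift l t0 zeta ups s)) (cst 0) 0.
Proof.
move=> ag; have sF' := sF; rewrite jet0_lift in sF'.
have sr : smooth_at (residual A t0 zeta ups) 0 by exact: smooth_at_residual.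
have sc : smooth_at (fun s => (t0 + s, zeta s, derive1 zeta s, ups s)) 0.
  apply: smooth_at_pair => //; apply: smooth_at_pair; last exact: smooth_at_derive1.
  by apply: smooth_at_pair => //; exact: smooth_at_shift.
have n1 : \forall s \near 0, smooth_at (dae_F A) (t0 + s, zeta s, derive1 zeta s, ups s).
  exact: (smooth_at_continuous sc (smooth_at_near sF')).
have n2 := smooth_at_near sz; have n3 := smooth_at_near su.
have H : \forall s \near 0, deriv_array A (jet_lift l t0 zeta ups s) =
    mxvec (\matrix_(k < l.+1) derive1n k (residual A t0 zeta ups) s).
  by apply: filterS3 n1 n2 n3 => s h1 h2 h3; exact: deriv_array_lift.
apply: agree_trans (near_agree H) _.
have -> : cst 0 = fun s : R => mxvec (\matrix_(k < l.+1) (cst 0 : R -> 'rV[R]_n) s).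
  apply/funext => s; have -> : \matrix_(k < l.+1) cst 0 s = 0 :> 'M[R]_(l.+1, n).
    by apply/matrixP => i j; rewrite !mxE.
  by rewrite linear0.
have sri i : smooth_at (derive1n i (residual A t0 zeta ups)) 0 by exact: smooth_at_derive1n.
apply: agree_linear; first by move=> c u v; rewrite linearP.
- by apply: smooth_at_rows => i; exact: sri.
- by apply: smooth_at_rows => i; exact: smooth_at_cst.
apply: agree_rows => i; [exact: sri|exact: smooth_at_cst|].
rewrite -(derive1n_cst0 _ i); apply: agree_derive1n.
by apply: agreeW ag; rewrite leq_add2r -ltnS.
Qed.

End AgreeArray.

(** * The explicit differential equation of one system *)
Section ExplicitODE.
Context {R : realType} {n m mu : nat}.
Variables (T : R) (A : dae R n m).
Hypotheses (T_gt0 : 0 < T) (sA : smooth_dae T A).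
Notation jet := (@jet R n m mu).
Notation Umx := 'M[R]_(mu.+1, m).
Notation P := (R * 'rV[R]_n * Umx * Umx)%type.

(** The arguments (t, z, (u, ..., u^(mu)), (u', ..., u^(mu+1))) of the explicit
    equation along a curve; the overlap of the two blocks lets U' be the plain
    derivative of U. *)
Definition ode_curve (t : R) (zeta : R -> 'rV[R]_n) (ups : R -> 'rV[R]_m) (s : R) : P :=
  (t + s, zeta s, \matrix_(k < mu.+1) derive1n k ups s, \matrix_(k < mu.+1) derive1n k.+1 ups
      s).

Lemma hypothesis_H_regular a d x0 : hypothesis_H T A mu a d -> array_set T A x0 ->
  [/\ d = (n - a)%N, (a <= n)%N &
    exists (ZA : jet -> 'M[R]_(mu.+1 * n, a)) (TA : jet -> 'M[R]_(n, d)),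
      smooth_at TA x0 /\
      \forall x \near x0, array_set T A x -> regular_point A x (ZA x) (TA x)].
Proof.
move=> [dE [an [ZA [TA [ZD [[_ sT _] rk _ loc]]]]]] Mx0; split => //.
exists ZA, TA; split; first exact: smooth_at_on sT Mx0.
have [U nU HU] := loc _ Mx0; apply: filterS nU => x Ux Mx.
have [h1 h2 [h3 _]] := HU x Mx Ux; have [_ rT _] := rk x Mx.
by split.
Qed.

Section Reduced.
Variables (d : nat) (B : 'M[R]_(n, d)) (g : R * Umx * 'rV[R]_d -> 'rV[R]_n).

(* The time derivative of the constraint z = g(t, U, z B) when z' = p. *)
Let gdir (y : P) (p : 'rV[R]_n) : 'rV[R]_n :=
  'D_((1, y.2), p *m B) g ((y.1.1.1, y.1.2), y.1.1.2 *m B).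

(** The equation F = 0 and the differentiated constraint, as a map of z'. *)
Definition reduced_map (x : P * 'rV[R]_n) : 'rV[R]_(n + n) :=
  row_mx (dae_F A (x.1.1.1.1, x.1.1.1.2, x.2, row ord0 x.1.1.2)) (x.2 - gdir x.1 x.2).

Lemma smooth_at_reduced_map (y : P) (p : 'rV[R]_n) :
  smooth_at (dae_F A) (y.1.1.1, y.1.1.2, p, row ord0 y.1.2) ->
  smooth_at g ((y.1.1.1, y.1.2), y.1.1.2 *m B) ->
  smooth_at reduced_map (y, p).
Proof.
move=> sF sg; apply: smooth_at_row_mx.
  apply: (smooth_at_comp (g := dae_F A)
    (f := fun x : P * 'rV[R]_n => (x.1.1.1.1, x.1.1.1.2, x.2, row ord0 x.1.1.2))) => //.
  by apply: smooth_at_linear => c u v; rewrite /= linearP.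
apply: smooth_at_sub; first exact: smooth_at_linear.
apply: (smooth_at_dir (h := fun x : P * 'rV[R]_n => ((x.1.1.1.1, x.1.1.2), x.1.1.1.2 *m B))) =>
    //.
  apply: smooth_at_linear => c u v.
  have -> : (c *: u + v).1.1.1.2 *m B = c *: (u.1.1.1.2 *m B) + v.1.1.1.2 *m B.
    by rewrite /= mulmxDl scalemxAl.
  by [].
apply: smooth_at_pair.
  by apply: smooth_at_pair; [exact: smooth_at_cst|exact: smooth_at_linear].
apply: smooth_at_linear => c u v.
by rewrite /= mulmxDl scalemxAl.
Qed.

(** Along the line of the p the second block is affine, so that its derivative is
    v - dg(0, v B). *)
Lemma reduced_map_injective (y : P) (p v : 'rV[R]_n) :
  smooth_at (dae_F A) (y.1.1.1, y.1.1.2, p, row ord0 y.1.2) ->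
  smooth_at g ((y.1.1.1, y.1.2), y.1.1.2 *m B) ->
  (forall p', p' = 'D_(0, p' *m B) g ((y.1.1.1, y.1.2), y.1.1.2 *m B) ->
    'D_(0, 0, p', 0) (dae_F A) (y.1.1.1, y.1.1.2, p, row ord0 y.1.2) = 0 -> p' = 0) ->
  'D_(0, v) reduced_map (y, p) = 0 -> v = 0.
Proof.
move=> sF sg inj dv; have dP := smooth_at_differentiable (smooth_at_reduced_map sF sg).
have dg := smooth_at_differentiable sg.
pose L (p : 'rV[R]_n) : P * 'rV[R]_n := (0, p).
have lL : linear L.
  by move=> c u w; rewrite /L -[RHS]/(c *: 0 + 0, _) scaler0 addr0.
have cE p' : (y, p') = (y, 0) + L p' by rewrite /L -[RHS]/(_ + 0, 0 + _) addr0 add0r.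
have dP' : differentiable reduced_map ((y, 0) + L p) by rewrite -cE.
pose Psi p' := reduced_map ((y, 0) + L p').
have dPsi0 : 'D_v Psi p = 0.
  by apply: etrans (derive_affine v _ lL dP') _; rewrite -cE.
have dPsi : differentiable Psi p.
  have sL : smooth_at (fun p => (y, 0) + L p) p.
    by apply: smooth_at_add; [exact: smooth_at_cst|exact: smooth_at_linear].
  exact: (differentiable_comp (smooth_at_differentiable sL)).
have E1 := derive_linear v _ (@lsubmx_linear _ n n) dPsi.
have E2 := derive_linear v _ (@rsubmx_linear _ n n) dPsi.
rewrite dPsi0 linear0 in E1; rewrite dPsi0 linear0 in E2.
have F1 : (fun p' => lsubmx (Psi p')) = fun p' => dae_F A (y.1.1.1, y.1.1.2, p', row ord0
    y.1.2).
  by apply/funext => p'; rewrite /Psi -cE /reduced_map row_mxKl.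
have F2 : (fun p' => rsubmx (Psi p')) = fun p' => p' - gdir y p'.
  by apply/funext => p'; rewrite /Psi -cE /reduced_map row_mxKr.
rewrite F1 in E1; rewrite F2 in E2.
apply: inj.
  pose Lp (p' : 'rV[R]_n) : 'rV[R]_n := p' - 'D_(0, p' *m B) g ((y.1.1.1, y.1.2), y.1.1.2 *m B).
  pose c0 := - 'D_((1, y.2), 0) g ((y.1.1.1, y.1.2), y.1.1.2 *m B).
  have lLp : linear Lp.
    move=> c u w; rewrite /Lp.
    have -> : ((0, (c *: u + w) *m B) : R * Umx * 'rV[R]_d) = c *: (0, u *m B) + (0, w *m B).
      rewrite -[RHS]/(c *: 0 + 0, c *: (u *m B) + w *m B) scaler0 addr0.
      by rewrite mulmxDl scalemxAl.
    rewrite !deriveE // linearP scalerBr; set a1 := 'd g _ _; set a2 := 'd g _ _.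
    by rewrite opprD addrACA.
  have FE : (fun p' => p' - gdir y p') = fun p' => c0 + Lp p'.
    apply/funext => p'; rewrite /c0 /Lp /gdir addrCA -opprD; congr (_ - _).
    have E := derive_vD ((1, y.2, 0) : R * Umx * 'rV[R]_d) ((0, p' *m B) : R * Umx * 'rV[R]_d)
        dg.
    apply: etrans _ E.
    by congr (derive g _ _); rewrite -[RHS]/(_ + 0, 0 + _) addr0 add0r.
  have [dLp LE] := is_diff_linear p _ lLp.
  have : 'D_v (fun p' => c0 + Lp p') p = Lp v.
    rewrite deriveD; [|exact: derivable_cst|exact: diff_derivable].
    by rewrite derive_cst add0r LE.
  rewrite -FE E2 /Lp => /esym/eqP; rewrite subr_eq0 => /eqP; exact.
pose LF (p' : 'rV[R]_n) : R * 'rV[R]_n * 'rV[R]_n * 'rV[R]_m := (0, 0, p', 0).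
have lLF : linear LF.
  by move=> c u w; rewrite /LF -[RHS]/(_, _, _, _) /= ?mulr0 ?scaler0 ?addr0.
have cF p' : (y.1.1.1, y.1.1.2, p', row ord0 y.1.2) = (y.1.1.1, y.1.1.2, 0, row ord0 y.1.2) +
    LF p'.
  by rewrite /LF -[RHS]/(_, _, _, _) /= !addr0 add0r.
have dF := smooth_at_differentiable sF; rewrite cF in dF.
have E3 := derive_affine v _ lLF dF.
have FE' : (fun p' => dae_F A (y.1.1.1, y.1.1.2, p', row ord0 y.1.2)) =
    fun p' => dae_F A ((y.1.1.1, y.1.1.2, 0, row ord0 y.1.2) + LF p').
  by apply/funext => p'; rewrite cF.
rewrite FE' E3 in E1; rewrite (cF p); exact: E1.
Qed.

(** Differentiating the constraint costs one order of agreement. *)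
Lemma reduced_map_curve (t : R) zeta ups k : t \in `[0, T] ->
  smooth_at zeta 0 -> smooth_at ups 0 ->
  smooth_at (dae_F A) (jet0 (jet_lift mu t zeta ups 0)) ->
  smooth_at g (qjet (jet_lift mu t zeta ups 0), zeta 0 *m B) ->
  agree k.+1 zeta (fun s => g (qjet (jet_lift mu t zeta ups s), zeta s *m B)) 0 ->
  agree k (residual A t zeta ups) (cst 0) 0 ->
  smooth_at (fun s => reduced_map (ode_curve t zeta ups s, derive1 zeta s)) 0 /\
  agree k (fun s => reduced_map (ode_curve t zeta ups s, derive1 zeta s)) (cst 0) 0.
Proof.
move=> tT sz su sF sg /agreeS[_ ag] ar.
have szd := smooth_at_derive1 sz.
pose c s : R * Umx * 'rV[R]_d := (qjet (jet_lift mu t zeta ups s), zeta s *m B).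
have sU (f : R -> 'rV[R]_m) s : smooth_at f s -> smooth_at (fun s => \matrix_(k < mu.+1)
    derive1n k f s) s.
  by move=> sf; apply: smooth_at_rows => i; exact: smooth_at_derive1n.
have sB s : smooth_at zeta s -> smooth_at (fun s => zeta s *m B) s.
  by move=> h; apply: smooth_at_mulmx => //; exact: smooth_at_cst.
have sc s : smooth_at zeta s -> smooth_at ups s -> smooth_at c s.
  move=> h1 h2; apply: smooth_at_pair; last exact: sB.
  by apply: smooth_at_pair; [exact: smooth_at_shift|exact: sU].
have dc s : smooth_at zeta s -> smooth_at ups s ->
    derive1 c s = ((1, \matrix_(k < mu.+1) derive1n k.+1 ups s), derive1 zeta s *m B).
  move=> h1 h2; have sh := smooth_at_shift t s.
  rewrite derive1_pair; [|exact: (smooth_at_pair sh (sU _ _ h2))|exact: sB].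
  rewrite derive1_pair; [|exact: sh|exact: sU].
  rewrite derive1_shift derive1_rows; last by move=> i; exact: smooth_at_derive1n.
  have lB : linear (fun x : 'rV[R]_n => x *m B) by move=> a x y; rewrite mulmxDl scalemxAl.
  have E : derive1 (fun s => zeta s *m B) s = derive1 zeta s *m B.
    rewrite !derive1E; have dz := smooth_at_differentiable h1.
    exact: (derive_linear (1 : R) _ lB dz).
  by rewrite E.
have near_c : \forall s \near 0, [/\ smooth_at zeta s, smooth_at ups s & smooth_at g (c s)].
  have n1 := smooth_at_near sz; have n2 := smooth_at_near su.
  have n3 : \forall s \near 0, smooth_at g (c s).
    by have := smooth_at_near_comp (sc 0 sz su) sg; apply: filterS => s [].
  by apply: filterS3 n1 n2 n3 => s h1 h2 h3; split.
have dgc : \forall s \near 0, derive1 (fun s => g (c s)) s = gdir (ode_curve t zeta ups s)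
    (derive1 zeta s).
  apply: filterS near_c => s [h1 h2 h3].
  by apply: etrans (derive1_comp_curve (sc s h1 h2) h3) _; rewrite dc.
have agz : agree k (derive1 zeta) (fun s => gdir (ode_curve t zeta ups s) (derive1 zeta s)) 0.
  exact: agree_trans ag (near_agree dgc).
have sgc : smooth_at (fun s => gdir (ode_curve t zeta ups s) (derive1 zeta s)) 0.
  apply: (smooth_at_ext dgc); apply: smooth_at_derive1.
  exact: (smooth_at_comp sg (sc 0 sz su)).
have sF' := sF; rewrite jet0_lift in sF'.
have sr : smooth_at (residual A t zeta ups) 0 by exact: smooth_at_residual.
have RE : (fun s => reduced_map (ode_curve t zeta ups s, derive1 zeta s)) =
    fun s => row_mx (residual A t zeta ups s) (derive1 zeta s - gdir (ode_curve t zeta ups s)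
        (derive1 zeta s)).
  apply/funext => s; rewrite /reduced_map /residual /=; congr (row_mx (dae_F A (_, _, _, _)) _).
  by apply/rowP => j; rewrite !mxE.
have sd := smooth_at_sub szd sgc.
split; first by rewrite RE; exact: smooth_at_row_mx.
rewrite RE; have -> : cst 0 = fun s : R => row_mx ((cst 0 : R -> 'rV[R]_n) s) ((cst 0 : R ->
    'rV[R]_n) s).
  by apply/funext => s; rewrite row_mx0.
apply: agree_row_mx => //; [exact: smooth_at_cst|exact: smooth_at_cst|].
have -> : (cst 0 : R -> 'rV[R]_n) = fun s => gdir (ode_curve t zeta ups s) (derive1 zeta s) +
    - gdir (ode_curve t zeta ups s) (derive1 zeta s) by apply/funext => s; rewrite subrr.
by apply: agree_add => //; exact: smooth_at_opp.
Qed.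

End Reduced.

End ExplicitODE.

Arguments ode_curve {R n m} mu t zeta ups s.

Section ODE.
Context {R : realType} {n m mu : nat}.
Variables (T : R) (A : dae R n m).
Hypotheses (T_gt0 : 0 < T) (sA : smooth_dae T A).
Notation jet := (@jet R n m mu).
Notation Umx := 'M[R]_(mu.+1, m).
Notation P := (R * 'rV[R]_n * Umx * Umx)%type.
Notation Y := (jet * Umx)%type.

Lemma smooth_at_ode_curve (t : R) (zeta : R -> 'rV[R]_n) (ups : R -> 'rV[R]_m) s :
  smooth_at zeta s -> smooth_at ups s -> smooth_at (ode_curve mu t zeta ups) s.
Proof.
move=> sz su; apply: smooth_at_pair; first apply: smooth_at_pair; first apply: smooth_at_pair
    => //.
- exact: smooth_at_shift.
- by apply: smooth_at_rows => i; exact: smooth_at_derive1n.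
- by apply: smooth_at_rows => i; exact: (smooth_at_derive1n i.+1 su).
Qed.

(** The base curve must satisfy the equation to order mu + 2: this makes the
    differentiated constraint hold at the base point, so that h is the inverse
    function f of [reduced_map] at the value 0. *)
Theorem explicit_ode a d (t0 : R) (zeta0 : R -> 'rV[R]_n) (ups0 : R -> 'rV[R]_m) :
  hypothesis_H T A mu a d -> smooth_at zeta0 0 -> smooth_at ups0 0 ->
  dae_dom T A (t0, zeta0 0, derive1 zeta0 0, ups0 0) ->
  agree (mu + 2) (residual A t0 zeta0 ups0) (cst 0) 0 ->
  exists h : P -> 'rV[R]_n, smooth_at h (ode_curve mu t0 zeta0 ups0 0) /\
    \forall y \near (jet_lift mu t0 zeta0 ups0 0, \matrix_(k < mu.+1) derive1n k.+1 ups0 0),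
      forall (t : R) (zeta : R -> 'rV[R]_n) (ups : R -> 'rV[R]_m) k,
        t \in `[0, T] -> smooth_at zeta 0 -> smooth_at ups 0 ->
        (jet_lift mu t zeta ups 0, \matrix_(k < mu.+1) derive1n k.+1 ups 0) = y ->
        agree (mu + k.+1) (residual A t zeta ups) (cst 0) 0 ->
        agree k (derive1 zeta) (fun s => h (ode_curve mu t zeta ups s)) 0.
Proof.
move=> H sz0 su0 dom0 ar0.
pose x0 : jet := jet_lift mu t0 zeta0 ups0 0.
have dom : dae_dom T A (jet0 x0) by rewrite jet0_lift addr0.
have sF0 : smooth_at (dae_F A) (jet0 x0) by exact: (dom_smooth sA dom).
have aD := agree_deriv_array sz0 su0 sF0 ar0.
have Mx0 : array_set T A x0 by split=> //; exact: (aD 0 isT).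
have tT0 : t0 \in `[0, T] by case: dom0.
have [dE an [ZA [TA [sTA reg]]]] := hypothesis_H_regular H Mx0.
have [B [g [sg inj crv]]] := constraint_function dE an T_gt0 sA Mx0 sTA reg.
have sF0' : smooth_at (dae_F A) (jet0 (jet_lift mu t0 zeta0 ups0 0)) by [].
have ar1 : agree 1 (residual A t0 zeta0 ups0) (cst 0) 0 by apply: agreeW ar0; rewrite addn2.
have az0 := nbhs_singleton crv _ _ _ _ tT0 sz0 su0 erefl aD.
(* The base curve itself satisfies the differentiated constraint at time 0. *)
have [_ /(_ 0 isT) red0] := reduced_map_curve tT0 sz0 su0 sF0' sg az0 ar1.
pose b0 := ode_curve mu t0 zeta0 ups0 0.
pose p0 := jdz x0.
have jdzE (t : R) (zeta : R -> 'rV[R]_n) (ups : R -> 'rV[R]_m) : jdz (jet_lift mu t zeta ups 0)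
    = derive1 zeta 0.
  by apply/rowP => j; rewrite !mxE.
have {}red0 : reduced_map A B g (b0, p0) = 0 by rewrite /p0 jdzE; exact: red0.
have sR : smooth_at (reduced_map A B g) (b0, p0) by exact: smooth_at_reduced_map.
have injR v : 'D_(0, v) (reduced_map A B g) (b0, p0) = 0 -> v = 0.
  exact: (reduced_map_injective (y := b0) (p := p0) sF0 sg inj).
have [f [sf _ F1 _]] := inverse_function _ sR injR.
rewrite red0 in sf.
have sl : smooth_at (fun y : P => (y, 0 : 'rV[R]_(n + n))) b0.
  by apply: smooth_at_pair; [exact: smooth_at_id|exact: smooth_at_cst].
exists (fun y => f (y, 0)); split; first exact: (smooth_at_comp sf sl).
pose y0 : Y := (x0, \matrix_(k < mu.+1) derive1n k.+1 ups0 0).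
pose Po (y : Y) : P := (jt y.1, jz y.1, jU y.1, y.2).
have sPo y : smooth_at Po y by exact: smooth_at_linear.
pose Pp (y : Y) : P * 'rV[R]_n := (Po y, jdz y.1).
have sPp y : smooth_at Pp y.
  apply: smooth_at_pair => //; apply: smooth_at_linear => c u v.
  by rewrite /jdz /jeta /= linearP.
have lfst : linear (fun y : Y => y.1) by move=> c u v.
have sfst (y : Y) : smooth_at (fun y : Y => y.1) y.
  exact: (smooth_at_linear y lfst).
have sP0 y : smooth_at (fun y : Y => (Po y, 0 : 'rV[R]_(n + n))) y.
  by apply: smooth_at_pair => //; exact: smooth_at_cst.
pose CP (x : jet) := forall (t : R) (zeta : R -> 'rV[R]_n) (ups : R -> 'rV[R]_m) k,
  t \in `[0, T] -> smooth_at zeta 0 -> smooth_at ups 0 -> jet_lift mu t zeta ups 0 = x ->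
  agree k (fun s => deriv_array A (jet_lift mu t zeta ups s)) (cst 0) 0 ->
  agree k zeta (fun s => g (qjet (jet_lift mu t zeta ups s), zeta s *m B)) 0.
have N1 : \forall y \near y0, CP y.1.
  exact: (continuous_near (P := CP) (sfst y0) crv).
have N2 : \forall y \near y0, smooth_at (dae_F A) (jet0 y.1).
  have sJ : smooth_at (fun y : Y => jet0 y.1) y0.
    apply: (smooth_at_linear_comp (f := fun y : Y => y.1)) => //.
    exact: jet0_linear.
  exact: (smooth_at_continuous sJ (smooth_at_near sF0)).
have N3 : \forall y \near y0, smooth_at g (qjet y.1, jz y.1 *m B).
  have sJ : smooth_at (fun y : Y => (qjet y.1, jz y.1 *m B)) y0.
    apply: smooth_at_pair; first exact: smooth_at_linear.
    by apply: smooth_at_mulmx; [exact: smooth_at_linear|exact: smooth_at_cst].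
  exact: (smooth_at_continuous sJ (smooth_at_near sg)).
have N4 : \forall y \near y0, \forall x \near Pp y, f (x.1, reduced_map A B g x) = x.2.
  exact: (smooth_at_continuous (sPp y0) (near_join F1)).
have N5 : \forall y \near y0, smooth_at f (Po y, 0).
  exact: (smooth_at_continuous (sP0 y0) (smooth_at_near sf)).
pose CC (y : Y) := forall (t : R) (zeta : R -> 'rV[R]_n) (ups : R -> 'rV[R]_m) k,
  t \in `[0, T] -> smooth_at zeta 0 -> smooth_at ups 0 ->
  (jet_lift mu t zeta ups 0, \matrix_(k < mu.+1) derive1n k.+1 ups 0) = y ->
  agree (mu + k.+1) (residual A t zeta ups) (cst 0) 0 ->
  agree k (derive1 zeta) (fun s => f (ode_curve mu t zeta ups s, 0)) 0.
suff N : nbhs y0 [set y | CC y] by exact: N.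
have HH : forall y, CP y.1 -> smooth_at (dae_F A) (jet0 y.1) ->
    smooth_at g (qjet y.1, jz y.1 *m B) ->
    (\forall x \near Pp y, f (x.1, reduced_map A B g x) = x.2) ->
    smooth_at f (Po y, 0) -> CC y; last first.
  have N12 : \forall y \near y0, CP y.1 /\ smooth_at (dae_F A) (jet0 y.1).
    exact: (filterI N1 N2).
  have N34 : \forall y \near y0, smooth_at g (qjet y.1, jz y.1 *m B) /\
      (\forall x \near Pp y, f (x.1, reduced_map A B g x) = x.2).
    exact: (filterI N3 N4).
  by apply: filterS3 N12 N34 N5 => y [h1 h2] [h3 h4] h5; exact: HH.
move=> {N1 N2 N3 N4 N5} y h1 h2 h3 h4 h5.
move=> t zeta ups [//|k] tT sz su yE ar.
move: h1 h2 h3 h4 h5; rewrite -yE /= => h1 h2 h3 h4 h5.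
have arD : agree (mu + k.+2) (residual A t zeta ups) (cst 0) 0 by [].
have ar' : agree k.+1 (residual A t zeta ups) (cst 0) 0.
  by apply: agreeW ar; rewrite addnS leqW // leq_addl.
have az := h1 _ _ _ _ tT sz su erefl (agree_deriv_array sz su h2 arD).
have [sred ared] := reduced_map_curve tT sz su h2 h3 az ar'.
have sode := smooth_at_ode_curve t sz su.
pose c1 s := (ode_curve mu t zeta ups s, reduced_map A B g (ode_curve mu t zeta ups s, derive1
    zeta s)).
pose c2 s := (ode_curve mu t zeta ups s, (cst 0 : R -> 'rV[R]_(n + n)) s).
have ac : agree k.+1 c1 c2 0.
  by apply: agree_pair => //; exact: smooth_at_cst.
have c10 : c1 0 = c2 0 by exact: (ac 0 isT).
have sc1 : smooth_at c1 0 by exact: smooth_at_pair.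
have sc2 : smooth_at c2 0 by apply: smooth_at_pair => //; exact: smooth_at_cst.
have sfc : smooth_at f (c1 0) by rewrite c10.
apply: agree_trans (agree_comp _ sc1 sc2 sfc c10 ac).
apply: near_agree.
have sop : smooth_at (fun s => (ode_curve mu t zeta ups s, derive1 zeta s)) 0.
  by apply: smooth_at_pair => //; exact: smooth_at_derive1.
have : \forall s \near 0, f (ode_curve mu t zeta ups s, reduced_map A B g (ode_curve mu t zeta
    ups s, derive1 zeta s)) = derive1 zeta s.
  apply: (continuous_near (P := fun x => f (x.1, reduced_map A B g x) = x.2) sop).
  by move: h4; rewrite /Pp /= jdzE.
by apply: filterS => s ->.
Qed.

End ODE.

(** * Curves through a jet *)
Section JointJets.
Context {R : realType}.
Implicit Types V W Q : normedModType R.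

Lemma smooth_at_slice_joint Q W (H : Q * R -> W) q0 (s0 : R) j {fQ : findim Q} :
  smooth_at H (q0, s0) ->
  smooth_at (fun x : Q * R => derive1n j (fun s => H (x.1, s)) x.2) (q0, s0).
Proof.
move=> sH; have [_ sj] := derive1n_slice j sH.
apply: (smooth_at_ext _ sj); have := smooth_at_near sH.
by apply: filterS => -[q s] /= /(derive1n_slice j)[].
Qed.

Lemma smooth_at_slice_point Q W (H : Q * R -> W) q (s : R) {fQ : findim Q} :
  smooth_at H (q, s) -> smooth_at (fun s => H (q, s)) s.
Proof.
move=> sH; apply: (smooth_at_comp (g := H) (f := fun s => (q, s))) => //.
by apply: smooth_at_pair; [exact: smooth_at_cst|exact: smooth_at_id].
Qed.

Lemma smooth_at_ode_joint Q n m mu (t : Q -> R) (Z : Q * R -> 'rV[R]_n) (Y : Q * R -> 'rV[R]_m)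
    (q0 : Q) (s0 : R) {fQ : findim Q} :
  smooth_at t q0 -> smooth_at Z (q0, s0) -> smooth_at Y (q0, s0) ->
  smooth_at (fun x : Q * R => ode_curve mu (t x.1) (fun s => Z (x.1, s)) (fun s => Y (x.1, s))
      x.2) (q0, s0).
Proof.
move=> st sZ sY; apply: smooth_at_pair; first apply: smooth_at_pair; first apply:
    smooth_at_pair.
- apply: smooth_at_add; last exact: smooth_at_linear.
  by apply: (smooth_at_comp (g := t) (f := fst)) => //; exact: smooth_at_linear.
- by apply: smooth_at_eq sZ => -[].
- by apply: smooth_at_rows => i; exact: (smooth_at_slice_joint i sY).
- by apply: smooth_at_rows => i; exact: (smooth_at_slice_joint i.+1 sY).
Qed.

Lemma smooth_at_jet_joint Q n m mu (t : Q -> R) (Z : Q * R -> 'rV[R]_n) (Y : Q * R -> 'rV[R]_m)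
    (q0 : Q) {fQ : findim Q} :
  smooth_at t q0 -> smooth_at Z (q0, 0) -> smooth_at Y (q0, 0) ->
  smooth_at (fun q => (jet_lift mu (t q) (fun s => Z (q, s)) (fun s => Y (q, s)) 0,
    \matrix_(k < mu.+1) derive1n k.+1 (fun s => Y (q, s)) 0)) q0.
Proof.
move=> st sZ sY; apply: smooth_at_pair.
  apply: smooth_at_pair; first apply: smooth_at_pair; first apply: smooth_at_pair.
  - by apply: smooth_at_add => //; exact: smooth_at_cst.
  - exact: (smooth_at_slice 0 sZ).
  - by apply: smooth_at_rows => i; exact: (smooth_at_slice i.+1 sZ).
  - by apply: smooth_at_rows => i; exact: (smooth_at_slice i sY).
by apply: smooth_at_rows => i; exact: (smooth_at_slice i.+1 sY).
Qed.

Section JetCurves.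
Variables (n m l : nat).
Notation jet := (@jet R n m l).

(** Polynomial curves with prescribed jets; they depend linearly on the jet. *)
Definition jet_zeta (x : jet) (s : R) : 'rV[R]_n :=
  tpoly l.+2 (fun i => if i is j.+1 then row (inord j) (jeta x) else jz x) s.

Definition jet_ups (U : 'M[R]_(l.+1, m)) (s : R) : 'rV[R]_m :=
  tpoly l.+1 (fun j => row (inord j) U) s.

Lemma smooth_at_jet_zeta (x : jet) (s : R) :
  smooth_at (fun y : jet * R => jet_zeta y.1 y.2) (x, s).
Proof.
apply: (@smooth_at_tpoly R _ _ l.+2
  (fun i (y : jet * R) => if i is j.+1 then row (inord j) (jeta y.1) else jz y.1)
  (fun y => y.2)); last exact: smooth_at_linear.
case=> [|i]; first exact: smooth_at_linear.
by apply: smooth_at_linear => c u v; rewrite /jeta /= linearP.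
Qed.

Lemma smooth_at_jet_ups (U : 'M[R]_(l.+1, m)) (s : R) :
  smooth_at (fun y : 'M[R]_(l.+1, m) * R => jet_ups y.1 y.2) (U, s).
Proof.
apply: (@smooth_at_tpoly R _ _ l.+1 (fun i (y : 'M[R]_(l.+1, m) * R) => row (inord i) y.1)
  (fun y => y.2)); last exact: smooth_at_linear.
by move=> i; apply: smooth_at_linear => c u v; rewrite /= linearP.
Qed.

Lemma jet_lift_curves (x : jet) : jet_lift l (jt x) (jet_zeta x) (jet_ups (jU x)) 0 = x.
Proof.
rewrite [RHS]jetE /jet_lift addr0; congr (_, _, _, _).
- exact: (@derive1n_tpoly _ _ l.+2 _ 0).
- apply/row_matrixP => i; rewrite rowK.
  apply: etrans (@derive1n_tpoly _ _ l.+2 _ i.+1 (ltn_ord i)) _.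
  by rewrite /= inord_val.
- apply/row_matrixP => i; rewrite rowK.
  apply: etrans (@derive1n_tpoly _ _ l.+1 _ i (ltn_ord i)) _.
  by rewrite inord_val.
Qed.

Lemma jet_ups0 (U : 'M[R]_(l.+1, m)) : jet_ups U 0 = row ord0 U.
Proof.
apply: etrans (@derive1n_tpoly _ _ l.+1 _ 0 isT) _.
by congr (row _ U); apply: val_inj; rewrite /= inordK.
Qed.

Lemma jet_zeta0 (x : jet) : jet_zeta x 0 = jz x.
Proof. exact: (@derive1n_tpoly _ _ l.+2 _ 0). Qed.

Lemma derive1_jet_zeta0 (x : jet) : derive1 (jet_zeta x) 0 = jdz x.
Proof.
apply: etrans (@derive1n_tpoly _ _ l.+2 _ 1 isT) _.
by congr (row _ _); apply: val_inj; rewrite /= inordK.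
Qed.

Variable A : dae R n m.

(** The rows of the vanishing array are the derivatives of the residual. *)
Lemma residual_agree (x : jet) : smooth_at (dae_F A) (jet0 x) -> deriv_array A x = 0 ->
  agree l.+1 (residual A (jt x) (jet_zeta x) (jet_ups (jU x))) (cst 0) 0.
Proof.
move=> sF Dx j jl.
have sz : smooth_at (jet_zeta x) 0 by exact: (smooth_at_slice_point (smooth_at_jet_zeta x 0)).
have su : smooth_at (jet_ups (jU x)) 0 by exact: (smooth_at_slice_point (smooth_at_jet_ups (jU
    x) 0)).
have sF' : smooth_at (dae_F A) (jet0 (jet_lift l (jt x) (jet_zeta x) (jet_ups (jU x)) 0)).
  by rewrite jet_lift_curves.
rewrite jet0_lift in sF'.
have := deriv_array_lift l sz su sF'; rewrite jet_lift_curves Dx => /(congr1 vec_mx).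
rewrite mxvecK linear0 => /matrixP M0.
rewrite derive1n_cst0; apply/rowP => i.
by have := M0 (Ordinal jl) i; rewrite !mxE.
Qed.

End JetCurves.
End JointJets.

(** * The hybrid system *)
Section Hybrid.
Context {R : realType} {n1 n2 m1 m2 mu1 mu2 : nat}.
Variables (T tau : R) (A1 : dae R n1 m1) (A2 : dae R n2 m2).
Variables (G1 : R * 'rV[R]_n1 -> 'rV[R]_m2) (G2 : R * 'rV[R]_n2 -> 'rV[R]_m1).
Hypotheses (T_gt0 : 0 < T).
Hypotheses (sA1 : smooth_dae T A1) (sA2 : smooth_dae T A2).
Hypothesis sG1 : smooth_on [set x | x.1 \in `[0, T] /\ dom_z A1 x.2] G1.
Hypothesis sG2 : smooth_on [set x | (x.1 \in `[0, T] \/ x.1 + tau \in `[0, T]) /\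
                                  dom_z A2 x.2] G2.
Hypothesis G1_dom : forall t z, t \in `[0, T] -> dom_z A1 z -> dom_u A2 (G1 (t, z)).
Hypothesis G2_dom : forall t z, t \in `[0, T] -> dom_z A2 z -> dom_u A1 (G2 (t - tau, z)).

Notation N := (mu1 + mu2 + 1)%N.
Notation nn := (n1 + n2)%N.
Notation H := (hybrid_dae tau A1 A2 G1 G2).
Notation X := (@jet R nn nn N).
Notation Q := (R * 'rV[R]_nn * 'M[R]_(N.+1, nn))%type.

Notation J4 := (R * 'rV[R]_nn * 'rV[R]_nn * 'rV[R]_nn)%type.

Definition jet_params (x : X) : Q := (jt x, jz x, jU x).
Definition state1 (x : X) (s : R) : 'rV[R]_n1 := lsubmx (jet_zeta x s).
Definition state2 (x : X) (s : R) : 'rV[R]_n2 := rsubmx (jet_zeta x s).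
(** The input of the first subsystem is a function of (t, U) alone, because it is
    evaluated at the delayed state. *)
Definition input1 (q : Q) (s : R) : 'rV[R]_m1 := G2 (q.1.1 + s - tau, rsubmx (jet_ups q.2 s)).
Definition input2 (x : X) (s : R) : 'rV[R]_m2 := G1 (jt x + s, state1 x s).

Lemma eq_rows p q (c c' : 'I_p -> 'rV[R]_q) : c =1 c' ->
  \matrix_i c i = \matrix_i c' i.
Proof. by move=> h; apply/matrixP => i j; rewrite !mxE h. Qed.

Lemma smooth_at_G1 t z : t \in `[0, T] -> dom_z A1 z -> smooth_at G1 (t, z).
Proof. by move=> tT dz; apply: (smooth_at_on sG1). Qed.

Lemma smooth_at_G2 t z : t \in `[0, T] -> dom_z A2 z -> smooth_at G2 (t - tau, z).
Proof. by move=> tT dz; apply: (smooth_at_on sG2); split => //=; right; rewrite subrK. Qed.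

Lemma hybrid_smooth p : dae_dom T H p -> smooth_at (dae_F H) p.
Proof.
have E : dae_F H = fun x => row_mx
    (dae_F A1 (x.1.1.1, lsubmx x.1.1.2, lsubmx x.1.2, G2 (x.1.1.1 - tau, rsubmx x.2)))
    (dae_F A2 (x.1.1.1, rsubmx x.1.1.2, rsubmx x.1.2, G1 (x.1.1.1, lsubmx x.1.1.2))).
  by apply/funext => -[[[t' z'] p'] u'].
rewrite E; move: p => [[[t z] p] u] [tT [z1 z2] [p1 p2] [u1 u2]]; set x0 := (t, z, p, u).
have st : smooth_at (fun x : J4 => x.1.1.1) x0.
  exact: smooth_at_linear.
have sz1 : smooth_at (fun x : J4 => lsubmx x.1.1.2) x0.
  by apply: smooth_at_linear => c v w; rewrite /= linearP.
have sz2 : smooth_at (fun x : J4 => rsubmx x.1.1.2) x0.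
  by apply: smooth_at_linear => c v w; rewrite /= linearP.
have sp1 : smooth_at (fun x : J4 => lsubmx x.1.2) x0.
  by apply: smooth_at_linear => c v w; rewrite /= linearP.
have sp2 : smooth_at (fun x : J4 => rsubmx x.1.2) x0.
  by apply: smooth_at_linear => c v w; rewrite /= linearP.
have su2 : smooth_at (fun x : J4 => rsubmx x.2) x0.
  by apply: smooth_at_linear => c v w; rewrite /= linearP.
have stt := smooth_at_sub st (smooth_at_cst tau x0).
have sg2 : smooth_at (fun x : J4 => G2 (x.1.1.1 - tau, rsubmx x.2)) x0.
  exact: (smooth_at_comp (g := G2) (f := fun x : J4 => (x.1.1.1 - tau, rsubmx x.2))
    (smooth_at_G2 tT u2) (smooth_at_pair stt su2)).
have sg1 : smooth_at (fun x : J4 => G1 (x.1.1.1, lsubmx x.1.1.2)) x0.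
  exact: (smooth_at_comp (g := G1) (f := fun x : J4 => (x.1.1.1, lsubmx x.1.1.2))
    (smooth_at_G1 tT z1) (smooth_at_pair st sz1)).
have sF1 : smooth_at (dae_F A1) (t, lsubmx z, lsubmx p, G2 (t - tau, rsubmx u)).
  by case: sA1 => _ _ _ s; apply: (smooth_at_on s); split => //=; exact: G2_dom.
have sF2 : smooth_at (dae_F A2) (t, rsubmx z, rsubmx p, G1 (t, lsubmx z)).
  by case: sA2 => _ _ _ s; apply: (smooth_at_on s); split => //=; exact: G1_dom.
have s1 := smooth_at_pair (smooth_at_pair (smooth_at_pair st sz1) sp1) sg2.
have s2 := smooth_at_pair (smooth_at_pair (smooth_at_pair st sz2) sp2) sg1.
apply: smooth_at_row_mx.
- apply: (smooth_at_comp (g := dae_F A1) _ s1); exact: sF1.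
- apply: (smooth_at_comp (g := dae_F A2) _ s2); exact: sF2.
Qed.

Lemma smooth_at_state1 x s : smooth_at (fun y : X * R => state1 y.1 y.2) (x, s).
Proof.
exact: (smooth_at_linear_comp _ (@lsubmx_linear _ _ _) (smooth_at_jet_zeta x s)).
Qed.

Lemma smooth_at_state2 x s : smooth_at (fun y : X * R => state2 y.1 y.2) (x, s).
Proof.
exact: (smooth_at_linear_comp _ (@rsubmx_linear _ _ _) (smooth_at_jet_zeta x s)).
Qed.

Lemma smooth_at_input1 q : q.1.1 \in `[0, T] -> dom_z A2 (rsubmx (row ord0 q.2)) ->
  smooth_at (fun y : Q * R => input1 y.1 y.2) (q, 0).
Proof.
move=> tT dz.
apply: (smooth_at_comp (g := G2) (f := fun y : Q * R => (y.1.1.1 + y.2 - tau, rsubmx (jet_ups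
    y.1.2 y.2)))).
  by rewrite /= addr0 jet_ups0; exact: smooth_at_G2.
apply: smooth_at_pair.
  apply: smooth_at_sub; last exact: smooth_at_cst.
  by apply: smooth_at_add; exact: smooth_at_linear.
apply: (smooth_at_linear_comp (f := fun y : Q * R => jet_ups y.1.2 y.2)).
  exact: rsubmx_linear.
apply: (smooth_at_comp (g := fun y : 'M[R]_(N.+1, nn) * R => jet_ups y.1 y.2)
  (f := fun y : Q * R => (y.1.2, y.2))); first exact: smooth_at_jet_ups.
exact: smooth_at_linear.
Qed.

Lemma smooth_at_jet_params x : smooth_at jet_params x.
Proof. exact: smooth_at_linear. Qed.

Lemma smooth_at_input1x x : jt x \in `[0, T] -> dom_z A2 (rsubmx (ju x)) ->
  smooth_at (fun y : X * R => input1 (jet_params y.1) y.2) (x, 0).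
Proof.
move=> tT dz.
apply: (smooth_at_comp (g := fun y : Q * R => input1 y.1 y.2) (f := fun y : X * R =>
    (jet_params y.1, y.2))).
  exact: smooth_at_input1.
exact: smooth_at_linear.
Qed.

Lemma smooth_at_input2 x : jt x \in `[0, T] -> dom_z A1 (lsubmx (jz x)) ->
  smooth_at (fun y : X * R => input2 y.1 y.2) (x, 0).
Proof.
move=> tT dz.
apply: (smooth_at_comp (g := G1) (f := fun y : X * R => (jt y.1 + y.2, state1 y.1 y.2))).
  by rewrite /= addr0 /state1 jet_zeta0; exact: smooth_at_G1.
apply: smooth_at_pair; last exact: smooth_at_state1.
by apply: smooth_at_add; exact: smooth_at_linear.
Qed.

Lemma derive1_state1 x s : derive1 (state1 x) s = lsubmx (derive1 (jet_zeta x) s).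
Proof.
have sz : smooth_at (jet_zeta x) s by exact: (smooth_at_slice_point (smooth_at_jet_zeta x s)).
rewrite !derive1E.
exact: (derive_linear (1 : R) _ (@lsubmx_linear _ _ _) (smooth_at_differentiable sz)).
Qed.

Lemma derive1_state2 x s : derive1 (state2 x) s = rsubmx (derive1 (jet_zeta x) s).
Proof.
have sz : smooth_at (jet_zeta x) s by exact: (smooth_at_slice_point (smooth_at_jet_zeta x s)).
rewrite !derive1E.
exact: (derive_linear (1 : R) _ (@rsubmx_linear _ _ _) (smooth_at_differentiable sz)).
Qed.

Lemma hybrid_dom x : array_set T H x ->
  [/\ jt x \in `[0, T],
      dae_dom T A1 (jt x, state1 x 0, derive1 (state1 x) 0, input1 (jet_params x) 0),
      dae_dom T A2 (jt x, state2 x 0, derive1 (state2 x) 0, input2 x 0),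
      dom_z A1 (lsubmx (jz x)) & dom_z A2 (rsubmx (ju x))].
Proof.
move=> [[/= tT [z1 z2] [p1 p2] [u1 u2]] _].
rewrite derive1_state1 derive1_state2 derive1_jet_zeta0 /state1 /state2 /input1 /input2 /state1.
rewrite jet_zeta0 /= jet_ups0 addr0.
by split => //; split => //=; [exact: G2_dom|exact: G1_dom].
Qed.

Lemma hybrid_residual x : array_set T H x ->
  agree N.+1 (residual A1 (jt x) (state1 x) (input1 (jet_params x))) (cst 0) 0 /\
  agree N.+1 (residual A2 (jt x) (state2 x) (input2 x)) (cst 0) 0.
Proof.
move=> [dom Dx]; have sF := hybrid_smooth dom.
have ar := residual_agree sF Dx.
have sz : smooth_at (jet_zeta x) 0 by exact: (smooth_at_slice_point (smooth_at_jet_zeta x 0)).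
have su : smooth_at (jet_ups (jU x)) 0 by exact: (smooth_at_slice_point (smooth_at_jet_ups (jU
    x) 0)).
have sF' : smooth_at (dae_F H) (jt x + 0, jet_zeta x 0, derive1 (jet_zeta x) 0, jet_ups (jU x)
    0).
  by rewrite addr0 jet_zeta0 derive1_jet_zeta0 jet_ups0.
have sr := smooth_at_residual sz su sF'.
have rE s : residual H (jt x) (jet_zeta x) (jet_ups (jU x)) s =
   row_mx (residual A1 (jt x) (state1 x) (input1 (jet_params x)) s) (residual A2 (jt x) (state2
       x) (input2 x) s).
  by rewrite /residual derive1_state1 derive1_state2.
split.
- have := agree_linear _ (@lsubmx_linear _ n1 n2) sr (smooth_at_cst 0 0) ar.
  have -> : (fun s => lsubmx (residual H (jt x) (jet_zeta x) (jet_ups (jU x)) s)) =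
      residual A1 (jt x) (state1 x) (input1 (jet_params x)).
    by apply/funext => s; rewrite rE row_mxKl.
  have -> : (fun s : R => lsubmx ((cst 0 : R -> 'rV[R]_nn) s)) = cst 0.
    by apply/funext => s; rewrite /= linear0.
  by apply; exact: findim_mx.
- have := agree_linear _ (@rsubmx_linear _ n1 n2) sr (smooth_at_cst 0 0) ar.
  have -> : (fun s => rsubmx (residual H (jt x) (jet_zeta x) (jet_ups (jU x)) s)) =
      residual A2 (jt x) (state2 x) (input2 x).
    by apply/funext => s; rewrite rE row_mxKr.
  have -> : (fun s : R => rsubmx ((cst 0 : R -> 'rV[R]_nn) s)) = cst 0.
    by apply/funext => s; rewrite /= linear0.
  by apply; exact: findim_mx.
Qed.

Section Local.
Variables (a1 d1 a2 d2 : nat).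
Hypotheses (H1 : hypothesis_H T A1 mu1 a1 d1) (H2 : hypothesis_H T A2 mu2 a2 d2).
Variable x0 : X.
Hypothesis Mx0 : array_set T H x0.
Let q0 := jet_params x0.

Let smooth_state1 x s : smooth_at (state1 x) s.
Proof. exact: (smooth_at_slice_point (smooth_at_state1 x s)). Qed.
Let smooth_state2 x s : smooth_at (state2 x) s.
Proof. exact: (smooth_at_slice_point (smooth_at_state2 x s)). Qed.

Let smooth_input1 x : array_set T H x -> smooth_at (input1 (jet_params x)) 0.
Proof.
move=> /hybrid_dom[tT _ _ _ du].
exact: (smooth_at_slice_point (smooth_at_input1 (q := jet_params x) tT du)).
Qed.

Let smooth_input2 x : array_set T H x -> smooth_at (input2 x) 0.
Proof.
move=> /hybrid_dom[tT _ _ dz _].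
exact: (smooth_at_slice_point (smooth_at_input2 tT dz)).
Qed.

Let smooth_jt x : smooth_at (fun x : X => jt x) x.
Proof. exact: smooth_at_linear. Qed.

(** [explicit_ode] with k = mu2 + 1, which N allows:
    mu1 + (mu2 + 1) + 1 = N + 1. *)
Lemma subsystem1_ode :
  exists h : R * 'rV[R]_n1 * 'M[R]_(mu1.+1, m1) * 'M[R]_(mu1.+1, m1) -> 'rV[R]_n1,
    smooth_at h (ode_curve mu1 (jt x0) (state1 x0) (input1 (jet_params x0)) 0) /\
    \forall x \near x0, array_set T H x ->
      agree mu2.+1 (derive1 (state1 x))
        (fun s => h (ode_curve mu1 (jt x) (state1 x) (input1 (jet_params x)) s)) 0.
Proof.
have [tT dom1 _ _ du] := hybrid_dom Mx0; have [ar _] := hybrid_residual Mx0.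
have ar2 : agree (mu1 + 2) (residual A1 (jt x0) (state1 x0) (input1 (jet_params x0))) (cst 0) 0.
  by apply: agreeW ar; lia.
have [h [sh nh]] := explicit_ode T_gt0 sA1 H1 (smooth_state1 x0 0) (smooth_input1 Mx0) dom1 ar2.
exists h; split => //.
have sj : smooth_at (fun x : X => (jet_lift mu1 (jt x) (state1 x) (input1 (jet_params x)) 0,
    \matrix_(k < mu1.+1) derive1n k.+1 (input1 (jet_params x)) 0)) x0.
  exact: (smooth_at_jet_joint mu1 (smooth_jt x0) (smooth_at_state1 x0 0) (smooth_at_input1x tT
      du)).
move: (continuous_near sj nh); apply: filterS => x hx Mx; have [tTx _ _ _ _] := hybrid_dom Mx.
have [arx _] := hybrid_residual Mx.
apply: (hx (jt x) (state1 x) (input1 (jet_params x)) mu2.+1) => //.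
  exact: smooth_input1.
by apply: agreeW arx; lia.
Qed.

(** [explicit_ode] with k = 1 suffices, as only z2' itself is wanted. *)
Lemma subsystem2_ode :
  exists h : R * 'rV[R]_n2 * 'M[R]_(mu2.+1, m2) * 'M[R]_(mu2.+1, m2) -> 'rV[R]_n2,
    smooth_at h (ode_curve mu2 (jt x0) (state2 x0) (input2 x0) 0) /\
    \forall x \near x0, array_set T H x ->
      derive1 (state2 x) 0 = h (ode_curve mu2 (jt x) (state2 x) (input2 x) 0).
Proof.
have [tT _ dom2 dz _] := hybrid_dom Mx0; have [_ ar] := hybrid_residual Mx0.
have ar2 : agree (mu2 + 2) (residual A2 (jt x0) (state2 x0) (input2 x0)) (cst 0) 0.
  by apply: agreeW ar; lia.
have [h [sh nh]] := explicit_ode T_gt0 sA2 H2 (smooth_state2 x0 0) (smooth_input2 Mx0) dom2 ar2.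
exists h; split => //.
have sj : smooth_at (fun x : X => (jet_lift mu2 (jt x) (state2 x) (input2 x) 0,
    \matrix_(k < mu2.+1) derive1n k.+1 (input2 x) 0)) x0.
  exact: (smooth_at_jet_joint mu2 (smooth_jt x0) (smooth_at_state2 x0 0) (smooth_at_input2 tT
      dz)).
move: (continuous_near sj nh); apply: filterS => x hx Mx; have [tTx _ _ _ _] := hybrid_dom Mx.
have [_ arx] := hybrid_residual Mx.
apply: (hx (jt x) (state2 x) (input2 x) 1 _ _ _ _ _ 0) => //.
  exact: smooth_input2.
by apply: agreeW arx; lia.
Qed.

Let sq0 : smooth_at (fun y : Q * R => input1 y.1 y.2) (q0, 0).
Proof. by have [tT _ _ _ du] := hybrid_dom Mx0; exact: smooth_at_input1. Qed.

(** If the Taylor polynomial Z of z1 is known to order j as a smooth function of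
    (t, z, U), then the right-hand side of the explicit equation along Z agrees
    with the one along z1 to order j, and its derivatives are the next Taylor
    coefficients of z1. *)
Lemma state1_determined j : (j <= mu2.+1)%N ->
  exists Z : Q * R -> 'rV[R]_n1, smooth_at Z (q0, 0) /\
    \forall x \near x0, array_set T H x -> agree j.+1 (state1 x) (fun s => Z (jet_params x, s))
        0.
Proof.
have [h [sh nh]] := subsystem1_ode.
elim: j => [_|j IH jmu].
  exists (fun y => lsubmx y.1.1.2); split.
    by apply: smooth_at_linear => c u v; rewrite /= linearP.
  have E (x : X) : array_set T H x ->
      agree 1 (state1 x) (fun s => lsubmx (jet_params x, s).1.1.2) 0.
    move=> _; apply/agreeS; split; first exact: (congr1 lsubmx (jet_zeta0 x)).
    exact: agree0.
  exact: (@filterE _ (nbhs x0) _ _ E).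
have [Z [sZ nZ]] := IH (ltnW jmu).
pose C (q : Q) (s : R) := ode_curve mu1 q.1.1 (fun s => Z (q, s)) (input1 q) s.
have sC : smooth_at (fun y : Q * R => C y.1 y.2) (q0, 0).
  have st : smooth_at (fun q : Q => q.1.1) q0 by exact: smooth_at_linear.
  exact: (smooth_at_ode_joint mu1 st sZ sq0).
have nZ0 : agree j.+1 (state1 x0) (fun s => Z (jet_params x0, s)) 0 by exact: (nbhs_singleton
    nZ Mx0).
have Z0 : Z (q0, 0) = state1 x0 0 by exact: (esym (nZ0 0 isT)).
have C0 : C q0 0 = ode_curve mu1 (jt x0) (state1 x0) (input1 (jet_params x0)) 0.
  by rewrite /C /ode_curve Z0.
have shC : smooth_at (fun y : Q * R => h (C y.1 y.2)) (q0, 0).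
  apply: (smooth_at_comp (g := h) (f := fun y : Q * R => C y.1 y.2)) => //=.
  by rewrite C0.
pose e i (q : Q) := derive1n i (fun s => h (C q s)) 0.
have se i : smooth_at (e i) q0 by exact: (smooth_at_slice i shC).
(* Taylor coefficients: z1 itself, then the derivatives of the right-hand side. *)
pose a (i : nat) (y : Q * R) : 'rV[R]_n1 := if i is i'.+1 then e i' y.1 else lsubmx y.1.1.2.
exists (fun y => tpoly j.+2 (fun i => a i y) y.2); split.
  apply: (@smooth_at_tpoly R _ _ j.+2 a (fun y => y.2)); last exact: smooth_at_linear.
  case=> [|i]; first by apply: smooth_at_linear => c u v; rewrite /= linearP.
  by apply: (smooth_at_comp (g := e i) (f := fst)) => //; exact: smooth_at_linear.
have sqs : smooth_at (fun x : X => (jet_params x, 0 : R)) x0.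
  by apply: smooth_at_pair; [exact: smooth_at_jet_params|exact: smooth_at_cst].
have N1 : \forall x \near x0, smooth_at Z (jet_params x, 0).
  exact: (smooth_at_continuous sqs (smooth_at_near sZ)).
have N2 : \forall x \near x0, smooth_at (fun y : Q * R => C y.1 y.2) (jet_params x, 0).
  exact: (smooth_at_continuous sqs (smooth_at_near sC)).
have N3 : \forall x \near x0, smooth_at h (C (jet_params x) 0).
  have sCx : smooth_at (fun x => C (jet_params x) 0) x0.
    exact: (smooth_at_comp (g := fun y : Q * R => C y.1 y.2) (f := fun x : X => (jet_params x,
        0 : R)) sC sqs).
  apply: (smooth_at_continuous sCx); rewrite /= C0; exact: (smooth_at_near sh).
have N12 : \forall x \near x0, [/\ smooth_at Z (jet_params x, 0),
    smooth_at (fun y : Q * R => C y.1 y.2) (jet_params x, 0) & smooth_at h (C (jet_params x)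
        0)].
  by apply: filterS3 N1 N2 N3 => x k1 k2 k3; split.
apply: filterS3 N12 nZ nh => x [k1 k2 k3] kZ kh Mx.
have agZ := kZ Mx; have agh := agreeW jmu (kh Mx).
have sI := smooth_input1 Mx.
have sc1 := smooth_at_ode_curve (mu := mu1) (jt x) (smooth_state1 x 0) sI.
have sc2 : smooth_at (C (jet_params x)) 0 by exact: (smooth_at_slice_point k2).
have sZx : smooth_at (fun s => Z (jet_params x, s)) 0 by exact: (smooth_at_slice_point k1).
have agC : agree j.+1 (ode_curve mu1 (jt x) (state1 x) (input1 (jet_params x))) (C (jet_params
    x)) 0.
  have st := smooth_at_shift (jt x) 0.
  have sU : smooth_at (fun s => \matrix_(k < mu1.+1) derive1n k (input1 (jet_params x)) s) 0.
    by apply: smooth_at_rows => i; exact: smooth_at_derive1n.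
  have sU' : smooth_at (fun s => \matrix_(k < mu1.+1) derive1n k.+1 (input1 (jet_params x)) s)
      0.
    by apply: smooth_at_rows => i; exact: (smooth_at_derive1n i.+1 sI).
  have p1 := smooth_at_pair st (smooth_state1 x 0); have p2 := smooth_at_pair st sZx.
  apply: agree_pair => //; [exact: smooth_at_pair|exact: smooth_at_pair|].
  by apply: agree_pair => //; apply: agree_pair.
have C00 : ode_curve mu1 (jt x) (state1 x) (input1 (jet_params x)) 0 = C (jet_params x) 0 by
    exact: (agC 0 isT).
have shc : smooth_at h (ode_curve mu1 (jt x) (state1 x) (input1 (jet_params x)) 0) by rewrite
    C00.
have agf := agree_trans agh (agree_comp _ sc1 sc2 shc C00 agC).
move=> i ij; apply: etrans _ (esym (@derive1n_tpoly R _ j.+2 (fun i => a i (jet_params x, 0)) i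
    ij)).
case: i ij => [|i] ij; first by rewrite /state1 /= jet_zeta0.
by rewrite derive1Sn; exact: agf.
Qed.

(** z1' is a Taylor coefficient of Z; the input of the second subsystem and its
    derivatives up to order mu2 + 1 can be computed from Z instead of z1. *)
Lemma hybrid_determines :
  exists U f,
    [/\ nbhs x0 U, exists2 V, nbhs (jt x0, jz x0, jU x0) V & smooth_on V f
      & forall x, array_set T H x -> U x -> jdz x = f (jt x, jz x, jU x)].
Proof.
have [Z [sZ nZ]] := state1_determined (leqnn _).
have [h [sh nh]] := subsystem2_ode.
pose W (y : Q * R) : 'rV[R]_m2 := G1 (y.1.1.1 + y.2, Z y).
pose C (q : Q) := ode_curve mu2 q.1.1 (fun _ => rsubmx q.1.2) (fun s => W (q, s)) 0.
pose f (q : Q) : 'rV[R]_nn := row_mx (derive1n 1 (fun s => Z (q, s)) 0) (h (C q)).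
have [tT _ _ dz _] := hybrid_dom Mx0.
have Z0 : Z (q0, 0) = lsubmx (jz x0).
  have nZ0 : agree mu2.+2 (state1 x0) (fun s => Z (jet_params x0, s)) 0 by exact:
      (nbhs_singleton nZ Mx0).
  by apply: etrans (esym (nZ0 0 isT)) _; rewrite /= /state1 jet_zeta0.
have sW : smooth_at W (q0, 0).
  apply: (smooth_at_comp (g := G1) (f := fun y : Q * R => (y.1.1.1 + y.2, Z y))).
    by rewrite /= Z0 addr0; exact: smooth_at_G1.
  apply: smooth_at_pair => //; apply: smooth_at_add; exact: smooth_at_linear.
have sC : smooth_at C q0.
  have st : smooth_at (fun q : Q => q.1.1) q0 by exact: smooth_at_linear.
  apply: smooth_at_pair; first apply: smooth_at_pair; first apply: smooth_at_pair.
  - by apply: smooth_at_add => //; exact: smooth_at_cst.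
  - by apply: smooth_at_linear => c u v; rewrite /= linearP.
  - by apply: smooth_at_rows => i; exact: (smooth_at_slice i sW).
  - by apply: smooth_at_rows => i; exact: (smooth_at_slice i.+1 sW).
have sqs : smooth_at (fun x : X => (jet_params x, 0 : R)) x0.
  by apply: smooth_at_pair; [exact: smooth_at_jet_params|exact: smooth_at_cst].
have N1 : \forall x \near x0, smooth_at Z (jet_params x, 0).
  exact: (smooth_at_continuous sqs (smooth_at_near sZ)).
have key x : array_set T H x -> smooth_at Z (jet_params x, 0) ->
    agree mu2.+2 (state1 x) (fun s => Z (jet_params x, s)) 0 ->
    ode_curve mu2 (jt x) (state2 x) (input2 x) 0 = C (jet_params x).
  move=> Mx sZx ag; have [tTx _ _ dzx _] := hybrid_dom Mx.
  have sZs : smooth_at (fun s => Z (jet_params x, s)) 0 by exact: (smooth_at_slice_point sZx).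
  have st := smooth_at_shift (jt x) 0.
  have s1 := smooth_at_pair st (smooth_state1 x 0); have s2 := smooth_at_pair st sZs.
  have agp : agree mu2.+2 (fun s => (jt x + s, state1 x s)) (fun s => (jt x + s, Z (jet_params
      x, s))) 0.
    exact: agree_pair.
  have sg : smooth_at G1 (jt x + 0, state1 x 0).
    by rewrite addr0 /state1 jet_zeta0; exact: smooth_at_G1.
  have agW : agree mu2.+2 (input2 x) (fun s => W (jet_params x, s)) 0.
    exact: (agree_comp _ s1 s2 sg (agp 0 isT) agp).
  have e1 : state2 x 0 = rsubmx (jet_params x).1.2 by rewrite /state2 jet_zeta0.
  have e2 : \matrix_(k < mu2.+1) derive1n k (input2 x) 0 =
      \matrix_(k < mu2.+1) derive1n k (fun s => W (jet_params x, s)) 0.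
    apply: eq_rows => i; have li : (i < mu2.+2)%N by exact: ltnW (ltn_ord i).
    exact: (agW i li).
  have e3 : \matrix_(k < mu2.+1) derive1n k.+1 (input2 x) 0 =
      \matrix_(k < mu2.+1) derive1n k.+1 (fun s => W (jet_params x, s)) 0.
    apply: eq_rows => i; have li : (i.+1 < mu2.+2)%N by rewrite ltnS.
    exact: (agW i.+1 li).
  have E (t : R) (u u' : 'rV[R]_n2) (M1 M1' M2 M2' : 'M[R]_(mu2.+1, m2)) :
    u = u' -> M1 = M1' -> M2 = M2' -> (t, u, M1, M2) = (t, u', M1', M2') by move=> -> -> ->.
  exact: (E (jt x + 0) _ _ _ _ _ _ e1 e2 e3).
have C0 : ode_curve mu2 (jt x0) (state2 x0) (input2 x0) 0 = C q0.
  by apply: key => //; exact: (nbhs_singleton nZ Mx0).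
have sf : smooth_at f q0.
  have shC : smooth_at h (C q0) by exact: (eq_ind _ (fun y => smooth_at h y) sh _ C0).
  have shc := smooth_at_comp (g := h) (f := C) shC sC.
  exact: (smooth_at_row_mx (smooth_at_slice 1 sZ) (shc _)).
have good : \forall x \near x0, array_set T H x -> jdz x = f (jt x, jz x, jU x).
  apply: filterS3 nZ nh N1 => x kZ kh k1 Mx.
  have ag := kZ Mx; rewrite /f -(ag 1 isT) -(key x Mx k1 ag) -(kh Mx).
  by rewrite derive1n1 derive1_state1 derive1_state2 derive1_jet_zeta0 hsubmxK.
exists [set x | array_set T H x -> jdz x = f (jt x, jz x, jU x)], f; split.
- exact: good.
- exact: (smooth_at_smooth_on sf).
- by move=> x Mx; apply.
Qed.

End Local.

End Hybrid.

Theorem theorem4p12 (R : realType) (n1 n2 m1 m2 : nat) (T tau : R)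
  (A1 : dae R n1 m1) (A2 : dae R n2 m2)
  (G1 : R * 'rV[R]_n1 -> 'rV[R]_m2) (G2 : R * 'rV[R]_n2 -> 'rV[R]_m1)
  (mu1 mu2 : nat)
  (T_gt0 : 0 < T) (tau_gt0 : 0 < tau)
  (* smoothness of the data *)
  (A1_smooth : smooth_dae T A1) (A2_smooth : smooth_dae T A2)
  (G1_smooth : smooth_on [set x | x.1 \in `[0, T] /\ dom_z A1 x.2] G1)
  (G2_smooth : smooth_on [set x | (x.1 \in `[0, T] \/ x.1 + tau \in `[0, T]) /\
                                  dom_z A2 x.2] G2)
  (* the compositions in the coupled system are defined *)
  (G1_dom : forall t z, t \in `[0, T] -> dom_z A1 z -> dom_u A2 (G1 (t, z)))
  (G2_dom : forall t z, t \in `[0, T] -> dom_z A2 z ->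
              dom_u A1 (G2 (t - tau, z)))
  (A1_regular : regular T A1) (A2_regular : regular T A2)
  (A1_strangeness : strangeness_index T A1 mu1)
  (A2_strangeness : strangeness_index T A2 mu2) :
  exists nu : nat,
    differentiation_index T (hybrid_dae tau A1 A2 G1 G2) nu /\
    (nu <= mu1 + mu2 + 1)%N.
Proof.
have [[a1 [d1 H1]] _] := A1_strangeness; have [[a2 [d2 H2]] _] := A2_strangeness.
pose P (k : nat) := `[< array_determines_dz T (hybrid_dae tau A1 A2 G1 G2) k >].
have PN : P (mu1 + mu2 + 1)%N.
  apply/asboolP => x0 Mx0.
  exact: (hybrid_determines T_gt0 A1_smooth A2_smooth G1_smooth G2_smooth G1_dom G2_dom H1 H2
      Mx0).
have exP : exists k, P k by exists (mu1 + mu2 + 1)%N.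
exists (ex_minn exP); case: ex_minnP => nu /asboolP dnu min; split; last exact: min.
split=> // k knu /asboolP dk.
by have := min k dk; rewrite leqNgt knu.
Qed.
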